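(* Let $G$ be a loopless planar graph. Then $G$ has only real chromatic roots if and only if $G$ has only integral chromatic roots if and only if $G$ is chordal (that is, these three conditions on $G$ are equivalent). Moreover, every chromatic root of such a graph belongs to $\{0,1,2,3\}$.
   Context: All graphs are finite and undirected, and may have loops and parallel edges. A graph is planar if it can be embedded in the plane without edge crossings. The chromatic polynomial $P(G,\lambda)$ of a graph $G$ is the polynomial in $\lambda$ that, for each positive integer $\lambda$, counts the number of proper $\lambda$-colorings of $G$ (maps from the vertex set of $G$ to $\{1,\dots,\lambda\}$ giving different values to the two ends of every edge). The chromatic roots of $G$ are the (complex) roots of $P(G,\lambda)$. A graph is chordal if it is simple (no loops and no parallel edges) and contains no induced cycle of length greater than three.
   Formalization: Since chordal includes simple, the claim fails for two vertices joined by two parallel edges (roots 0 and 1, but not chordal); the formal statement instead asks that the graph obtained from G by merging parallel edges be chordal, which for simple G is the same as G being chordal. *)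

(* Defs.v *)
(* MathComp world, with MathComp-Analysis for the topology of the plane. *)
From HB Require Import structures.
From mathcomp Require Import all_boot all_order all_algebra.
From mathcomp Require Import all_classical all_reals topology normedtype.
From mathcomp Require Import complex.

Set Implicit Arguments.
Unset Strict Implicit.
Unset Printing Implicit Defensive.

Import Order.TTheory GRing.Theory Num.Theory.
Import numFieldNormedType.Exports.

Local Open Scope ring_scope.

(* [ends e] is the set of end-vertices of [e]: a singleton exactly when [e] is
   a loop. Parallel edges are distinct edges with the same value of [ends]. *)
Record mgraph := MGraph {
  vertex : finType;
  edge : finType;
  ends : edge -> {set vertex};
  endsP : forall e, (0 < #|ends e| <= 2)%N
}.

Definition adj (G : mgraph) : rel (vertex G) :=
  fun u v => [exists e : edge G, ends e == [set u; v]].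

Definition loopless (G : mgraph) : Prop :=
  forall e : edge G, #|ends e| = 2%N.

Definition simple (G : mgraph) : Prop :=
  loopless G /\ injective (@ends G).

(* [ordS i] is the cyclic successor of [i] in ['I_n]. *)
Definition induced_cycle (G : mgraph) (n : nat) (c : 'I_n -> vertex G) : Prop :=
  injective c /\
  forall i j : 'I_n, adj (c i) (c j) = (j == ordS i) || (i == ordS j).

Definition chordal (G : mgraph) : Prop :=
  simple G /\
  forall (n : nat) (c : 'I_n -> vertex G), (3 < n)%N -> ~ induced_cycle c.

Section Simplification.
Variable G : mgraph.

Definition simple_edge : finType :=
  {A : {set vertex G} | (A \in codom (@ends G)) && (#|A| == 2%N)}.

Lemma simple_endsP (A : simple_edge) : (0 < #|val A| <= 2)%N.
Proof. by case: A => A /= /andP[_ /eqP ->]. Qed.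

(* One edge per pair of distinct adjacent vertices: loops are deleted and each
   class of parallel edges is merged into a single edge. For loopless [G] this
   does not change the chromatic polynomial ([chromatic_poly_simplification]),
   whereas [chordal G] excludes parallel edges: two vertices joined by two
   edges have chromatic polynomial 'X * ('X - 1) but are not chordal. So
   chromatic roots can only detect chordality of [simplification G]; for simple
   [G] it is chordality of [G] itself ([chordal_simplification]). *)
Definition simplification : mgraph :=
  @MGraph (vertex G) simple_edge val simple_endsP.

Lemma simplification_simple : simple simplification.
Proof.
by split=> [[A /= /andP[_ /eqP]]|] //; apply: val_inj.
Qed.

Lemma adj_simplification (u v : vertex G) : loopless G ->
  @adj simplification u v = @adj G u v.
Proof.
move=> ll; apply/existsP/existsP => [[[A /= /andP[/codomP[e ->] _]] eA]|[e /eqP he]].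
  by exists e.
have P : ([set u; v] \in codom (@ends G)) && (#|[set u; v]| == 2%N).
  by rewrite -he codom_f ll eqxx.
by exists (Sub [set u; v] P : simple_edge).
Qed.

Lemma chordal_simplification : simple G ->
  (chordal simplification <-> chordal G).
Proof.
move=> sG; have [ll _] := sG; split=> -[_ ch]; split=> //.
- move=> n c n3 [ci ca]; apply: (ch n c n3); split=> // i j.
  by rewrite adj_simplification.
- exact: simplification_simple.
- move=> n c n3 [ci ca]; apply: (ch n c n3); split=> // i j.
  by rewrite -adj_simplification.
Qed.

End Simplification.

(* A drawing without crossings in the plane [R * R]: each edge is a continuous
   curve parametrised by [0, 1] which joins the points of its ends, and which
   is a simple arc (a simple closed curve for a loop). Distinct edges meet
   only at common ends, and no edge passes through a vertex. *)
Definition plane_embedding (R : realType) (G : mgraph)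
    (pt : vertex G -> R * R) (arc : edge G -> R -> R * R) : Prop :=
  [/\ injective pt,
      forall e, {within `[0, 1], continuous (arc e)}%classic,
      forall e, [set arc e 0; arc e 1]%classic
                = (pt @` [set v | v \in ends e])%classic,
      forall e v (t : R), 0 < t < 1 -> arc e t <> pt v
    & forall e e' (s t : R), 0 < s < 1 -> 0 < t < 1 ->
        arc e s = arc e' t -> e = e' /\ s = t].

Definition planar (R : realType) (G : mgraph) : Prop :=
  exists (pt : vertex G -> R * R) (arc : edge G -> R -> R * R),
    plane_embedding pt arc.

Definition proper_coloring (G : mgraph) (k : nat)
    (f : {ffun vertex G -> 'I_k}) : bool :=
  [forall u, forall v, adj u v ==> (f u != f v)].

Definition is_chromatic_poly (G : mgraph) (p : {poly int}) : Prop :=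
  forall k : nat, (0 < k)%N ->
    p.[k%:R] = #|[set f : {ffun vertex G -> 'I_k} | proper_coloring f]|%:R.

Section ChromaticPolynomialExists.
Variable V : finType.
Implicit Types (L M : seq (V * V)).

Definition eqs k L (f : {ffun V -> 'I_k}) := all (fun e => f e.1 == f e.2) L.
Definition neqs k L (f : {ffun V -> 'I_k}) := all (fun e => f e.1 != f e.2) L.

Lemma card_eqs L : exists m, forall k,
  #|[set f : {ffun V -> 'I_k} | eqs L f]| = (k ^ m)%N.
Proof.
pose e : rel V := fun x y => ((x, y) \in L) || ((y, x) \in L).
have syme : connect_sym e.
  by apply: sym_connect_sym => x y; rewrite /e orbC.
pose T : finType := {x : V | x \in roots e}.
have rP x : fingraph.root e x \in roots e by apply: (roots_root syme).
pose r x : T := Sub (fingraph.root e x) (rP x).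
have rT (t : T) : r (val t) = t.
  by apply: val_inj => /=; apply/eqP; exact: (valP t).
exists #|T| => k; rewrite -[k in RHS]card_ord -card_ffun.
pose g (h : {ffun T -> 'I_k}) : {ffun V -> 'I_k} := [ffun x => h (r x)].
have gi : injective g.
  move=> h h' /ffunP E; apply/ffunP => t.
  by have := E (val t); rewrite !ffunE rT.
rewrite -cardsT -(card_imset _ gi); congr #|pred_of_set _|.
apply/setP => f; rewrite inE; apply/idP/imsetP => [/allP fL|[h _ ->]]; last first.
  apply/allP => -[x y] xyL /=; rewrite !ffunE; apply/eqP; congr (h _).
  apply: val_inj => /=; apply/eqP; rewrite (root_connect syme).
  by apply: connect1; rewrite /e xyL.
exists [ffun t : T => f (val t)] => //.
apply/ffunP => x; rewrite !ffunE /=.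
have : connect e x (fingraph.root e x) by exact: connect_root.
move: (fingraph.root e x) => y /connectP[p]; elim: p x => [|z p IH] x /=.
  by move=> _ ->.
move=> /andP[/orP ez pp] yE; rewrite -(IH z pp yE).
by case: ez => /fL /= /eqP.
Qed.

Lemma card_eqs_neqs M L : exists p : {poly int}, forall k,
  p.[k%:R] = #|[set f : {ffun V -> 'I_k} | eqs L f && neqs M f]|%:R.
Proof.
elim: M L => [|[x y] M IH] L.
  have [m mP] := card_eqs L; exists 'X^m => k.
  rewrite hornerXn -natrX -mP; congr (_%:R); congr #|pred_of_set _|.
  by apply/setP => f; rewrite !inE andbT.
have [p pP] := IH L; have [q qP] := IH ((x, y) :: L).
exists (p - q) => k; rewrite hornerD hornerN pP qP.
apply/eqP; rewrite subr_eq -natrD; apply/eqP; congr (_%:R).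
rewrite -(cardsID [set f : {ffun V -> 'I_k} | f x == f y]) addnC.
congr (_ + _)%N; congr #|pred_of_set _|; apply/setP => f; rewrite !inE /=.
  by rewrite andbCA.
by rewrite andbC andbA.
Qed.

End ChromaticPolynomialExists.

Lemma ex_chromatic_poly (G : mgraph) : exists p, is_chromatic_poly G p.
Proof.
pose M := [seq e <- enum {: vertex G * vertex G} | adj e.1 e.2].
have [p pP] := card_eqs_neqs M [::]; exists p => k _.
rewrite pP; congr (_%:R); congr #|pred_of_set _|; apply/setP => f.
rewrite !inE /=; apply/allP/forallP => [H u|H [u v]].
  apply/forallP => v; apply/implyP => uv.
  by apply: (H (u, v)); rewrite mem_filter uv mem_enum.
rewrite mem_filter /= => /andP[uv _].
by move/forallP: (H u) => /(_ v) /implyP /(_ uv).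
Qed.

Lemma is_chromatic_poly_uniq (G : mgraph) (p q : {poly int}) :
  is_chromatic_poly G p -> is_chromatic_poly G q -> p = q.
Proof.
move=> pP qP; apply/eqP; rewrite -subr_eq0; apply/negPn/negP => d0.
pose s : seq int := [seq i.+1%:R | i <- iota 0 (size (p - q))].
have := max_poly_roots d0 (rs := s).
rewrite size_map size_iota ltnn => H; suff: false by [].
apply: H.
  apply/allP => _ /mapP[i _ ->].
  by rewrite /root hornerD hornerN (pP i.+1) // (qP i.+1) // subrr.
rewrite map_inj_uniq ?iota_uniq // => i j /eqP.
by rewrite eqr_nat eqSS => /eqP.
Qed.

Definition chromatic_poly (G : mgraph) : {poly int} :=
  sval (cid (ex_chromatic_poly G)).

Lemma chromatic_polyP (G : mgraph) : is_chromatic_poly G (chromatic_poly G).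
Proof. exact: svalP (cid (ex_chromatic_poly G)). Qed.

Lemma chromatic_poly_simplification (G : mgraph) : loopless G ->
  chromatic_poly (simplification G) = chromatic_poly G.
Proof.
move=> ll; apply: is_chromatic_poly_uniq (chromatic_polyP G) => k k0.
rewrite (chromatic_polyP (simplification G) k0).
congr (_%:R); congr #|pred_of_set _|; apply/setP => f; rewrite !inE.
by apply: eq_forallb => u; apply: eq_forallb => v; rewrite adj_simplification.
Qed.

Definition chromatic_root (R : realType) (G : mgraph) (z : R[i]) : Prop :=
  root (map_poly intr (chromatic_poly G)) z.

Definition only_real_chromatic_roots (R : realType) (G : mgraph) : Prop :=
  forall z : R[i], chromatic_root G z -> z \is Num.real.

Definition only_integral_chromatic_roots (R : realType) (G : mgraph) : Prop :=
  forall z : R[i], chromatic_root G z -> exists m : int, z = m%:~R.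

(* Main.v *)
From Stdlib Require Import Ring.
Require Import Defs.
From mathcomp Require Import all_boot all_order all_algebra.
From mathcomp Require Import zify.

Set Implicit Arguments.
Unset Strict Implicit.
Unset Printing Implicit Defensive.

(** Chromatic roots depend on a graph only through its adjacency relation, so
    the work is done with a relation [e] on a finite type and the subgraphs
    induced on sets [A] of vertices; n, m and t stand for the numbers of
    vertices, edges and triangles of [A], and P(A) for its chromatic polynomial.

    Reduction to atoms. If a clique S separates [A] into two sides A1 and A2
    that overlap in S, then P(A) P(S) = P(A1) P(A2) ([chromatic_clique_sum]),
    and the roots of P(S) are 0, ..., |S| - 1. Hence having only real roots
    passes from [A] to the two sides, and being chordal passes from the sides
    to [A] ([chordal_glue]). Conversely a chordal graph that is not a clique
    has such a separation ([chordal_clique_separator], due to Dirac). By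
    induction, the roots of a chordal planar graph are roots of cliques, and
    planar cliques have at most four vertices. For the converse it remains to
    see that a planar atom, i.e. a graph without clique separator, is a clique
    if its chromatic roots are real ([atom_real_roots_clique]).

    Real roots. The leading coefficients of P(A) are 1, -m and C(m,2) - t, and
    0 and 1 are roots. As an atom is 2-connected, 1 is a simple root
    ([chromatic_beta]). Let z run through the remaining n - 2 roots. Then the sum of the z is m - 1 and the sum of the
    z^2 is m + 2t - 1. The product of the (z - 1)^2 is a positive integer, so
    by the inequality of the means the sum of the (z - 1)^2 is at least n - 2;
    this says m <= 2t + 1. The sums of the (z - 2)^2 and of the (z - 3)^2 are
    nonnegative ([real_root_inequalities]). In a planar atom t + n <= m + 2,
    with equality only if 3t = 2m ([atom_euler]). For n >= 4 these relations
    leave n = 4, m = 6, which is a clique, and m = 2n - 3, t = n - 2, the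
    numbers of a triangulated disc without inner vertices. Such a disc has a
    chord, and its two ends separate it ([atom_not_disc]).

    Planarity. The Jordan curve theorem is avoided by counting modulo 2 the
    crossings of the arc ab with the downward ray from c. For disjoint arcs ab
    and cd, the four such numbers formed with one arc and one end of the other
    add up to a value that depends only on the lexicographic order of the four
    ends ([crossing_parity]). For continuous arcs this is proved in
    [planar_crossing_parity]: after a fine subdivision it is a sum of trivial
    identities over the squares of a grid. Adding the relation over well chosen
    pairs of edges, as in van Kampen's proof that K5 and K(3,3) are not planar,
    gives two facts about planar atoms: no edge lies in three triangles
    ([atom_edge_triangles]), and a cycle in the link of a vertex is the whole
    link ([atom_link_cycle]). So a nonempty set of triangles that meets every
    edge evenly contains all triangles ([closed_surface_full]). In other words
    the boundary map from triangles to edges modulo 2 has a kernel of dimension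
    at most one, and linear algebra replaces Euler's formula. *)

(** * Induced subgraphs *)

Section InducedSubgraphs.
Variable V : finType.
Implicit Types (e : rel V) (A B S : {set V}) (u v w x y : V).

Definition clique e S := [forall u in S, forall v in S, (u != v) ==> e u v].
Definition within e A : rel V := fun u v => [&& u \in A, v \in A & e u v].
Definition conn e A := [forall u in A, forall v in A, connect (within e A) u v].
Definition nbr e A v := [set u in A | e v u].
Definition cliques e k A := [set B : {set V} | [&& B \subset A, #|B| == k & clique e B]].
Arguments cliques e k%_nat_scope A.

(** The usual definition of an atom asks for a connected graph without clique
    separators; connectedness is the case S = set0. *)
Definition atom e A :=
  [forall S : {set V}, (S \subset A) && clique e S ==> conn e (A :\: S)].

Lemma cliqueP e S :
  reflect {in S &, forall u v, u != v -> e u v} (clique e S).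
Proof.
apply: (iffP forall_inP) => [H u v uS vS uv|H u uS].
  by have /forall_inP/(_ v vS)/implyP := H u uS; apply.
by apply/forall_inP => v vS; apply/implyP; apply: H.
Qed.

Lemma connP e A :
  reflect {in A &, forall u v, connect (within e A) u v} (conn e A).
Proof.
apply: (iffP forall_inP) => [H u v uA vA|H u uA].
  by have /forall_inP := H u uA; apply.
by apply/forall_inP => v vA; apply: H.
Qed.

Lemma atomP e A :
  reflect (forall S, S \subset A -> clique e S -> conn e (A :\: S)) (atom e A).
Proof.
apply: (iffP forallP) => [H S SA cS|H S].
  by have /implyP := H S; apply; rewrite SA.
by apply/implyP => /andP[]; apply: H.
Qed.

Lemma cliqueS e A B : A \subset B -> clique e B -> clique e A.
Proof.
by move=> /subsetP AB /cliqueP cB; apply/cliqueP => u v /AB uB /AB vB; apply: cB.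
Qed.

Lemma clique0 e : clique e set0.
Proof. by apply/cliqueP => u v; rewrite inE. Qed.

Lemma clique1 e u : clique e [set u].
Proof. by apply/cliqueP => v w /set1P-> /set1P->; rewrite eqxx. Qed.

Lemma adj_neq e u v : irreflexive e -> e u v -> u != v.
Proof. by move=> ei uv; apply: contraTneq uv => ->; rewrite ei. Qed.

Lemma in_nbr e A v u : (u \in nbr e A v) = (u \in A) && e v u.
Proof. by rewrite inE. Qed.

Lemma in_cliques e k A B :
  (B \in cliques e k A) = [&& B \subset A, #|B| == k & clique e B].
Proof. by rewrite inE. Qed.

Lemma eq_clique e e' A : {in A &, e =2 e'} -> clique e A = clique e' A.
Proof.
move=> ee; apply/cliqueP/cliqueP => H u v uA vA uv; first by rewrite -ee ?H.
by rewrite ee ?H.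
Qed.

Lemma eq_cliques e e' k A : {in A &, e =2 e'} -> cliques e k A = cliques e' k A.
Proof.
move=> ee; apply/setP => B; rewrite !in_cliques; apply: andb_id2l => /subsetP BA.
congr (_ && _); apply: eq_clique => u v /BA uA /BA vA; exact: ee.
Qed.

Lemma eq_within e e' A : {in A &, e =2 e'} -> within e A =2 within e' A.
Proof.
move=> ee u v; rewrite /within; case: (boolP (u \in A)) => //= uA.
by case: (boolP (v \in A)) => //= vA; apply: ee.
Qed.

Lemma eq_conn e e' A : {in A &, e =2 e'} -> conn e A = conn e' A.
Proof.
move=> /eq_within/eq_connect ee.
by apply/connP/connP => H u v uA vA; [rewrite -ee|rewrite ee]; apply: H.
Qed.

Lemma card_cliques1 e A : #|cliques e 1 A| = #|A|.
Proof.
rewrite -(card_imset (mem A) (@set1_inj V)); apply: eq_card => B.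
rewrite in_cliques; apply/idP/imsetP => [/and3P[sB /cards1P[x xB] _]|[x xA ->]].
  by exists x => //; move: sB; rewrite xB sub1set.
by rewrite sub1set xA cards1 clique1.
Qed.

Lemma within_sym e A : symmetric e -> symmetric (within e A).
Proof. by move=> es u v; rewrite /within es andbCA. Qed.

Lemma connect_within_sym e A : symmetric e -> connect_sym (within e A).
Proof. by move=> es; apply: sym_connect_sym; apply: within_sym. Qed.

Lemma withinS e e' A B : A \subset B -> {in A &, subrel e e'} ->
  subrel (connect (within e A)) (connect (within e' B)).
Proof.
move=> /subsetP AB ee; apply: connect_sub => u v /= /and3P[uA vA euv].
by apply: connect1; rewrite /within !AB //= ee.
Qed.

Lemma path_within_sub e A x p : path (within e A) x p -> {subset p <= A}.
Proof.
elim: p x => [|z p IH] x //= /andP[/and3P[_ zA _] pp] w.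
by rewrite inE => /orP[/eqP->//|/(IH z pp)].
Qed.

Lemma connect_within_mem e A u v :
  connect (within e A) u v -> u != v -> (u \in A) && (v \in A).
Proof.
move=> /connectP[p]; elim/last_ind: p => [|p z _] /=; first by move=> _ ->; rewrite eqxx.
rewrite last_rcons => pp -> _.
apply/andP; split.
  by case: p pp => [|w p] /= /andP[]/and3P[].
by move: pp; rewrite rcons_path => /andP[_ /and3P[]].
Qed.

(** A path from inside [C] to outside of it uses an edge that leaves [C]. This
    is how connectedness is exploited everywhere below. *)
Lemma connect_exit e B a b (C : {set V}) : connect (within e B) a b ->
  a \in C -> b \notin C -> exists c d, [/\ c \in C, d \notin C, c \in B, d \in B & e c d].
Proof.
move=> /connectP[p]; elim: p a => [|z p IH] a /=; first by move=> _ -> ->.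
case/andP=> /and3P[aB zB az] pp bp aC bC.
by case: (boolP (z \in C)) => zC; [apply: (IH z)|exists a, z].
Qed.

Variable e : rel V.
Hypothesis e_sym : symmetric e.
Hypothesis e_irr : irreflexive e.

(** The cliques that contain [v] are those of the neighbourhood of [v] with
    [v] added. *)
Lemma card_cliquesS k A v : v \in A ->
  #|cliques e k.+1 A| = #|cliques e k.+1 (A :\ v)| + #|cliques e k (nbr e A v)|.
Proof.
move=> vA; rewrite -(cardsID [set B : {set V} | v \in B]) addnC; congr (_ + _).
  apply: eq_card => B; rewrite inE in_cliques [in RHS]in_cliques subsetD1 inE.
  by case: (v \in B); rewrite ?andbF ?andbT.
have inj : {in cliques e k (nbr e A v) &, injective (fun B => v |: B)}.
  move=> B C; rewrite !in_cliques => /and3P[/subsetP sB _ _] /and3P[/subsetP sC _ _] E.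
  have vB : v \notin B by apply/negP => /sB; rewrite in_nbr e_irr andbF.
  have vC : v \notin C by apply/negP => /sC; rewrite in_nbr e_irr andbF.
  by rewrite -(setU1K vB) -(setU1K vC) E.
rewrite -(card_in_imset inj); apply: eq_card => B; rewrite inE in_cliques inE.
apply/idP/imsetP => [/andP[/and3P[sB cB /cliqueP kB] vB]|[C]].
  exists (B :\ v); last by rewrite setD1K.
  rewrite in_cliques; apply/and3P; split.
  - apply/subsetP => u /setD1P[uv uB]; rewrite in_nbr (subsetP sB) //=.
    by apply: kB => //; rewrite eq_sym.
  - by move: cB; rewrite (cardsD1 v B) vB add1n eqSS.
  - by apply: cliqueS (introT (cliqueP _ _) kB); apply: subD1set.
rewrite in_cliques => /and3P[/subsetP sC /eqP cC /cliqueP kC] ->.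
have vC : v \notin C by apply/negP => /sC; rewrite in_nbr e_irr andbF.
rewrite setU11 cardsU1 vC cC eqxx /= andbT; apply/andP; split.
  by rewrite subUset sub1set vA; apply/subsetP => u /sC; rewrite in_nbr => /andP[].
apply/cliqueP => x y /setU1P[->|xC] /setU1P[->|yC]; rewrite ?eqxx //.
- by move=> _; have := sC _ yC; rewrite in_nbr => /andP[].
- by move=> _; have := sC _ xC; rewrite in_nbr e_sym => /andP[].
- exact: kC.
Qed.

Lemma card_edges A v : v \in A ->
  #|cliques e 2 A| = #|cliques e 2 (A :\ v)| + #|nbr e A v|.
Proof. by move=> vA; rewrite (card_cliquesS 1 vA) card_cliques1. Qed.

Lemma clique_card_edges A : #|cliques e 2 A| = 'C(#|A|, 2) -> clique e A.
Proof.
rewrite -cards_draws => E.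
have sub : cliques e 2 A \subset [set B : {set V} | (B \subset A) && (#|B| == 2)].
  by apply/subsetP => B; rewrite in_cliques inE => /and3P[-> ->].
have /setP EE : cliques e 2 A = [set B : {set V} | (B \subset A) && (#|B| == 2)].
  by apply/eqP; rewrite eqEcard sub E leqnn.
apply/cliqueP => u v uA vA uv; have := EE [set u; v].
rewrite in_cliques inE subUset !sub1set uA vA cards2 uv /= => /cliqueP.
by apply; rewrite ?inE ?eqxx ?orbT.
Qed.

Lemma card_edges_le A : #|cliques e 2 A| <= 'C(#|A|, 2).
Proof.
rewrite -cards_draws; apply/subset_leq_card/subsetP => B.
by rewrite in_cliques inE => /and3P[-> ->].
Qed.

Lemma edge_cliques A u v :
  ([set u; v] \in cliques e 2 A) = [&& u \in A, v \in A & e u v].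
Proof.
rewrite in_cliques subUset !sub1set cards2 -andbA; apply: andb_id2l => uA.
apply: andb_id2l => vA; have [->|uv] := eqVneq u v; first by rewrite e_irr.
apply/cliqueP/idP => [|euv x y /set2P[]-> /set2P[]->]; rewrite ?eqxx //.
- by apply; rewrite ?inE ?eqxx ?orbT.
- by rewrite e_sym.
Qed.

Lemma edgeP A B : B \in cliques e 2 A ->
  exists u v, [/\ B = [set u; v], u \in A, v \in A & e u v].
Proof.
rewrite in_cliques => /and3P[sB /cards2P[u [v [uv E]]] kB].
exists u, v; rewrite E in sB kB *; split=> //.
- by apply: (subsetP sB); rewrite !inE eqxx.
- by apply: (subsetP sB); rewrite !inE eqxx orbT.
- by apply: (cliqueP _ _ kB); rewrite ?inE ?eqxx ?orbT.
Qed.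

End InducedSubgraphs.
Arguments cliques {V} e k%_nat_scope A.

(** * Crossing parities and triangles in atoms *)

(** What is kept of a plane drawing: [n c a b] is the parity of the number of
    crossings of the arc ab with the downward ray from c, and [lt] is the
    lexicographic order of the points. Only disjoint edges enter the last
    clause, so that the condition survives for walks in place of edges. *)
Definition crossing_parity (V : finType) (e : rel V) (lt : rel V)
    (n : V -> V -> V -> bool) : Prop :=
  [/\ forall u v, u != v -> lt v u = ~~ lt u v,
      forall c a b, n c a b = n c b a
    & forall a b c d, e a b -> e c d ->
        a != c -> a != d -> b != c -> b != d ->
        n c a b (+) n d a b (+) n a c d (+) n b c d
        = lt c a (+) lt d a (+) lt c b (+) lt d b].
Lemma addb_xorb a b : a (+) b = xorb a b. Proof. by case: a; case: b. Qed.
Lemma negb_xorb a : ~~ a = xorb true a. Proof. by []. Qed.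
(** Deriving an equation between sums modulo 2 from an equation [L = R], which
    in practice is a sum of known equations: what is left is an identity in
    the Boolean ring, for [addb_ring]. *)
Lemma addb_from (L R x y : bool) : L = R -> x (+) y (+) (L (+) R) = false -> x = y.
Proof. by move=> ->; rewrite addbb addbF; case: x; case: y. Qed.
Ltac addb_ring := rewrite ?negb_xorb ?addb_xorb; ring.

Section PlanarTriangles.
Variables (V : finType) (e lt : rel V) (n : V -> V -> V -> bool).
Hypotheses (e_sym : symmetric e) (e_irr : irreflexive e).
Hypothesis e_planar : crossing_parity e lt n.
Implicit Types (A : {set V}) (u v w x y : V).

Let lt_anti u v : u != v -> lt v u = ~~ lt u v.
Proof. by case: e_planar => H _ _; apply: H. Qed.
Let nC c a b : n c a b = n c b a.
Proof. by case: e_planar => _ H _; apply: H. Qed.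
Let exchange a b c d : e a b -> e c d ->
        a != c -> a != d -> b != c -> b != d ->
        n c a b (+) n d a b (+) n a c d (+) n b c d
        = lt c a (+) lt d a (+) lt c b (+) lt d b.
Proof. by case: e_planar => _ _; apply. Qed.

(** Parity of the crossings of the triangle xyz with the downward ray from [w]:
    for a drawn triangle it tells whether [w] is inside. *)
Definition inside w x y z := n w x y (+) n w y z (+) n w x z.

(** Every vertex of the triangle is an end of two of its edges, so that in the
    sum of the three exchange relations between uv and these edges all terms
    seen from the triangle cancel, and so do the order terms. *)
Lemma inside_adjacent u v x y z : e u v -> e x y -> e y z -> e x z ->
  u \notin [set x; y; z] -> v \notin [set x; y; z] ->
  inside u x y z = inside v x y z.
Proof.
rewrite !inE !negb_or => uv xy yz xz /andP[/andP[ux uy] uz] /andP[/andP[vx vy] vz].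
rewrite ![_ == x]eq_sym ![_ == y]eq_sym ![_ == z]eq_sym in ux uy uz vx vy vz.
have h1 := exchange xy uv ux vx uy vy.
have h2 := exchange yz uv uy vy uz vz.
have h3 := exchange xz uv ux vx uz vz.
apply: (addb_from (congr2 addb (congr2 addb h1 h2) h3)).
rewrite /inside; addb_ring.
Qed.

Lemma inside_const A x y z u v : e x y -> e y z -> e x z ->
  conn e (A :\: [set x; y; z]) ->
  u \in A :\: [set x; y; z] -> v \in A :\: [set x; y; z] ->
  inside u x y z = inside v x y z.
Proof.
move=> xy yz xz /connP cA uA vA.
have /connectP[p] := cA u v uA vA; elim: p u {uA} => [|w p IH] u /=; first by move=> _ ->.
case/andP=> /and3P[uA wA uw] pp vp; rewrite -(IH w) //.
move: uA wA; rewrite !in_setD => /andP[uA _] /andP[wA _].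
exact: inside_adjacent.
Qed.

(** A triangle does not separate an atom, so all other vertices are on the same
    side of it. *)
Lemma atom_inside A x y z u v : atom e A -> e x y -> e y z -> e x z ->
  x \in A -> y \in A -> z \in A ->
  u \in A -> v \in A -> u \notin [:: x; y; z] -> v \notin [:: x; y; z] ->
  inside u x y z = inside v x y z.
Proof.
move=> /atomP atomA xy yz xz xA yA zA uA vA.
rewrite !inE => ux vx; apply: (@inside_const A); rewrite // ?inE -?orbA ?ux ?vx //.
apply: atomA; first by rewrite !subUset !sub1set xA yA zA.
apply/cliqueP => a b; rewrite !inE -!orbA.
by move=> /or3P[]/eqP-> /or3P[]/eqP->; rewrite ?eqxx // e_sym.
Qed.

(** Three triangles on uv form a K(2,3) plus the edge uv. Of the three paths
    from u to v in a drawn K(2,3) one is in the middle; algebraically, the sum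
    of the exchange relations over the six pairs of disjoint edges is 1. But by
    [atom_inside] the sum is 0, as any two of the w's are on the same side of
    the triangle through the third. *)
Lemma atom_edge_triangles A u v w1 w2 w3 : atom e A ->
  [/\ u \in A, v \in A, w1 \in A, w2 \in A & w3 \in A] -> e u v ->
  e u w1 -> e u w2 -> e u w3 -> e v w1 -> e v w2 -> e v w3 ->
  uniq [:: w1; w2; w3] -> False.
Proof.
move=> atomA [uA vA A1 A2 A3] uv u1 u2 u3 v1 v2 v3.
rewrite /= !inE negb_or andbT => /andP[/andP[d12 d13] d23].
have ne x y : e x y -> x != y by move=> xy; apply: contraTneq xy => ->; rewrite e_irr.
have duv := ne _ _ uv.
have [[du1 du2] du3] := (ne _ _ u1, ne _ _ u2, ne _ _ u3).
have [[dv1 dv2] dv3] := (ne _ _ v1, ne _ _ v2, ne _ _ v3).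
have out w w' : e u w -> e v w -> w != w' -> w \notin [:: u; v; w'].
  by move=> /ne uw /ne vw ww'; rewrite !inE !negb_or ww' ![w == _]eq_sym uw vw.
have d21 : w2 != w1 by rewrite eq_sym.
have d31 : w3 != w1 by rewrite eq_sym.
have d32 : w3 != w2 by rewrite eq_sym.
have c1 : inside w2 u v w1 = inside w3 u v w1.
  by apply: (atom_inside atomA) => //; apply: out.
have c2 : inside w1 u v w2 = inside w3 u v w2.
  by apply: (atom_inside atomA) => //; apply: out.
have c3 : inside w1 u v w3 = inside w2 u v w3.
  by apply: (atom_inside atomA) => //; apply: out.
have h wi wj : e u wi -> e v wj -> u != wj -> v != wi -> wi != wj ->
  n v u wi (+) n wj u wi (+) n u v wj (+) n wi v wj
  = lt v u (+) lt wj u (+) lt v wi (+) lt wj wi.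
  by move=> ui vj uj vi ij; apply: exchange => //; rewrite eq_sym.
have h12 := h w1 w2 u1 v2 du2 dv1 d12.
have h13 := h w1 w3 u1 v3 du3 dv1 d13.
have h23 := h w2 w3 u2 v3 du3 dv2 d23.
have h21 := h w2 w1 u2 v1 du1 dv2 d21.
have h31 := h w3 w1 u3 v1 du1 dv3 d31.
have h32 := h w3 w2 u3 v2 du2 dv3 d32.
have l12 := lt_anti d12. have l13 := lt_anti d13. have l23 := lt_anti d23.
suff: true = false by [].
apply: (addb_from (congr2 addb (congr2 addb (congr2 addb (congr2 addb h12 h13)
  (congr2 addb h23 h21)) (congr2 addb h31 h32))
  (congr2 addb (congr2 addb l12 (congr2 addb l13 l23)) (congr2 addb c1 (congr2 addb c2 c3))))).
rewrite /inside; addb_ring.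
Qed.

Fixpoint walk_cross c x (p : seq V) :=
  if p is y :: q then n c x y (+) walk_cross c y q else false.

(** Along the walk, the terms of inner vertices occur twice. *)
Lemma walk_exchange a b c p : e a b -> path e c p ->
  a \notin c :: p -> b \notin c :: p ->
  n c a b (+) n (last c p) a b (+) walk_cross a c p (+) walk_cross b c p
  = lt c a (+) lt (last c p) a (+) lt c b (+) lt (last c p) b.
Proof.
move=> ab; elim: p c => [|d p IH] c /=.
  by move=> _ _ _; addb_ring.
case/andP=> cd pp; rewrite inE negb_or => /andP[ac ap].
rewrite inE negb_or => /andP[bc bp].
have h1 := IH d pp ap bp.
move: ap bp; rewrite inE negb_or => /andP[ad _]; rewrite inE negb_or => /andP[bd _].
have h2 := exchange ab cd ac ad bc bd.
by apply: (addb_from (congr2 addb h1 h2)); addb_ring.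
Qed.

(** The triangles formed by [v] and the steps of a walk in its link: adding
    [atom_inside] over them, the inner spokes cancel. *)
Lemma walk_inside A v w w' c p : atom e A ->
  path e c p -> v \in A -> w \in A -> w' \in A -> {subset c :: p <= nbr e A v} ->
  w \notin c :: p -> w' \notin c :: p -> w != v -> w' != v ->
  n w v c (+) n w v (last c p) (+) walk_cross w c p
  = n w' v c (+) n w' v (last c p) (+) walk_cross w' c p.
Proof.
move=> atomA pp vA wA w'A; elim: p c pp => [|d p IH] c /=; first by rewrite !addbb.
case/andP=> cd pp sub; rewrite inE negb_or => /andP[wc wp].
rewrite inE negb_or => /andP[w'c w'p] wv w'v.
have h1 : _ := IH d pp _ wp w'p wv w'v.
have {}h1 := h1 ltac:(by move=> x xp; apply: sub; rewrite inE xp orbT).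
move: wp w'p; rewrite inE negb_or => /andP[wd _]; rewrite inE negb_or => /andP[w'd _].
have /sub := mem_head c (d :: p); rewrite inE => /andP[cA vc].
have : d \in c :: d :: p by rewrite !inE eqxx orbT.
move/sub; rewrite inE => /andP[dA vd].
have h2 : inside w v c d = inside w' v c d.
  by apply: (atom_inside atomA); rewrite // !inE !negb_or; apply/and3P.
by apply: (addb_from (congr2 addb h1 h2)); rewrite /inside; addb_ring.
Qed.

(** For a wheel with hub v and rim w1 w2 w3 ... w1, add the exchange relations
    of the three pairs (v w1, w2 w3), (v w3, w1 w2) and (v w2, rest of the rim).
    This is the identity saying that in a drawn K4 an odd number of vertices is
    inside the triangle of the others. For a neighbour w of v off the rim, the
    relations between the edge vw and the rim say that v and w are on the same
    side of the rim. By [atom_inside] and [walk_inside] the two are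
    contradictory. *)
Lemma atom_link_cycle A v w1 w2 p w : atom e A -> v \in A ->
  path e w2 (w1 :: p) -> e (last w1 p) w2 -> last w1 p != w1 ->
  {subset w2 :: w1 :: p <= nbr e A v} -> w2 \notin w1 :: p ->
  w \in nbr e A v -> w \in w2 :: w1 :: p.
Proof.
set w3 := last w1 p => atomA vA /=; case/andP=> e21 pp e32 d31 sub w2p.
rewrite in_nbr => /andP[wA vw]; apply/negPn/negP => wp; exfalso.
have [w2A v2] : w2 \in A /\ e v w2 by have /sub := mem_head w2 (w1 :: p); rewrite inE => /andP.
have sub1 : {subset w1 :: p <= nbr e A v}.
  by move=> x xp; apply: sub; rewrite inE xp orbT.
have [w1A v1] : w1 \in A /\ e v w1 by have /sub1 := mem_head w1 p; rewrite inE => /andP.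
have [w3A v3] : w3 \in A /\ e v w3 by have /sub1 := mem_last w1 p; rewrite inE => /andP.
have ne x y : e x y -> x != y by move=> xy; apply: contraTneq xy => ->; rewrite e_irr.
have ne' x y : e x y -> y != x by move=> xy; rewrite eq_sym; apply: ne.
have vp : v \notin w1 :: p by apply/negP => /sub1; rewrite in_nbr e_irr andbF.
have ww x : x \in w2 :: w1 :: p -> w != x by move=> xp; apply: contraNneq wp => ->.
have ww2 := ww _ (mem_head _ _).
have ww1 : w != w1 by apply: ww; rewrite !inE eqxx orbT.
have ww3 : w != w3 by apply: ww; rewrite inE mem_last orbT.
have wp' : w \notin w1 :: p by apply: contra wp; rewrite (in_cons w2) => ->; rewrite orbT.
have d13 : w1 != w3 by rewrite eq_sym.
have h1 := exchange v1 e32 (ne _ _ v3) (ne _ _ v2) d13 (ne' _ _ e21).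
have h2 := exchange v3 e21 (ne _ _ v2) (ne _ _ v1) (ne _ _ e32) d31.
have h3 := walk_exchange v2 pp vp w2p.
have h4 := exchange vw e32 (ne _ _ v3) (ne _ _ v2) ww3 ww2.
have h5 := exchange vw e21 (ne _ _ v2) (ne _ _ v1) ww2 ww1.
have h6 := walk_exchange vw pp vp wp'.
have h7 := @walk_inside A v w w2 w1 p atomA pp vA wA w2A sub1 wp' w2p (ne' _ _ vw) (ne' _ _ v2).
have h8 : inside w v w2 w1 = inside w3 v w2 w1.
  apply: (atom_inside atomA) => //; rewrite !inE !negb_or; apply/and3P; split=> //.
  - exact: ne'.
  - exact: ne'.
  - exact: ne.
have h9 : inside w v w2 w3 = inside w1 v w2 w3.
  apply: (atom_inside atomA) => //; first by rewrite e_sym.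
    by rewrite !inE !negb_or; apply/and3P; split=> //; apply: ne'.
  by rewrite !inE !negb_or; apply/and3P; split=> //; apply: ne'.
have l12 := lt_anti (ne _ _ e21). have l13 := lt_anti d13. have l23 := lt_anti (ne _ _ e32).
have l w' : w' != v -> lt v w' = ~~ lt w' v by apply: lt_anti.
have l1 := l _ (ne' _ _ v1). have l2 := l _ (ne' _ _ v2). have l3 := l _ (ne' _ _ v3).
have l4 := l _ (ne' _ _ vw).
suff: true = false by [].
apply: (addb_from (congr2 addb (congr2 addb (congr2 addb h1 h2) (congr2 addb h3 h4))
  (congr2 addb (congr2 addb h5 h6) (congr2 addb h7 (congr2 addb h8 h9))))).
rewrite /inside -/w3 ?l12 ?l13 ?l23 ?l1 ?l2 ?l3 ?l4.
rewrite ?[n _ w2 v]nC ?[n _ w1 v]nC ?[n _ w3 v]nC ?[n _ w3 w2]nC.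
addb_ring.
Qed.
End PlanarTriangles.

(** * Edges and triangles as chains modulo two *)

Import Order.TTheory GRing.Theory Num.Theory.
Local Open Scope ring_scope.

(** Linear algebra of a complex of chains on [T], [E], [X] (triangles, edges and
    vertices) with boundary maps [D] and [B]. Chains are plain functions,
    restricted to the index sets by the sums. *)
Section ChainComplex.
Variables (F : fieldType).

Lemma rank_ge_pred m k (M : 'M[F]_(m, k)) (v0 : 'rV[F]_m) :
  (forall u : 'rV_m, u *m M = 0 -> (u <= v0)%MS) -> (m <= (\rank M).+1)%N.
Proof.
move=> H; have : (kermx M <= v0)%MS.
  by apply/row_subP => i; apply: H; rewrite -row_mul mulmx_ker row0.
move/mxrankS; rewrite mxrank_ker => h.
have := leq_trans h (rank_leq_row v0); lia.
Qed.

Variables (I J K : finType) (T : {set I}) (E : {set J}) (X : {set K}).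
Variables (D : I -> J -> F) (B : J -> K -> F).

Let MD := \matrix_(i < #|T|, j < #|E|) D (enum_val i) (enum_val j).
Let MB := \matrix_(j < #|E|, k < #|X|) B (enum_val j) (enum_val k).

Hypothesis DB : {in T & X, forall t k, \sum_(j in E) D t j * B j k = 0}.

Let MDB : MD *m MB = 0.
Proof.
apply/matrixP => i k; rewrite !mxE -[RHS](DB (enum_valP i) (enum_valP k)).
rewrite [RHS]big_enum_val; apply: eq_bigr => j _.
by rewrite !mxE.
Qed.

Lemma row_vector_fun (L : finType) (Y : {set L}) (u : 'rV[F]_#|Y|) :
  exists f : L -> F, forall i, u 0 i = f (enum_val i).
Proof.
have [Y0|[y0 yY]] := set_0Vmem Y.
  exists (fun=> 0) => i; exfalso; have := enum_valP i; by rewrite {2}Y0 inE.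
exists (fun y => u 0 (enum_rank_in yY y)) => i.
by rewrite enum_valK_in.
Qed.

Hypothesis B_const : forall g : K -> F,
  {in E, forall j, \sum_(k in X) B j k * g k = 0} -> {in X &, forall k k', g k = g k'}.

(** The hypothesis on [B] holds for the incidence matrix of a connected graph,
    whose rank is the number of vertices minus one. *)
Let rankB : (#|X| <= (\rank MB).+1)%N.
Proof.
rewrite -mxrank_tr; apply: (@rank_ge_pred _ _ _ (const_mx 1)) => u.
have [g gP] := row_vector_fun u => /matrixP uM.
have gc : {in X &, forall k k', g k = g k'}.
  apply: B_const => j jE; have := uM 0 (enum_rank_in jE j); rewrite !mxE => uj.
  rewrite -[RHS]uj [LHS]big_enum_val; apply: eq_bigr => k _.
  by rewrite !mxE gP mulrC enum_rankK_in.
have [X0|[x0 xX]] := set_0Vmem X.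
  suff -> : u = 0 by apply: sub0mx.
  by apply/matrixP => i k; exfalso; have := enum_valP k; rewrite {2}X0 inE.
suff -> : u = g x0 *: const_mx 1 by apply: scalemx_sub.
apply/matrixP => i k; rewrite !mxE (ord1 i) gP mulr1; apply: gc => //.
exact: enum_valP.
Qed.

(** The hypothesis says that [D] has a kernel of dimension at most one, spanned
    by [s0]. *)
Lemma rank_exact_bound (s0 : I -> F) :
  (forall s : I -> F, {in E, forall j, \sum_(t in T) s t * D t j = 0} ->
    exists a, {in T, forall t, s t = a * s0 t}) ->
  (#|T| + #|X| <= #|E| + 2)%N.
Proof.
move=> H; have := mulmx0_rank_max MDB.
suff: (#|T| <= (\rank MD).+1)%N by move: rankB; lia.
apply: (@rank_ge_pred _ _ _ (\row_i s0 (enum_val i))) => u.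
have [s sP] := row_vector_fun u => /matrixP uM.
have [|a aP] := H s.
  move=> j jE; have := uM 0 (enum_rank_in jE j); rewrite !mxE => uj.
  rewrite -[RHS]uj [LHS]big_enum_val; apply: eq_bigr => k _.
  by rewrite !mxE sP enum_rankK_in.
suff -> : u = a *: \row_i s0 (enum_val i) by apply: scalemx_sub.
by apply/matrixP => i k; rewrite !mxE (ord1 i) sP aP ?enum_valP.
Qed.

Lemma rank_injective_bound :
  (forall s : I -> F, {in E, forall j, \sum_(t in T) s t * D t j = 0} ->
    {in T, forall t, s t = 0}) ->
  row_free MD /\ (#|T| + #|X| <= #|E| + 1)%N.
Proof.
move=> H.
have freeD : row_free MD.
  rewrite -kermx_eq0; apply/rowV0P => u /sub_kermxP /matrixP uM.
  have [s sP] := row_vector_fun u.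
  apply/matrixP => i k; rewrite (ord1 i) sP mxE; apply: H; last exact: enum_valP.
  move=> j jE; have := uM 0 (enum_rank_in jE j); rewrite !mxE => uj.
  rewrite -[RHS]uj [LHS]big_enum_val; apply: eq_bigr => l _.
  by rewrite !mxE sP enum_rankK_in.
split=> //; have := mulmx0_rank_max MDB; move: rankB freeD.
by rewrite /row_free => h /eqP ->; lia.
Qed.

(** If the Euler characteristic is 1 and there are no 2-cycles, then the first
    homology vanishes. *)
Lemma cycles_are_boundaries :
  (forall s : I -> F, {in E, forall j, \sum_(t in T) s t * D t j = 0} ->
    {in T, forall t, s t = 0}) ->
  (#|T| + #|X| = #|E| + 1)%N ->
  forall z : J -> F, {in X, forall k, \sum_(j in E) z j * B j k = 0} ->
  exists s : I -> F, {in E, forall j, z j = \sum_(t in T) s t * D t j}.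
Proof.
move=> H card z zX.
have [freeD _] := rank_injective_bound H.
have sub : (MD <= kermx MB)%MS by apply/sub_kermxP.
have rD : \rank MD = #|T| by apply/eqP.
have kD : (kermx MB <= MD)%MS.
  rewrite -(geq_leqif (mxrank_leqif_sup sub)) rD mxrank_ker.
  by move: rankB (rank_leq_row MB); lia.
pose zv : 'rV_#|E| := \row_j z (enum_val j).
have /submxP[sv svP] : (zv <= MD)%MS.
  apply: submx_trans kD; apply/sub_kermxP/matrixP => i k; rewrite !mxE.
  rewrite -[RHS](zX _ (enum_valP k)) [RHS]big_enum_val; apply: eq_bigr => j _.
  by rewrite !mxE.
have [s sP] := row_vector_fun sv; exists s => j jE.
have /matrixP/(_ 0 (enum_rank_in jE j)) := svP.
rewrite !mxE enum_rankK_in // => ->; rewrite [RHS]big_enum_val; apply: eq_bigr => l _.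
by rewrite !mxE sP enum_rankK_in.
Qed.

Lemma tree_no_cycle : (#|E| < #|X|)%N ->
  forall z : J -> F, {in X, forall k, \sum_(j in E) z j * B j k = 0} ->
  {in E, forall j, z j = 0}.
Proof.
move=> card z zX j jE.
have freeB : row_free MB.
  by rewrite /row_free eqn_leq rank_leq_row; move: rankB; lia.
pose zv : 'rV_#|E| := \row_j z (enum_val j).
have : zv *m MB = 0.
  apply/matrixP => i k; rewrite !mxE -[RHS](zX _ (enum_valP k)) [RHS]big_enum_val.
  by apply: eq_bigr => l _; rewrite !mxE.
rewrite -(mul0mx _ MB) => /(row_free_inj freeB)/matrixP/(_ 0 (enum_rank_in jE j)).
by rewrite !mxE enum_rankK_in.
Qed.

Lemma connected_edges : (#|X| <= #|E|.+1)%N.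
Proof. by apply: leq_trans rankB _; rewrite ltnS; apply: rank_leq_row. Qed.
End ChainComplex.
Lemma sum_bool (I : finType) (P : pred I) (f : I -> bool) :
  \sum_(i | P i) f i = odd #|[set i | P i & f i]|.
Proof.
rewrite (eq_bigr (fun i => if f i then true else 0)); last by move=> i _; case: (f i).
rewrite -big_mkcondr -big_filter; set s := filter _ _.
have -> : #|[set i | P i & f i]| = size s.
  rewrite cardE; apply: perm_size; apply: uniq_perm; rewrite ?enum_uniq ?filter_uniq ?index_enum_uniq //.
  by move=> x; rewrite mem_enum inE mem_filter mem_index_enum andbT.
elim: s => [|x s IH]; first by rewrite big_nil.
by rewrite big_cons IH /=; case: odd.
Qed.

(** Every pair x, y is counted twice. *)
Lemma handshake (I : finType) (X : {set I}) (r : rel I) :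
  symmetric r -> irreflexive r -> \sum_(x in X) \sum_(y in X) r x y = 0.
Proof.
move=> rs ri; rewrite -big_enum /=; under eq_bigr do rewrite -big_enum /=.
elim: (enum X) => [|a s IH]; first by rewrite big_nil.
rewrite !big_cons ri add0r; under [X in _ + X]eq_bigr do rewrite big_cons.
rewrite big_split /= IH addr0 (eq_bigr (r^~ a)) => [|x _]; last exact: rs.
by case: (\sum_(i <- s) r i a).
Qed.

(** The component of [b] once the edges at [a] are removed has an even sum of
    degrees, so an even number of its vertices are adjacent to [a]: there is a
    second one besides [b]. *)
Lemma even_no_bridge (I : finType) (r : rel I) a b :
  symmetric r -> irreflexive r -> (forall x, ~~ odd #|[set y | r x y]|) ->
  r a b -> exists p, [/\ path r b p, a \notin b :: p, last b p != b & r (last b p) a].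
Proof.
move=> rs ri even rab; pose r' x y := [&& r x y, x != a & y != a].
pose X := [set x | connect r' b x].
have bX : b \in X by rewrite inE connect0.
have ba : b != a by apply: contraTneq rab => ->; rewrite ri.
have path' x p : path r' x p -> x != a -> path r x p /\ a \notin x :: p.
  elim: p x => [|y p IH] x /=; first by rewrite inE eq_sym.
  case/andP=> /and3P[xy xa ya] /IH[]// pp ap _; split; first by rewrite xy.
  by rewrite inE negb_or eq_sym xa.
have aX : a \notin X.
  rewrite inE; apply/negP => /connectP[p pp e]; have [//|_] := path' _ _ pp.
  by rewrite e mem_last.
have out x y : x \in X -> r x y -> y \notin X -> y = a.
  move=> xX xy; apply: contraNeq => ya; move: (xX); rewrite !inE => bx.
  apply: connect_trans bx (connect1 _); rewrite /r' xy ya andbT /=.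
  by apply: contraNneq aX => xa; rewrite -xa.
have sum0 : \sum_(x in X) \sum_y r x y = 0.
  by apply: big1 => x _; rewrite sum_bool; apply/negbTE; have := even x.
have sumE : \sum_(x in X) \sum_y r x y = \sum_(x in X) r x a.
  rewrite (eq_bigr (fun x => \sum_(y in X) r x y + \sum_(y in ~: X) r x y)); last first.
    move=> x _; rewrite (bigID (mem X)) /=; congr (_ + _); apply: eq_bigl => y.
    by rewrite in_setC.
  rewrite big_split /= handshake // add0r; apply: eq_bigr => x xX.
  rewrite (bigD1 a) /=; last by rewrite in_setC.
  rewrite big1 ?addr0 // => y /andP[]; rewrite in_setC => yX ya.
  by apply/negbTE; apply: contra ya => xy; apply/eqP; apply: out xX xy yX.
have [c /and3P[cX cb ca]|none] := pickP [pred c | [&& c \in X, c != b & r c a]].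
  have /connectP[p pp cp] : connect r' b c by move: cX; rewrite inE.
  by have [//|pr ap] := path' _ _ pp; exists p; rewrite -cp.
move: sum0; rewrite sumE (bigD1 b) //= big1; first by rewrite rs rab.
by move=> c /andP[cX cb]; have := none c; rewrite /= cX cb.
Qed.
Lemma set3_perm (V : finType) (x y z : V) :
  [set x; y; z] = [set y; x; z] /\ [set x; y; z] = [set x; z; y].
Proof. by split; apply/setP => u; rewrite !inE; [rewrite (orbC (u == x))|rewrite orbAC]. Qed.

Section Triangles.
Variables (V : finType) (e : rel V).
Hypotheses (e_sym : symmetric e) (e_irr : irreflexive e).
Implicit Types (A : {set V}) (S : {set {set V}}) (u v w x y : V).

Let ne u v : e u v -> u != v := adj_neq e_irr.

Lemma triangle_cliques A u v w :
  ([set u; v; w] \in cliques e 3 A) =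
  [&& u \in A, v \in A, w \in A, e u v, e u w & e v w].
Proof.
rewrite in_cliques !subUset !sub1set -!andbA.
apply: andb_id2l => uA; apply: andb_id2l => vA; apply: andb_id2l => wA.
have E : [set u; v; w] = [set x in [:: u; v; w]].
  by apply/setP => x; rewrite !inE orbA.
apply/andP/and3P => [[]|[uv uw vw]].
  rewrite E cardsE => /eqP/card_uniqP /=; rewrite !inE negb_or andbT.
  move=> /andP[/andP[uv uw] vw] /cliqueP c.
  by split; apply: c; rewrite // !inE eqxx ?orbT.
split.
  by rewrite E cardsE; apply/eqP/card_uniqP; rewrite /= !inE negb_or !ne.
apply/cliqueP => x y; rewrite !inE -!orbA.
by move=> /or3P[]/eqP-> /or3P[]/eqP->; rewrite ?eqxx // e_sym.
Qed.

Lemma triangle_at A t u v : t \in cliques e 3 A -> u \in t -> v \in t -> u != v ->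
  exists x, t = [set u; v; x].
Proof.
rewrite in_cliques => /and3P[_ /eqP ct _] ut vt uv.
have /cards1P[x xE] : #|t :\ u :\ v| == 1%N.
  move: ct; rewrite (cardsD1 u) ut (cardsD1 v (_ :\ _)) !inE eq_sym uv vt /=; lia.
exists x; rewrite -setUA -xE setD1K ?setD1K // !inE eq_sym uv vt //.
Qed.

Lemma card_edge_triangles A S u v : S \subset cliques e 3 A -> e u v ->
  #|[set t in S | [set u; v] \subset t]| = #|[set x in A | [set u; v; x] \in S]|.
Proof.
move=> /subsetP SA uv.
have inj : {in [set x in A | [set u; v; x] \in S] &, injective (fun x => [set u; v; x])}.
  move=> x y; rewrite !inE => /andP[_ /SA]; rewrite triangle_cliques.
  case/and5P=> _ _ _ _ /andP[/ne ux /ne vx] _ /setP/(_ x); rewrite !inE eqxx orbT.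
  by rewrite ![x == _]eq_sym (negbTE ux) (negbTE vx) => /esym/eqP.
rewrite -(card_in_imset inj); apply: eq_card => t; rewrite inE subUset !sub1set.
apply/idP/imsetP => [/and3P[tS ut vt]|[x]].
  have [x tE] := triangle_at (SA _ tS) ut vt (ne uv); exists x => //.
  rewrite inE -tE tS andbT; move: (SA _ tS); rewrite tE triangle_cliques.
  by case/and5P.
by rewrite inE => /andP[_ tS] ->; rewrite tS !inE !eqxx orbT.
Qed.

Lemma double_count (I J : finType) (X : {set I}) (Y : {set J}) (r : I -> J -> bool) :
  (\sum_(x in X) #|[set y in Y | r x y]| = \sum_(y in Y) #|[set x in X | r x y]|)%N.
Proof.
transitivity (\sum_(x in X) \sum_(y in Y) r x y)%N.
  apply: eq_bigr => x _; rewrite -sum1_card big_mkcond [RHS]big_mkcond /=.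
  by apply: eq_bigr => y _; rewrite inE; case: (y \in Y); case: r.
rewrite exchange_big /=; apply: eq_bigr => y _.
rewrite -sum1_card big_mkcond [RHS]big_mkcond /=.
by apply: eq_bigr => x _; rewrite inE; case: (x \in X); case: r.
Qed.

Lemma card_cliques_at k A v : v \in A ->
  #|[set B : {set V} in cliques e k.+1 A | v \in B]| = #|cliques e k (nbr e A v)|.
Proof.
move=> vA; have := card_cliquesS e_sym e_irr k vA.
rewrite -(cardsID [set B : {set V} | v \in B]) => /eqP; rewrite addnC.
have -> : cliques e k.+1 A :\: [set B : {set V} | v \in B] = cliques e k.+1 (A :\ v).
  apply/setP => B; rewrite !inE subsetD1.
  by case: (v \in B); rewrite ?andbF ?andbT.
rewrite eqn_add2l => /eqP <-; apply: eq_card => B; rewrite !inE.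
by rewrite andbC.
Qed.

Lemma sum_degrees A : (\sum_(v in A) #|nbr e A v| = 2 * #|cliques e 2 A|)%N.
Proof.
under eq_bigr => v vA do rewrite -(card_cliques1 e) -card_cliques_at //.
rewrite (double_count A _ (fun v (B : {set V}) => v \in B)) mulnC -sum_nat_const.
apply: eq_bigr => B; rewrite in_cliques => /and3P[BA /eqP <- _].
apply: eq_card => x; rewrite inE andbC; apply: andb_idr; exact: (subsetP BA).
Qed.

Lemma sum_links A : (\sum_(v in A) #|cliques e 2 (nbr e A v)| = 3 * #|cliques e 3 A|)%N.
Proof.
under eq_bigr => v vA do rewrite -card_cliques_at //.
rewrite (double_count A _ (fun v (B : {set V}) => v \in B)) mulnC -sum_nat_const.
apply: eq_bigr => B; rewrite in_cliques => /and3P[BA /eqP <- _].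
apply: eq_card => x; rewrite inE andbC; apply: andb_idr; exact: (subsetP BA).
Qed.

Lemma sum_edge_triangles A :
  (\sum_(B in cliques e 2 A) #|[set t in cliques e 3 A | B \subset t]|
   = 3 * #|cliques e 3 A|)%N.
Proof.
rewrite (double_count _ _ (fun (B t : {set V}) => B \subset t)) mulnC -sum_nat_const.
apply: eq_bigr => t; rewrite in_cliques => /and3P[tA /eqP ct kt].
rewrite -[RHS](_ : 'C(#|t|, 2) = 3%N); last by rewrite ct.
rewrite -cards_draws; apply: eq_card => B; rewrite !inE.
case: (boolP (B \subset t)) => Bt; rewrite ?andbF //= andbT.
by rewrite (subset_trans Bt tA) (cliqueS Bt kt) andbT.
Qed.

(** A cycle of triangles modulo 2. *)
Definition closed_surface A S :=
  {in cliques e 2 A, forall B : {set V}, ~~ odd #|[set t in S | B \subset t]|}.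

End Triangles.

Section PlanarSurfaces.
Variables (V : finType) (e lt : rel V) (n : V -> V -> V -> bool).
Hypotheses (e_sym : symmetric e) (e_irr : irreflexive e).
Hypothesis e_planar : crossing_parity e lt n.
Variables (A : {set V}) (S : {set {set V}}).
Hypotheses (A_atom : atom e A) (S_tri : S \subset cliques e 3 A).

Let ne u v : e u v -> u != v := adj_neq e_irr.

(** The counting form of [atom_edge_triangles]. *)
Lemma atom_edge_le2 u v : u \in A -> v \in A -> e u v ->
  (#|[set x in A | e u x && e v x]| <= 2)%N.
Proof.
move=> uA vA uv; rewrite leqNgt; apply/negP => /card_gt2P[x [y [z [[]]]]].
rewrite !inE => /and3P[xA ux vx] /and3P[yA uy vy] /and3P[zA uz vz] [xy yz zx].
apply: (@atom_edge_triangles V e lt n e_sym e_irr e_planar A u v x y z) => //.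
by rewrite /= !inE negb_or xy yz eq_sym zx.
Qed.

Hypotheses (S_closed : closed_surface e A S) (S_neq0 : S != set0).

Let tri u v w : [set u; v; w] \in S ->
   [/\ u \in A, v \in A & w \in A] /\ [/\ e u v, e u w & e v w].
Proof.
by move/(subsetP S_tri); rewrite triangle_cliques // => /and5P[? ? ? ? /andP[]].
Qed.

Let edge_even u v : ~~ odd #|[set x in A | [set u; v; x] \in S]|.
Proof.
case: (set_0Vmem [set x in A | [set u; v; x] \in S]) => [->|[x]].
  by rewrite cards0.
rewrite inE => /andP[_ /tri[[uA vA _] [uv _ _]]].
rewrite -(card_edge_triangles e_sym e_irr S_tri uv); apply: S_closed.
by rewrite edge_cliques // uA vA.
Qed.

(** The number of triangles of [S] on an edge is even and at most two. *)
Let edge_full u v x : [set u; v; x] \in S ->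
  #|[set y in A | e u y && e v y]| = 2%N /\
  forall y, y \in A -> e u y -> e v y -> [set u; v; y] \in S.
Proof.
move=> uvx; have [[uA vA xA] [uv _ _]] := tri uvx.
pose X := [set y in A | [set u; v; y] \in S].
pose Y := [set y in A | e u y && e v y].
have XY : X \subset Y.
  by apply/subsetP => y; rewrite !inE => /andP[-> /tri[_ [_ -> ->]]].
have X0 : (0 < #|X|)%N by apply/card_gt0P; exists x; rewrite inE xA.
have := edge_even u v; rewrite -/X => X2.
have X1 : (1 < #|X|)%N by move: X0 X2; case: #|X| => [|[]].
have Y2 : (#|Y| <= 2)%N := atom_edge_le2 uA vA uv.
have /eqP E : X == Y by rewrite eqEcard XY (leq_trans Y2).
rewrite -/Y; split; first by apply/eqP; rewrite eqn_leq Y2 -E.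
move=> y yA uy vy; have : y \in X by rewrite E inE yA uy.
by rewrite inE => /andP[].
Qed.

(** The triangles of [S] at [v] form an even graph on the neighbours of [v],
    which therefore contains a cycle; by [atom_link_cycle] no neighbour of [v]
    is off this cycle. *)
Let surface_nbr v w : (exists a b, [set v; a; b] \in S) -> w \in A -> e v w ->
  exists x, [set v; w; x] \in S.
Proof.
move=> [a [b vab]] wA vw; pose r x y := [set v; x; y] \in S.
have rs : symmetric r by move=> x y; rewrite /r (set3_perm v x y).2.
have ri : irreflexive r.
  by move=> x; apply/negP => /tri[_ [_ _]]; rewrite e_irr.
have even x : ~~ odd #|[set y | r x y]|.
  have := edge_even v x; congr (~~ odd _); apply: eq_card => y; rewrite !inE.
  by apply: andb_idl => /tri[[]].
have [p [pp ap lb la]] := even_no_bridge rs ri even vab.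
have re x y : r x y -> e x y by move=> /tri[_ []].
have path_r x q : path r x q -> {subset q <= [pred y | [exists z, r y z]]}.
  elim: q x => [|y q IH] x //= /andP[xy yq] z; rewrite inE => /orP[/eqP->|/(IH y)]; last exact.
  by apply/existsP; exists x; rewrite rs.
have sub : {subset a :: b :: p <= [pred y | [exists z, r y z]]}.
  move=> z; rewrite !inE => /or3P[/eqP->|/eqP->|/(path_r _ _ pp)//].
  - by apply/existsP; exists b.
  - by apply/existsP; exists a; rewrite rs.
suff: w \in a :: b :: p by move/sub/existsP.
have vA : v \in A by have [[]] := tri vab.
apply: (atom_link_cycle e_sym e_irr e_planar A_atom vA).
- by rewrite /= (re _ _ vab); apply: sub_path pp => x y; apply: re.
- exact: re.
- exact: lb.
- by move=> z /sub/existsP[y /tri[[_ zA _] [vz _ _]]]; rewrite in_nbr zA.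
- exact: ap.
- by rewrite in_nbr wA.
Qed.

(** By [surface_nbr] the set of vertices on [S] is closed under adjacency, so
    it is [A]; and with every edge, [S] contains all triangles on it. *)
Lemma closed_surface_full : S = cliques e 3 A /\
  {in cliques e 2 A, forall B : {set V}, #|[set t in cliques e 3 A | B \subset t]| = 2%N}.
Proof.
have conA : conn e A.
  by have /atomP/(_ set0) := A_atom; rewrite setD0; apply; rewrite ?sub0set ?clique0.
pose C := [set v in A | [exists x, exists y, [set v; x; y] \in S]].
have full v w : v \in A -> w \in A -> e v w -> exists x, [set v; w; x] \in S.
  move=> vA wA vw; have vC : v \in C; last first.
    by apply: surface_nbr => //; move: vC; rewrite inE => /andP[_ /existsP[x /existsP[y]]]; exists x, y.
  have /set0Pn[t tS] := S_neq0.
  have /card_gt0P[u ut] : (0 < #|t|)%N.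
    by move/(subsetP S_tri): tS; rewrite in_cliques => /and3P[_ /eqP-> _].
  have [u' [x tE]] : exists u' x, t = [set u; u'; x].
    have /card_gt0P[u'] : (0 < #|t :\ u|)%N.
      move/(subsetP S_tri): tS; rewrite in_cliques => /and3P[_ /eqP ct _].
      by move: ct; rewrite (cardsD1 u) ut; lia.
    rewrite !inE eq_sym => /andP[uu' u't]; exists u'.
    by have [x] := triangle_at (subsetP S_tri _ tS) ut u't uu'; exists x.
  rewrite tE in tS; have [[uA _ _] _] := tri tS.
  have uC : u \in C.
    by rewrite inE uA; apply/existsP; exists u'; apply/existsP; exists x.
  apply/negPn/negP => vC; have := connP _ _ conA u v uA vA.
  move/connect_exit => /(_ _ uC vC)[c [d [cC dC _ dA cd]]].
  move: cC; rewrite inE => /andP[cA /existsP[a /existsP[b cab]]].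
  have [|z dz] := @surface_nbr c d _ dA cd; first by exists a, b.
  case/negP: dC; rewrite inE dA /=; apply/existsP; exists c; apply/existsP; exists z.
  by rewrite (set3_perm d c z).1.
have SE : S = cliques e 3 A.
  apply/eqP; rewrite eqEsubset S_tri; apply/subsetP => t tT.
  have ct : #|t| = 3%N by move: tT; rewrite in_cliques => /and3P[_ /eqP].
  have [u ut] : exists u, u \in t by apply/card_gt0P; rewrite ct.
  have [v] : exists v, v \in t :\ u by apply/card_gt0P; move: ct; rewrite (cardsD1 u) ut; lia.
  rewrite !inE => /andP[vu vt]; rewrite eq_sym in vu.
  have [x tE] := triangle_at tT ut vt vu; move: tT.
  rewrite tE triangle_cliques // => /and5P[uA vA xA uv /andP[ux vx]].
  have [y uvy] := full u v uA vA uv.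
  by have [_] := edge_full uvy; apply.
split=> // B BE; have [u [v [-> uA vA uv]]] := edgeP BE.
rewrite (card_edge_triangles e_sym e_irr (subxx (cliques e 3 A)) uv) //.
have [x uvx] := full u v uA vA uv; have [E2 _] := edge_full uvx.
rewrite -[RHS]E2; apply: eq_card => y; rewrite in_set [RHS]in_set; apply: andb_id2l => yA.
by rewrite triangle_cliques // uA vA yA uv.
Qed.
End PlanarSurfaces.
Section Incidence.
Variables (V : finType) (e : rel V).
Hypotheses (e_sym : symmetric e) (e_irr : irreflexive e).
Implicit Types (A : {set V}) (S : {set {set V}}) (u v w x y : V).
Let ne u v : e u v -> u != v := adj_neq e_irr.

Lemma boundary_boundary A : {in cliques e 3 A & A, forall (t : {set V}) v,
  \sum_(B in cliques e 2 A) (B \subset t) * (v \in B) = 0}.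
Proof.
move=> t v tT vA; rewrite sum_bool.
move: tT; rewrite in_cliques => /and3P[tA /eqP ct kt].
have [vt|vt] := boolP (v \in t); last first.
  rewrite [X in odd X](_ : _ = 0%N) //; apply/eqP; rewrite cards_eq0.
  apply/eqP/setP => B; rewrite in_set0 in_set; apply/negbTE/negP => /and3P[_ Bt vB].
  by case/negP: vt; apply: (subsetP Bt).
suff -> : #|[set B in cliques e 2 A | (B \subset t) * (v \in B)]| = #|t :\ v|.
  by move: ct; rewrite (cardsD1 v) vt add1n => -[->].
have -> : t :\ v = nbr e t v.
  apply/setP => x; rewrite !inE andbC; apply: andb_id2l => xt.
  apply/idP/idP => [xv|/ne]; last by rewrite eq_sym.
  by apply: (cliqueP _ _ kt); rewrite // eq_sym.
rewrite -(card_cliques1 e) -card_cliques_at //; apply: eq_card => B.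
rewrite !in_set; have [Bt|Bt] := boolP (B \subset t); rewrite ?mul0r ?andbF //.
by rewrite (subset_trans Bt tA) mul1r.
Qed.

Lemma sum_pair A (g : V -> bool) u v : u \in A -> v \in A -> u != v ->
  \sum_(k in A) (k \in [set u; v]) * g k = g u + g v.
Proof.
move=> uA vA uv; rewrite (bigD1 u) //= (bigD1 v) /=; last by rewrite vA eq_sym.
rewrite big1 ?addr0; first by rewrite !inE !eqxx orbT !mul1r.
by move=> k /andP[/andP[_ ku] kv]; rewrite !inE (negbTE ku) (negbTE kv) mul0r.
Qed.

Lemma coboundary_const A : conn e A -> forall g : V -> bool,
  {in cliques e 2 A, forall B : {set V}, \sum_(k in A) (k \in B) * g k = 0} ->
  {in A &, forall k k', g k = g k'}.
Proof.
move=> /connP cA g H u v uA vA; have /connectP[p] := cA _ _ uA vA.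
elim: p u {uA} => [|w p IH] u /=; first by move=> _ ->.
case/andP=> /and3P[uA wA uw] pp /(IH _ pp) <-.
have := H [set u; w]; rewrite edge_cliques // uA wA uw => /(_ isT).
by rewrite sum_pair ?ne //; case: (g u); case: (g w).
Qed.

Lemma connected_card A : conn e A -> (#|A| <= #|cliques e 2 A|.+1)%N.
Proof. by move=> cA; apply: connected_edges (coboundary_const cA). Qed.

(** A connected graph with one edge less than vertices is a tree; [z] is the
    indicator of a set of edges with even degrees. *)
Lemma tree_acyclic A : conn e A -> #|A| = #|cliques e 2 A|.+1 ->
  forall z : {set V} -> bool,
    {in A, forall k, \sum_(B in cliques e 2 A) z B * (k \in B) = 0} ->
    {in cliques e 2 A, forall B, z B = 0}.
Proof.
by move=> cA cE; apply: (tree_no_cycle (coboundary_const cA)); rewrite cE.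
Qed.

Fixpoint walk_chain x (p : seq V) (B : {set V}) : bool :=
  if p is y :: q then (B == [set x; y]) + walk_chain y q B else false.

Lemma walk_chain_boundary A x p k : path (within e A) x p ->
  \sum_(B in cliques e 2 A) walk_chain x p B * (k \in B)
  = (k == x) + (k == last x p).
Proof.
elim: p x => [|y p IH] x /=; first by
  move=> _; rewrite big1 => [|B _]; rewrite ?mul0r //; case: (k == x).
case/andP=> /and3P[xA yA xy] /IH E.
rewrite (eq_bigr (fun B : {set V} => (B == [set x; y]) * (k \in B) + walk_chain y p B * (k \in B))).
  2: by move=> B _; rewrite mulrDl.
rewrite big_split /= E (bigD1 [set x; y]) /=; last by rewrite edge_cliques // xA yA.
rewrite eqxx mul1r big1 => [|B /andP[_ /negbTE->]]; last by rewrite mul0r.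
rewrite !inE; case: (eqVneq k x) => [->|_].
  by rewrite (negbTE (ne xy)); case: (x == last y p).
by case: (k == y); case: (k == last y p).
Qed.

Lemma walk_chain_avoid x p v (B : {set V}) : v \notin x :: p -> v \in B ->
  walk_chain x p B = false.
Proof.
elim: p x => [|y p IH] x //=; rewrite inE negb_or => /andP[vx vp] vB.
rewrite IH // addr0; apply/negbTE/eqP => BE; move: vp vB.
by rewrite BE !inE (negbTE vx) /= => /norP[/negbTE->].
Qed.

Lemma walk_chain_rcons x p y (B : {set V}) :
  walk_chain x (rcons p y) B = walk_chain x p B + (B == [set last x p; y]).
Proof. by elim: p x => [|z p IH] x /=; rewrite ?IH ?addrA ?addr0 ?add0r. Qed.

(** The triangles of [S] at [v], viewed as a chain of edges of the link of [v]. *)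
Lemma link_boundary A S v k : S \subset cliques e 3 A -> v \in A -> k \in nbr e A v ->
  \sum_(C in cliques e 2 (nbr e A v)) (v |: C \in S) * (k \in C)
  = odd #|[set t in S | [set v; k] \subset t]|.
Proof.
move=> /subsetP SA vA; rewrite in_nbr => /andP[kA vk]; rewrite sum_bool; congr odd.
have vC C : C \in cliques e 2 (nbr e A v) -> v \notin C.
  rewrite in_cliques => /and3P[/subsetP sC _ _]; apply/negP => /sC.
  by rewrite in_nbr e_irr andbF.
have inj : {in [set C in cliques e 2 (nbr e A v) | (v |: C \in S) * (k \in C)] &,
    injective (fun C => v |: C)}.
  move=> C C'; rewrite in_set => /andP[/vC vC1 _]; rewrite in_set => /andP[/vC vC2 _] E.
  by rewrite -(setU1K vC1) -(setU1K vC2) E.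
rewrite -(card_in_imset inj); apply: eq_card => t; rewrite in_set.
rewrite subUset !sub1set; apply/imsetP/and3P => [[C]|[tS vt kt]].
  rewrite in_set => /and3P[CC CS kC] ->.
  by split=> //; rewrite !inE ?eqxx ?kC ?orbT.
have [x tE] := triangle_at (SA _ tS) vt kt (ne vk).
move: (SA _ tS); rewrite tE triangle_cliques // => /and5P[_ _ xA _ /andP[vx kx]].
exists [set k; x]; last by rewrite setUA.
have E : v |: [set k; x] = t by rewrite tE setUA.
by rewrite in_set edge_cliques // !in_nbr kA vk xA vx kx E tS /= !inE eqxx.
Qed.

End Incidence.

(** * Counting edges and triangles of planar atoms *)

Section Euler.
Variables (V : finType) (e lt : rel V) (n : V -> V -> V -> bool).
Hypotheses (e_sym : symmetric e) (e_irr : irreflexive e).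
Hypothesis e_planar : crossing_parity e lt n.
Variables (A : {set V}).
Hypotheses (A_atom : atom e A).

Let ne u v : e u v -> u != v := adj_neq e_irr.

Let conA : conn e A.
Proof.
by have /atomP/(_ set0) := A_atom; rewrite setD0; apply; rewrite ?sub0set ?clique0.
Qed.

Local Notation E := (cliques e 2 A).
Local Notation T := (cliques e 3 A).

Let kernel_closed (s : {set V} -> bool) :
  {in E, forall B : {set V}, \sum_(t in T) s t * (B \subset t) = 0} ->
  closed_surface e A [set t in T | s t].
Proof.
move=> H B BE; have := H B BE; rewrite sum_bool => /negbT.
congr (~~ odd _); apply: eq_card => t; rewrite !in_set -!andbA; congr (_ && _).
Qed.

(** Either the set of all triangles is the only 2-cycle, and then each edge is
    in exactly two triangles, or there are none. In both cases the rank of the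
    boundary map from triangles to edges is known, and bounded by the dimension
    m - n + 1 of the cycle space. *)
Lemma atom_euler :
  (3 * #|T| = 2 * #|E| /\ #|T| + #|A| <= #|E| + 2)%N \/
  (forall s : {set V} -> bool,
     {in E, forall B : {set V}, \sum_(t in T) s t * (B \subset t) = 0} ->
     {in T, forall t, s t = 0}) /\ (#|T| + #|A| <= #|E| + 1)%N.
Proof.
have [cl|] := boolP [exists S : {set {set V}}, [&& S \subset T, S != set0 &
    [forall B in E, ~~ odd #|[set t in S | B \subset t]|]]].
  left; have /existsP[S /and3P[ST S0 /forall_inP Scl]] := cl.
  have full := closed_surface_full e_sym e_irr e_planar A_atom.
  split.
    have [_ two] := full S ST Scl S0.
    rewrite -sum_edge_triangles // mulnC -sum_nat_const; apply: eq_bigr => B BE.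
    exact: two.
  apply: (rank_exact_bound (boundary_boundary e_sym e_irr (A := A))
    (coboundary_const e_sym e_irr conA) (s0 := fun=> 1)) => s sE.
  have [S0'|S0'] := eqVneq [set t in T | s t] set0.
    exists 0 => t tT; rewrite mul0r; apply/negbTE/negP => st.
    by have := in_set0 t; rewrite -S0' in_set tT st.
  have sT : [set t in T | s t] \subset T by apply/subsetP => t; rewrite in_set => /andP[].
  have [ST' _] := full _ sT (kernel_closed sE) S0'.
  by exists 1 => t tT; move: tT; rewrite -{1}ST' in_set mulr1 => /andP[_ ->].
move=> none; right.
have inj (s : {set V} -> bool) :
    {in E, forall B : {set V}, \sum_(t in T) s t * (B \subset t) = 0} ->
    {in T, forall t, s t = 0}.
  move=> sE t tT; apply/negbTE; apply: contraNN none => st; apply/existsP.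
  exists [set t in T | s t]; apply/and3P; split.
  - by apply/subsetP => t'; rewrite in_set => /andP[].
  - by apply/set0Pn; exists t; rewrite in_set tT.
  - by apply/forall_inP => B BE; apply: kernel_closed.
split=> //.
by have [_] := rank_injective_bound (boundary_boundary e_sym e_irr (A := A))
  (coboundary_const e_sym e_irr conA) inj.
Qed.

Section Disc.
Hypothesis n4 : (4 <= #|A|)%N.
Hypotheses (mE : (#|E| + 3 = 2 * #|A|)%N) (tE : (#|T| + 2 = #|A|)%N).

Let inj : forall s : {set V} -> bool,
     {in E, forall B : {set V}, \sum_(t in T) s t * (B \subset t) = 0} ->
     {in T, forall t, s t = 0}.
Proof. by case: atom_euler => -[//]; lia. Qed.

(** The first homology vanishes, by [cycles_are_boundaries]. *)
Let walk_boundary x p : path (within e A) x p -> last x p = x ->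
  exists S : {set {set V}}, S \subset T /\
    {in E, forall B : {set V}, walk_chain x p B = odd #|[set t in S | B \subset t]|}.
Proof.
move=> pp lp.
have [||s sE] := cycles_are_boundaries (boundary_boundary e_sym e_irr (A := A))
  (coboundary_const e_sym e_irr conA) inj _ (z := walk_chain x p).
- by rewrite -/E; lia.
- by move=> k kA; rewrite walk_chain_boundary // lp; case: (k == x).
exists [set t in T | s t]; split; first by apply/subsetP => t; rewrite in_set => /andP[].
move=> B BE; rewrite sE // sum_bool; congr odd; apply: eq_card => t.
by rewrite !in_set -!andbA.
Qed.

(** Two neighbours x and y of v are joined by a path avoiding v, since {v} is
    not a separator. With v it forms a cycle; let [S] be a set of triangles
    bounded by it. In the graph formed by [S] on the link of v exactly x and y
    have odd degree, so they are in the same component. *)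
Let link_conn v : v \in A -> conn e (nbr e A v).
Proof.
move=> vA; apply/connP => x y; rewrite !in_nbr => /andP[xA vx] /andP[yA vy].
have xN : x \in nbr e A v by rewrite in_nbr xA.
have [->|xy] := eqVneq x y; first exact: connect0.
have /atomP/(_ [set v]) := A_atom; rewrite sub1set vA clique1 => /(_ isT isT)/connP.
have out w : w \in A -> e v w -> w \in A :\ v by move=> wA /ne vw; rewrite !inE eq_sym vw.
move=> /(_ x y (out _ xA vx) (out _ yA vy)) /connectP[p pp yE].
have vp : v \notin x :: p.
  rewrite inE (negbTE (ne vx)) /=; apply/negP => /(path_within_sub pp).
  by rewrite !inE eqxx.
have ppA : path (within e A) x p.
  by apply: sub_path pp => a b /and3P[/setD1P[_ aA] /setD1P[_ bA] ab]; apply/and3P.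
have [||S [ST SE]] := @walk_boundary x (rcons (rcons p v) x).
- rewrite !rcons_path ppA -yE last_rcons /within xA yA vA /= e_sym vy.
  by rewrite vx.
- by rewrite last_rcons.
have deg w : w \in nbr e A v ->
    odd #|[set u in A | [set v; w; u] \in S]| = (w == x) + (w == y).
  rewrite in_nbr => /andP[wA vw].
  rewrite -(card_edge_triangles e_sym e_irr ST vw) -SE ?edge_cliques ?vA ?wA //.
  rewrite !walk_chain_rcons (walk_chain_avoid vp) ?inE ?eqxx // -yE last_rcons add0r.
  have pair u : e v u -> ([set v; w] == [set v; u]) = (w == u).
    move=> vu; apply/eqP/eqP => [/setP/(_ u)|->//].
    by rewrite !inE eqxx orbT ![u == _]eq_sym (negbTE (ne vu)) => /eqP.
  by rewrite (setUC [set y]) !pair // addrC.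
pose r a b := within e (nbr e A v) a b && ([set v; a; b] \in S).
pose X := [set w | connect (within e (nbr e A v)) x w].
have rs : symmetric r.
  by move=> a b; rewrite /r (within_sym _ e_sym) (set3_perm v a b).2.
have ri : irreflexive r by move=> a; rewrite /r /within e_irr !andbF.
have XN w : w \in X -> w \in nbr e A v.
  rewrite inE => xw; have [<-//|xw'] := eqVneq x w.
  by have /andP[] := connect_within_mem xw xw'.
have := handshake X rs ri.
rewrite (eq_bigr (fun w => (w == x) + (w == y))) => [|w wX]; last first.
  rewrite -(deg w (XN _ wX)) sum_bool; congr odd; apply: eq_card => u.
  rewrite !in_set; apply/idP/idP.
    case/and3P=> uX; rewrite /within !in_nbr => /and3P[_ /andP[uA _] _] ->.
    by rewrite uA.
  case/andP=> uA wuS; have := subsetP ST _ wuS; rewrite triangle_cliques //.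
  case/and5P=> _ wA _ vw /andP[vu wu].
  have wuN : within e (nbr e A v) w u by rewrite /within !in_nbr wA uA vw vu.
  rewrite /r wuN wuS andbT andbT; move: wX; rewrite !inE => xw.
  by apply: connect_trans xw (connect1 _).
rewrite big_split /= (bigD1 x) ?inE ?connect0 //= eqxx big1 => [|w /andP[_ /negbTE->]//].
rewrite addr0; have [yX|yX] := boolP (y \in X); first by move: yX; rewrite inE.
by rewrite big1 // => w wX; apply/negbTE; apply: contraNneq yX => <-.
Qed.

(** Links are connected, so each has at least as many edges as vertices minus
    one, and the numbers of edges and triangles make the sum of the differences
    vanish. *)
Let link_tree v : v \in A -> #|nbr e A v| = #|cliques e 2 (nbr e A v)|.+1.
Proof.
move=> vA; apply/eqP; rewrite eqn_leq connected_card ?link_conn //= leqNgt.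
apply/negP => h.
have le w : w \in A -> (#|nbr e A w| <= #|cliques e 2 (nbr e A w)|.+1)%N.
  by move=> wA; apply: connected_card => //; apply: link_conn.
have : (\sum_(w in A) #|nbr e A w| < \sum_(w in A) #|cliques e 2 (nbr e A w)|.+1)%N.
  rewrite (bigD1 v) // [X in (_ < X)%N](bigD1 v) //= -addSn leq_add //.
  by apply: leq_sum => w /andP[wA _]; apply: le.
under [X in (_ < X)%N]eq_bigr do rewrite -addn1.
rewrite big_split /= sum_degrees // sum_links // sum1_card; lia.
Qed.

(** On average an edge is in more than one triangle, so some uv is in two
    triangles, with third vertices w1 and w2. Since {u, v} is not a separator,
    w1 and w2 are joined by a path avoiding both; close it through u, and let
    [S] be a set of triangles with this boundary. As the link of v is a tree,
    no triangle of [S] contains v. As the link of u is a tree, the triangles of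
    [S] at u form the unique path from w1 to w2 in it, which goes through v. *)
Lemma atom_not_disc : False.
Proof.
have [B /andP[BE]|none] :=
  pickP [pred B | (B \in E) && (1 < #|[set t in T | B \subset t]|)%N]; last first.
  have : (\sum_(B in E) #|[set t in T | B \subset t]| <= \sum_(B in E) 1)%N.
    by apply: leq_sum => B BE; have := none B; rewrite /= BE ltnNge => /negbFE.
  by rewrite sum_edge_triangles // sum1_card; lia.
have [u [v [-> uA vA uv]]] := edgeP BE.
rewrite (card_edge_triangles e_sym e_irr (subxx _) uv) => /card_gt1P[w1 [w2 [W1 W2 w12]]].
move: W1; rewrite in_set triangle_cliques // => /and5P[w1A _ _ _ /and3P[_ uw1 vw1]].
move: W2; rewrite in_set triangle_cliques // => /and5P[w2A _ _ _ /and3P[_ uw2 vw2]].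
have /atomP/(_ [set u; v]) := A_atom; rewrite subUset !sub1set uA vA => /(_ isT).
have -> : clique e [set u; v].
  have : [set u; v] \in E by rewrite edge_cliques // uA vA.
  by rewrite in_cliques => /and3P[].
move=> /(_ isT)/connP.
have out w : w \in A -> e u w -> e v w -> w \in A :\: [set u; v].
  by move=> wA /ne uw /ne vw; rewrite !inE negb_or ![w == _]eq_sym uw vw.
move=> /(_ w1 w2 (out _ w1A uw1 vw1) (out _ w2A uw2 vw2)) /connectP[p pp w2E].
have sub : {subset w1 :: p <= A :\: [set u; v]}.
  by move=> w; rewrite inE => /orP[/eqP->|/(path_within_sub pp)//]; apply: out.
have up : u \notin w1 :: p by apply/negP => /sub; rewrite !inE eqxx.
have vp : v \notin w1 :: p by apply/negP => /sub; rewrite !inE eqxx orbT.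
have ppA : path (within e A) w1 p.
  by apply: sub_path pp => a b /and3P[/setDP[aA _] /setDP[bA _] ab]; apply/and3P.
have [||S [ST SE]] := @walk_boundary u (w1 :: rcons p u).
- rewrite /= rcons_path ppA -w2E /within uA w1A w2A uw1 /=.
  by rewrite e_sym.
- by rewrite /= last_rcons.
have pair x y z : x != z -> ([set x; y] == [set x; z]) = (y == z).
  move=> xz; apply/eqP/eqP => [/setP/(_ z)|->//].
  by rewrite !inE eqxx orbT ![z == _]eq_sym (negbTE xz) => /eqP.
have uwalk : v \notin u :: w1 :: rcons p u.
  by rewrite inE eq_sym negb_or (ne uv) -rcons_cons mem_rcons inE eq_sym negb_or (ne uv).
have S_v k : k \in nbr e A v -> ~~ odd #|[set t in S | [set v; k] \subset t]|.
  rewrite in_nbr => /andP[kA vk]; rewrite -SE ?edge_cliques ?vA ?kA //.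
  by rewrite (walk_chain_avoid uwalk) // !inE eqxx.
have S_u k : k \in nbr e A u ->
    odd #|[set t in S | [set u; k] \subset t]| = (k == w1) + (k == w2).
  rewrite in_nbr => /andP[kA uk]; rewrite -SE ?edge_cliques ?uA ?kA //.
  rewrite /= walk_chain_rcons (walk_chain_avoid up) ?inE ?eqxx // add0r -w2E.
  by rewrite (setUC [set w2]) !pair // ne.
have vN : v \in nbr e A u by rewrite in_nbr vA.
have w1N : w1 \in nbr e A u by rewrite in_nbr w1A.
have w2N : w2 \in nbr e A u by rewrite in_nbr w2A.
have flower_v C : C \in cliques e 2 (nbr e A v) -> (v |: C \in S) = false.
  apply: (tree_acyclic e_sym e_irr (link_conn vA) (link_tree vA) (z := fun C => v |: C \in S)).
  by move=> k kv; rewrite link_boundary //; apply/negbTE/S_v.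
have flower_u C : C \in cliques e 2 (nbr e A u) ->
    (u |: C \in S) + ((C == [set v; w1]) + (C == [set v; w2])) = 0.
  apply: (tree_acyclic e_sym e_irr (link_conn uA) (link_tree uA)
    (z := fun C => (u |: C \in S) + ((C == [set v; w1]) + (C == [set v; w2])))).
  move=> k ku.
  rewrite (eq_bigr (fun C : {set V} => (u |: C \in S) * (k \in C) +
    walk_chain w1 [:: v; w2] C * (k \in C))); last first.
    by move=> D _; rewrite mulrDl /= (setUC [set w1]) addr0.
  have path_w : path (within e (nbr e A u)) w1 [:: v; w2].
    by rewrite /= /within w1N vN w2N e_sym vw1 vw2.
  have /= W := walk_chain_boundary e_sym e_irr k path_w.
  rewrite big_split /= link_boundary // S_u // W.
  by case: (k == w1); case: (k == w2).
have := flower_u [set v; w1]; rewrite edge_cliques // vN w1N vw1 => /(_ isT).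
rewrite eqxx pair ?ne // (negbTE w12) addr0.
(* The triangle u v w1 would be in S, seen from u, and not in S, seen from v. *)
have -> : u |: [set v; w1] = v |: [set u; w1] by rewrite setUCA.
by rewrite flower_v // edge_cliques // !in_nbr uA w1A vw1 uw1 e_sym uv.
Qed.
End Disc.
End Euler.

From mathcomp Require Import ring lra.

(** * Chromatic polynomials *)

Lemma poly_nat_ext (p q : {poly int}) : (forall k, p.[k.+1%:R] = q.[k.+1%:R]) -> p = q.
Proof.
move=> pq; apply/eqP; rewrite -subr_eq0; apply/negPn/negP => d0.
pose s : seq int := [seq i.+1%:R | i <- iota 0 (size (p - q))].
have := max_poly_roots d0 (rs := s).
rewrite size_map size_iota ltnn => H; suff: false by [].
apply: H.
  apply/allP => _ /mapP[i _ ->].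
  by rewrite /root hornerD hornerN pq subrr.
rewrite map_inj_uniq ?iota_uniq // => i j /eqP.
by rewrite eqr_nat eqSS => /eqP.
Qed.

Section Colorings.
Variable V : finType.
Implicit Types (e : rel V) (A B : {set V}) (u v w x y : V) (p q : {poly int}).

(** Proper colourings of [A] with k + 1 colours, as functions on all vertices
    that are constant outside of [A]. *)
Definition col k e A := [set f : {ffun V -> 'I_k.+1} |
  [forall u, (u \notin A) ==> (f u == ord0)] &&
  [forall u in A, forall v in A, e u v ==> (f u != f v)]].

(** With k + 1 colours there is always the colour 0 for the vertices outside of
    [A]; these values suffice to determine [p]. *)
Definition chromatic e A p := forall k, p.[k.+1%:R] = #|col k e A|%:R.

Lemma colP k e A (f : {ffun V -> 'I_k.+1}) : reflect
  ((forall u, u \notin A -> f u = ord0) /\ {in A &, forall u v, e u v -> f u != f v})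
  (f \in col k e A).
Proof.
rewrite inE; apply: (iffP andP) => -[H1 H2]; split.
- by move=> u uA; have /implyP/(_ uA)/eqP := forallP H1 u.
- by move=> u v uA vA; have /forall_inP/(_ v vA)/implyP := forall_inP H2 u uA.
- by apply/forallP => u; apply/implyP => /H1->.
- by apply/forall_inP => u uA; apply/forall_inP => v vA; apply/implyP; apply: H2.
Qed.

Lemma chromatic_uniq e A p q : chromatic e A p -> chromatic e A q -> p = q.
Proof. by move=> pP qP; apply: poly_nat_ext => k; rewrite pP qP. Qed.

Definition del e x y : rel V := fun u v => e u v && ([set u; v] != [set x; y]).
(** Contraction keeps [x] as the name of the merged vertex and is used on the
    set without [y]. *)
Definition con e x y : rel V := fun u v =>
  (u != v) && [|| e u v, (u == x) && e y v | (v == x) && e u y].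

Variable e : rel V.
Hypotheses (e_sym : symmetric e) (e_irr : irreflexive e).

Let ne u v : e u v -> u != v := adj_neq e_irr.

Lemma del_sym x y : symmetric (del e x y).
Proof. by move=> u v; rewrite /del e_sym setUC. Qed.
Lemma del_irr x y : irreflexive (del e x y).
Proof. by move=> u; rewrite /del e_irr. Qed.
Lemma con_irr x y : irreflexive (con e x y).
Proof. by move=> u; rewrite /con eqxx. Qed.
Lemma con_sym x y : symmetric (con e x y).
Proof.
move=> u v; rewrite /con eq_sym e_sym (e_sym y v) (e_sym u y); congr (_ && (_ || _)).
by rewrite orbC.
Qed.

Lemma del_E x y u v : del e x y u v =
  e u v && ~~ ((u == x) && (v == y) || (u == y) && (v == x)).
Proof.
congr (_ && ~~ _); apply/eqP/idP => [/setP E|].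
  have := E x; have := E y; have := E u; have := E v; rewrite !inE !eqxx ?orbT /=.
  rewrite ![x == _]eq_sym ![y == _]eq_sym.
  by case: (u == x); case: (v == x); case: (u == y); case: (v == y).
by case/orP => /andP[/eqP-> /eqP->]; rewrite // setUC.
Qed.

Section Step.
Variables (A : {set V}) (x y : V).
Hypotheses (xA : x \in A) (yA : y \in A) (xy : e x y).

(** The colourings of the graph without the edge xy with equal colours at x
    and y are those of the contracted graph. *)
Lemma card_col_del_con k :
  (#|col k e A| + #|col k (con e x y) (A :\ y)| = #|col k (del e x y) A|)%N.
Proof.
have nxy := ne xy; have yx : e y x by rewrite e_sym.
rewrite -(cardsID [set f : {ffun V -> 'I_k.+1} | f x == f y] (col k (del e x y) A)).
rewrite addnC; congr (_ + _)%N; last first.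
  apply: eq_card => f; rewrite in_setD in_set.
  apply/colP/andP => [[H0 H1]|[fxy /colP[H0 H1]]].
    split; first exact: H1.
    by apply/colP; split=> // u v uA vA; rewrite /del => /andP[uv _]; apply: H1.
  split=> // u v uA vA uv.
  case: (boolP ([set u; v] == [set x; y])) => E; last by apply: H1; rewrite // /del uv.
  have : ~~ del e x y u v by rewrite /del E andbF.
  rewrite del_E uv /= negbK => /orP[]/andP[/eqP-> /eqP->] //.
  by rewrite eq_sym.
pose h (g : {ffun V -> 'I_k.+1}) := [ffun u => if u == y then g x else g u].
have inj : {in col k (con e x y) (A :\ y) &, injective h}.
  move=> g g' /colP[g0 _] /colP[g0' _] /ffunP E; apply/ffunP => u.
  have [->|uy] := eqVneq u y; first by rewrite g0 ?g0' // !inE eqxx.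
  by have := E u; rewrite !ffunE (negbTE uy).
rewrite -(card_in_imset inj); apply: eq_card => f; rewrite in_setI in_set.
apply/imsetP/andP => [[g /colP[g0 g1] ->]|[/colP[f0 f1] /eqP fxy]].
  rewrite !ffunE eqxx (negbTE nxy); split=> //; apply/colP; split.
    move=> u uA; rewrite ffunE; case: eqP uA => [->|_ uA]; first by rewrite yA.
    by apply: g0; rewrite !inE (negbTE uA) andbF.
  move=> u v uA vA; rewrite del_E !ffunE => /andP[uv].
  have := ne uv.
  case: (eqVneq u y) uv => [->|uy] uv; case: (eqVneq v y) uv => [->|vy] uv //=.
  - move=> _; rewrite (negbTE (ne yx)) /= => vx; apply: g1; rewrite ?in_setD1 ?vA ?vy ?xA ?nxy //.
    by rewrite /con eq_sym vx eqxx uv orbT.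
  - move=> _; rewrite orbF andbT => ux; apply: g1; rewrite ?in_setD1 ?uA ?uy ?xA ?nxy //.
    by rewrite /con ux eqxx uv !orbT.
  - move=> uv' _; apply: g1; rewrite ?in_setD1 ?uA ?vA ?uy ?vy //.
    by rewrite /con uv' uv.
exists [ffun u => if u == y then ord0 else f u]; last first.
  by apply/ffunP => u; rewrite !ffunE (negbTE nxy); case: eqP => // ->.
apply/colP; split=> [u|u v].
  by rewrite !inE ffunE negb_and negbK; case: eqP => // _ /f0.
rewrite !in_setD1 !ffunE => /andP[uy uA] /andP[vy vA].
rewrite (negbTE uy) (negbTE vy) /con => /andP[uv].
have D a b : e a b -> a != y -> b != y -> del e x y a b.
  by move=> ab ay by_; rewrite del_E ab (negbTE ay) (negbTE by_) andbF.
case/or3P => [euv|/andP[/eqP ux yv]|/andP[/eqP vx uy']].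
- by apply: f1 => //; apply: D.
- rewrite ux fxy; apply: f1 => //; rewrite del_E yv (eq_sym y x) (negbTE nxy) /= eqxx /=.
  by rewrite eq_sym -ux.
- rewrite vx fxy; apply: f1 => //; rewrite del_E uy' eqxx (negbTE uy) andbT orbF.
  by rewrite -vx.
Qed.

Lemma chromatic_del_con p q : chromatic (del e x y) A p ->
  chromatic (con e x y) (A :\ y) q -> chromatic e A (p - q).
Proof.
move=> pP qP k; rewrite hornerD hornerN pP qP -card_col_del_con.
by rewrite natrD addrK.
Qed.

Lemma cliques_del k :
  cliques (del e x y) k A = [set B in cliques e k A | ~~ ([set x; y] \subset B)].
Proof.
apply/setP => B; rewrite in_set !in_cliques -!andbA; apply: andb_id2l => BA.
apply: andb_id2l => _; apply/cliqueP/andP => [H|[/cliqueP H] xyB u v uB vB uv].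
  split; first by apply/cliqueP => u v uB vB uv; have /andP[] := H u v uB vB uv.
  apply/negP; rewrite subUset !sub1set => /andP[xB yB].
  by have := H x y xB yB (ne xy); rewrite /del eqxx andbF.
rewrite /del H //=; apply: contraNneq xyB => <-.
by rewrite subUset !sub1set uB vB.
Qed.

Let c := #|[set w in A | e x w && e y w]|.

Lemma card_edges_del : (#|cliques (del e x y) 2 A| + 1 = #|cliques e 2 A|)%N.
Proof.
have xyE : [set x; y] \in cliques e 2 A by rewrite edge_cliques // xA yA.
rewrite cliques_del addnC (cardsD1 [set x; y] (cliques e 2 A)) xyE; congr (_ + _)%N.
apply: eq_card => B; rewrite in_set in_setD1 andbC; case BE : (B \in _); rewrite ?andbF //.
rewrite !andbT; congr (~~ _); rewrite [RHS]eq_sym eqEcard; apply/esym/andb_idr => _.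
by move: BE xyE; rewrite !in_cliques => /and3P[_ /eqP-> _] /and3P[_ /eqP-> _].
Qed.

Lemma card_triangles_del : (#|cliques (del e x y) 3 A| + c = #|cliques e 3 A|)%N.
Proof.
rewrite cliques_del -(cardsID [set t : {set V} | [set x; y] \subset t] (cliques e 3 A)).
rewrite addnC; congr (_ + _)%N; last first.
  by apply: eq_card => t; rewrite in_set in_setD in_set andbC.
transitivity #|[set w in A | [set x; y; w] \in cliques e 3 A]|.
  apply: eq_card => w; rewrite in_set [RHS]in_set; apply: andb_id2l => wA.
  by rewrite triangle_cliques // xA yA wA xy.
rewrite -(card_edge_triangles e_sym e_irr (subxx (cliques e 3 A)) xy).
by apply: eq_card => t; rewrite in_setI [LHS]in_set; congr andb; rewrite in_set.
Qed.

(** Contraction loses the edge xy and merges the two edges from each common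
    neighbour of x and y. *)
Lemma card_edges_con : (#|cliques (con e x y) 2 (A :\ y)| + 1 + c = #|cliques e 2 A|)%N.
Proof.
have nxy := ne xy.
have xAy : x \in A :\ y by rewrite in_setD1 nxy.
rewrite (card_edges (@con_sym x y) (con_irr x y) xAy).
rewrite (card_edges e_sym e_irr yA) (card_edges e_sym e_irr xAy).
have -> : cliques (con e x y) 2 (A :\ y :\ x) = cliques e 2 (A :\ y :\ x).
  apply: eq_cliques => u v; rewrite !in_setD1 => /and3P[ux uy _] /and3P[vx vy _].
  rewrite /con (negbTE ux) (negbTE vx) /= orbF; apply: andb_idl; exact: ne.
set U := nbr e (A :\ y) x.
have -> : nbr (con e x y) (A :\ y) x = U :|: (nbr e A y :\ x).
  apply/setP => u; rewrite !inE /con eqxx /= [x == u]eq_sym.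
  case: (eqVneq u x) => [->|ux] /=; first by rewrite e_irr !andbF.
  case: (eqVneq u y) => [->|uy] //=; first by rewrite e_irr !andbF.
  by rewrite orbF andb_orr.
have E : #|nbr e A y| = (1 + #|nbr e A y :\ x|)%N.
  by rewrite (cardsD1 x (nbr e A y)) in_nbr xA e_sym xy.
have : c = #|U :&: (nbr e A y :\ x)|.
  apply: eq_card => w; rewrite !inE; apply/and3P/andP => [[wA xw yw]|].
    by rewrite wA xw yw ![w == _]eq_sym !ne.
  by case=> /andP[/andP[_ wA] xw] /and3P[_ _ yw].
have := cardsUI U (nbr e A y :\ x); lia.
Qed.
End Step.
End Colorings.
Section Coefficients.
Variable V : finType.
Implicit Types (e : rel V) (A : {set V}) (p q : {poly int}).

Lemma card_col_edgeless k e A : cliques e 2 A = set0 -> symmetric e -> irreflexive e ->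
  #|col k e A| = (k.+1 ^ #|A|)%N.
Proof.
move=> E0 es ei; rewrite -[X in (X ^ _)%N]card_ord -(card_pffun_on ord0).
apply: eq_card => f; apply/colP/pffun_onP => [[f0 _]|[/supportP f0 _]].
  by split; [apply/supportP => u; apply: f0|move=> ? _; rewrite inE].
split=> // u v uA vA uv.
have : [set u; v] \in cliques e 2 A by rewrite edge_cliques // uA vA.
by rewrite E0 inE.
Qed.

Definition leading_coefs e A p :=
  [/\ (size p <= #|A|.+1)%N, p`_#|A| = 1,
      forall n, #|A| = n.+1 -> p`_n = - #|cliques e 2 A|%:R
    & forall n, #|A| = n.+2 ->
        p`_n = 'C(#|cliques e 2 A|, 2)%:R - #|cliques e 3 A|%:R].

(** Induction by deletion and contraction. In the step the third coefficient
    works out because the number of common neighbours of x and y is both the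
    number of triangles lost by deletion and the number of edges merged by
    contraction. *)
Lemma chromatic_exists e A : symmetric e -> irreflexive e ->
  exists p, [/\ chromatic e A p, leading_coefs e A p & A != set0 -> root p 0].
Proof.
have [m] := ubnP #|cliques e 2 A|; elim: m e A => // m IH e A.
rewrite ltnS => mE es ei.
have [E0|[B BE]] := set_0Vmem (cliques e 2 A).
  have t0 : #|cliques e 3 A| = 0%N.
    by have := sum_edge_triangles e A; rewrite E0 big_set0; lia.
  exists 'X^#|A|; split.
  - by move=> k; rewrite hornerXn card_col_edgeless // natrX.
  - rewrite /leading_coefs t0 E0 cards0 size_polyXn coefXn eqxx; split=> // n ->.
      by rewrite coefXn oppr0 eqn_leq ltnn andbF.
    by rewrite coefXn subrr eqn_leq (leqNgt _ n) leqnSn andbF.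
  - by rewrite -card_gt0 => A0; rewrite /root hornerXn expr0n -leqn0 leqNgt A0.
have [x [y [_ xA yA xy]]] := edgeP BE => {B BE}.
have nxy : x != y by apply: contraTneq xy => ->; rewrite ei.
have m1 := card_edges_del es ei xA yA xy.
have m2 := card_edges_con es ei xA yA xy.
have t1 := card_triangles_del es ei xA yA xy.
have [|p [pP [p1 p2 p3 p4] p5]] := IH _ A _ (del_sym es x y) (del_irr ei x y); first by lia.
have [|q [qP [q1 q2 q3 q4] q5]] := IH _ (A :\ y) _ (con_sym es x y) (con_irr e x y); first by lia.
have cA : #|A| = #|A :\ y|.+1 by rewrite (cardsD1 y A) yA.
exists (p - q); split.
- exact: chromatic_del_con pP qP.
- split.
  + apply: leq_trans (size_polyD _ _) _; rewrite size_polyN geq_max p1 cA.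
    exact: leqW.
  + by rewrite coefB p2 nth_default ?subr0 // cA.
  + move=> n nA; have cq : #|A :\ y| = n by move: cA; rewrite nA => -[].
    by rewrite coefB (p3 _ nA) -cq q2 -m1 natrD opprD.
  + move=> n nA; have cq : #|A :\ y| = n.+1 by move: cA; rewrite nA => -[].
    rewrite coefB (p4 _ nA) (q3 _ cq) -m1 addn1 binS bin1 -t1 opprK !natrD.
    have -> : #|cliques (del e x y) 2 A| = (#|cliques (con e x y) 2 (A :\ y)| +
      #|[set w in A | e x w && e y w]|)%N by lia.
    by rewrite natrD; ring.
- move=> _; rewrite /root hornerD hornerN.
  rewrite (rootP (p5 _)) ?(rootP (q5 _)) ?subrr //.
    by apply/set0Pn; exists x; rewrite in_setD1 nxy.
  by apply/set0Pn; exists x.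
Qed.

Lemma chromatic_coefs e A p : symmetric e -> irreflexive e ->
  chromatic e A p -> leading_coefs e A p.
Proof. by move=> es ei pP; have [q [/(chromatic_uniq pP)->]] := chromatic_exists A es ei. Qed.

Lemma chromatic_root0 e A p : symmetric e -> irreflexive e ->
  chromatic e A p -> A != set0 -> root p 0.
Proof. by move=> es ei pP; have [q [/(chromatic_uniq pP)->]] := chromatic_exists A es ei. Qed.

Lemma chromatic_monic e A p : symmetric e -> irreflexive e ->
  chromatic e A p -> p \is monic /\ size p = #|A|.+1.
Proof.
move=> es ei /(chromatic_coefs es ei)[s1 l1 _ _].
have sp : size p = #|A|.+1.
  apply/eqP; rewrite eqn_leq s1 ltnNge; apply/negP => /leq_sizeP/(_ _ (leqnn _)).
  by rewrite l1 => /eqP; rewrite oner_eq0.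
by split=> //; rewrite monicE /lead_coef sp l1.
Qed.

Lemma chromatic_root1 e A p u v : chromatic e A p -> u \in A -> v \in A -> e u v ->
  root p 1.
Proof.
move=> /(_ 0) pP uA vA uv; rewrite /root pP pnatr_eq0 cards_eq0.
apply/eqP/setP => f; rewrite [RHS]inE; apply/negbTE/negP => /colP[_ /(_ u v uA vA uv)].
by rewrite [f u]ord1 [f v]ord1.
Qed.

End Coefficients.
(** List the values of each map on [S] followed by the remaining elements, and
    send the first list to the second. *)
Lemma extend_injection (I C : finType) (S : {set I}) (s s' : I -> C) :
  {in S &, injective s} -> {in S &, injective s'} ->
  exists2 pi : C -> C, injective pi & {in S, forall u, pi (s u) = s' u}.
Proof.
move=> si si'; have [->|[u0 u0S]] := set_0Vmem S.
  by exists id => // u; rewrite inE.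
pose l (r : I -> C) := [seq r i | i <- enum S] ++ enum (~: [set r i | i in S]).
have lu (r : I -> C) : {in S &, injective r} -> uniq (l r).
  move=> ri; rewrite cat_uniq enum_uniq andbT map_inj_in_uniq; last first.
    by move=> x y; rewrite !mem_enum; apply: ri.
  rewrite enum_uniq; apply/hasPn => c; rewrite mem_enum in_setC; apply: contra.
  by case/mapP => i; rewrite mem_enum => iS ->; apply: imset_f.
have lm (r : I -> C) c : c \in l r.
  rewrite mem_cat mem_enum in_setC; case: imsetP => [[i iS ->]|]; last by rewrite orbT.
  by rewrite map_f // mem_enum.
have ls : size (l s) = size (l s').
  have /perm_size // : perm_eq (l s) (l s').
  by apply: uniq_perm; rewrite ?lu // => c; rewrite !lm.
exists (fun c => nth (s u0) (l s') (index c (l s))) => [c d E|u uS].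
  have : index c (l s) = index d (l s).
    by apply/eqP; rewrite -(nth_uniq (s u0) _ _ (lu _ si')) -?ls ?index_mem ?lm // E.
  by move/(congr1 (nth (s u0) (l s))); rewrite !nth_index.
have su : s u = nth (s u0) (l s) (index u (enum S)).
  rewrite nth_cat size_map index_mem mem_enum uS (nth_map u0) ?index_mem ?mem_enum //.
  by rewrite nth_index // mem_enum.
have iE : (index u (enum S) < size (enum S))%N by rewrite index_mem mem_enum.
rewrite su index_uniq ?lu //; last by rewrite size_cat size_map ltn_addr.
by rewrite nth_cat size_map iE (nth_map u0) // nth_index ?mem_enum.
Qed.

Section CliqueSums.
Variables (V : finType) (e : rel V).
Implicit Types (A B S : {set V}) (p q : {poly int}).

Variable k : nat.
Local Notation coloring := {ffun V -> 'I_k.+1}.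
Implicit Types (f g s : coloring).

Definition restrict S f : coloring := [ffun u => if u \in S then f u else ord0].
Definition extensions A S s := [set f in col k e A | restrict S f == s].

Lemma in_extensions A S s f :
  (f \in extensions A S s) = (f \in col k e A) && (restrict S f == s).
Proof. by rewrite [LHS]inE. Qed.

Lemma restrict_col S A f : S \subset A -> f \in col k e A -> restrict S f \in col k e S.
Proof.
move=> /subsetP SA /colP[f0 f1]; apply/colP; split=> [u /negbTE uS|u v uS vS uv].
  by rewrite ffunE uS.
by rewrite !ffunE uS vS; apply: f1 => //; apply: SA.
Qed.

Lemma card_col_extensions S A : S \subset A ->
  #|col k e A| = (\sum_(s in col k e S) #|extensions A S s|)%N.
Proof.
move=> SA; rewrite -sum1_card (partition_big (restrict S) (mem (col k e S))) /=.
  by apply: eq_bigr => s _; rewrite -sum1_card; apply: eq_bigl => f; rewrite !inE.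
by move=> f; apply: restrict_col.
Qed.

Lemma clique_col_inj S f : clique e S -> f \in col k e S -> {in S &, injective f}.
Proof.
move=> /cliqueP cS /colP[_ f1] u v uS vS fuv; apply/eqP; apply/negPn/negP => uv.
by have := f1 u v uS vS (cS u v uS vS uv); rewrite fuv eqxx.
Qed.

(** Two colourings of a clique differ by a permutation of the colours. *)
Lemma card_extensions S A s s' : clique e S -> S \subset A ->
  s \in col k e S -> s' \in col k e S -> #|extensions A S s| = #|extensions A S s'|.
Proof.
move=> cS SA; wlog suff le : s s' / s \in col k e S -> s' \in col k e S ->
    (#|extensions A S s| <= #|extensions A S s'|)%N.
  by move=> sS s'S; apply/eqP; rewrite eqn_leq !le.
move=> sS s'S.
have [pi pii piE] := extend_injection (clique_col_inj cS sS) (clique_col_inj cS s'S).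
pose h f : coloring := [ffun u => if u \in A then pi (f u) else ord0].
have inj : {in extensions A S s &, injective h}.
  move=> f g; rewrite !in_extensions => /andP[/colP[f0 _] _] /andP[/colP[g0 _] _] /ffunP E.
  apply/ffunP => u; have [uA|uA] := boolP (u \in A); last by rewrite f0 ?g0.
  by have := E u; rewrite !ffunE uA => /pii.
rewrite -(card_in_imset inj); apply/subset_leq_card/subsetP => _ /imsetP[f fE ->].
move: fE; rewrite in_extensions => /andP[/colP[f0 f1] /eqP fs].
rewrite in_extensions; apply/andP; split.
  apply/colP; split=> [u /negbTE uA|u v uA vA uv]; rewrite !ffunE ?uA // vA.
  by rewrite (inj_eq pii); apply: f1.
apply/eqP/ffunP => u; rewrite ffunE; have [uS|uS] := boolP (u \in S); last first.
  by have /colP[-> //] := s'S.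
by rewrite ffunE (subsetP SA) // -piE // -fs ffunE uS.
Qed.

Section TwoSides.
Variables (A A1 A2 S : {set V}).
Hypotheses (e_sym : symmetric e) (A12 : A1 :|: A2 = A) (SE : A1 :&: A2 = S).
Hypothesis separated : forall u v, u \in A1 :\: S -> v \in A2 :\: S -> ~~ e u v.

Lemma card_extensions_glue s : s \in col k e S ->
  #|extensions A S s| = (#|extensions A1 S s| * #|extensions A2 S s|)%N.
Proof.
move=> sS; rewrite -cardsX.
have inS u : (u \in S) = (u \in A1) && (u \in A2) by rewrite -SE inE.
have inA u : (u \in A) = (u \in A1) || (u \in A2) by rewrite -A12 inE.
pose h (f12 : coloring * coloring) : coloring := [ffun u => if u \in A1 then f12.1 u else f12.2 u].
have ext_on B f u : f \in extensions B S s -> u \in S -> f u = s u.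
  by rewrite in_extensions => /andP[_ /eqP <-] uS; rewrite ffunE uS.
have ext0 B f u : f \in extensions B S s -> u \notin B -> f u = ord0.
  by rewrite in_extensions => /andP[/colP[f0 _] _]; apply: f0.
have ext1 B f u v : f \in extensions B S s -> u \in B -> v \in B -> e u v -> f u != f v.
  by rewrite in_extensions => /andP[/colP[_ f1] _]; apply: f1.
have inj : {in setX (extensions A1 S s) (extensions A2 S s) &, injective h}.
  move=> [f1 f2] [g1 g2]; rewrite !in_setX /= => /andP[f1E f2E] /andP[g1E g2E] /ffunP E.
  congr (_, _); apply/ffunP => u; have := E u; rewrite !ffunE /=.
    by case: ifP => // /negbT u1 _; rewrite (ext0 _ _ _ f1E) ?(ext0 _ _ _ g1E).
  case: ifP => // u1 _; have [u2|u2] := boolP (u \in A2).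
    by rewrite (ext_on _ _ _ f2E) ?(ext_on _ _ _ g2E) // inS u1.
  by rewrite (ext0 _ _ _ f2E) ?(ext0 _ _ _ g2E).
rewrite -(card_in_imset inj); apply: eq_card => f; apply/idP/imsetP => [fE|[[f1 f2]]].
  have part B : B \subset A -> S \subset B -> restrict B f \in extensions B S s.
    move=> BA SB; move: (fE); rewrite !in_extensions => /andP[fA /eqP fs].
    rewrite (restrict_col BA) //=; apply/eqP/ffunP => u; rewrite -fs !ffunE.
    by case: ifP => // /(subsetP SB) ->.
  exists (restrict A1 f, restrict A2 f).
    by rewrite in_setX !part // -?SE ?subsetIl ?subsetIr // -A12 ?subsetUl ?subsetUr.
  apply/ffunP => u; rewrite !ffunE /=; have [//|/negbTE u1] := boolP (u \in A1).
  by case: ifP => // u2; apply: ext0 fE _; rewrite inA u1 u2.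
rewrite in_setX /= => /andP[f1E f2E] ->.
have hE1 u : u \in A1 -> h (f1, f2) u = f1 u by rewrite ffunE => ->.
have hE2 u : u \in A2 -> h (f1, f2) u = f2 u.
  rewrite ffunE /=; case: ifP => // u1 u2.
  by rewrite (ext_on _ _ _ f1E) ?(ext_on _ _ _ f2E) // inS u1.
rewrite in_extensions; apply/andP; split.
  apply/colP; split=> [u|u v].
    by rewrite inA ffunE negb_or => /andP[/negbTE-> u2] /=; apply: ext0 f2E _.
  rewrite !inA => uA vA uv.
  have [u1|u1] := boolP (u \in A1); have [v1|v1] := boolP (v \in A1).
  - by rewrite !hE1 //; apply: ext1 f1E _ _ _.
  - move: vA; rewrite (negbTE v1) /= => v2.
    have [u2|u2] := boolP (u \in A2); first by rewrite !hE2 //; apply: ext1 f2E _ _ _.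
    by move: uv; rewrite (negbTE (separated _ _)) //
      in_setD inS ?u1 ?(negbTE u2) ?v2 ?andbF ?(negbTE v1).
  - move: uA; rewrite (negbTE u1) /= => u2.
    have [v2|v2] := boolP (v \in A2); first by rewrite !hE2 //; apply: ext1 f2E _ _ _.
    by move: uv; rewrite e_sym (negbTE (separated _ _)) //
      in_setD inS ?v1 ?(negbTE v2) ?u2 ?andbF ?(negbTE u1).
  - move: uA vA; rewrite (negbTE u1) (negbTE v1) /= => u2 v2.
    by rewrite !hE2 //; apply: ext1 f2E _ _ _.
apply/eqP/ffunP => u; rewrite ffunE; case: ifP => uS.
  by move: (uS); rewrite inS => /andP[u1 _]; rewrite hE1 // (ext_on _ _ _ f1E).
by have /colP[-> //] := sS; rewrite uS.
Qed.

(** The number of extensions of a colouring of [S] is multiplicative over the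
    two sides, and it is the same for all colourings of [S]. *)
Lemma card_col_clique_sum : clique e S ->
  (#|col k e A| * #|col k e S| = #|col k e A1| * #|col k e A2|)%N.
Proof.
move=> cS.
have [S1 S2] : S \subset A1 /\ S \subset A2 by rewrite -SE subsetIl subsetIr.
have SA : S \subset A by rewrite -A12 subsetU // S1.
rewrite (card_col_extensions SA) (card_col_extensions S1) (card_col_extensions S2).
have [->|[s0 s0S]] := set_0Vmem (col k e S); first by rewrite !big_set0 mul0n.
have const B : S \subset B ->
    (\sum_(s in col k e S) #|extensions B S s| = #|col k e S| * #|extensions B S s0|)%N.
  move=> SB; rewrite -sum_nat_const; apply: eq_bigr => s sS.
  exact: card_extensions.
by rewrite !const // card_extensions_glue //; lia.
Qed.
End TwoSides.

(** The colour of the apex has to avoid the distinct colours of the base. *)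
Lemma card_extensions_cone v B s : v \notin B -> clique e (v |: B) -> symmetric e ->
  irreflexive e ->
  s \in col k e B -> (#|extensions (v |: B) B s| + #|B| = k.+1)%N.
Proof.
move=> vB cvB es ei sB; have cB : clique e B by apply: cliqueS cvB; apply: subsetUr.
have adj u : u \in B -> e v u.
  move=> uB; apply: (cliqueP _ _ cvB); rewrite ?inE ?eqxx ?uB ?orbT //.
  by apply: contraNneq vB => ->.
rewrite -(card_in_imset (clique_col_inj cB sB)) -[RHS]card_ord -[RHS](cardC [set s u | u in B]).
rewrite addnC; congr (_ + _)%N.
pose h c : coloring := [ffun u => if u == v then c else s u].
have inj : injective h by move=> c d /ffunP/(_ v); rewrite !ffunE eqxx.
rewrite -(card_image inj); apply: eq_card => f; rewrite in_extensions.
have /colP[s0 s1] := sB.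
apply/andP/imageP => [[/colP[f0 f1] /eqP fs]|[c cB' ->]].
  exists (f v); last first.
    apply/ffunP => u; rewrite ffunE; case: eqP => [->//|/eqP uv]; rewrite -fs ffunE.
    by case: ifP => // uB; rewrite f0 // in_setU1 (negbTE uv) uB.
  rewrite inE; apply/negP => /imsetP[u uB]; rewrite -fs ffunE uB => E.
  by have := f1 v u; rewrite E eqxx !inE eqxx uB orbT => /(_ isT isT (adj u uB)).
have hB u : u \in B -> h c u = s u.
  by move=> uB; rewrite ffunE; case: eqP => // E; rewrite -E uB in vB.
have hv : h c v = c by rewrite ffunE eqxx.
have cs u : u \in B -> c != s u.
  by move=> uB; apply: contraNneq cB' => ->; apply: imset_f.
split; last first.
  by apply/eqP/ffunP => u; rewrite ffunE; case: ifP => [/hB//|/negbT/s0].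
apply/colP; split=> [u|u w].
  by rewrite in_setU1 negb_or ffunE => /andP[/negbTE-> /s0].
rewrite !in_setU1 => /orP[/eqP->|uB] /orP[/eqP->|wB]; rewrite ?ei // ?hv ?hB //.
- by move=> _; apply: cs.
- by move=> _; rewrite eq_sym; apply: cs.
- exact: s1.
Qed.
End CliqueSums.

Section CliqueSumPolynomials.
Variables (V : finType) (e : rel V).
Hypotheses (e_sym : symmetric e) (e_irr : irreflexive e).
Implicit Types (A B S : {set V}) (p q : {poly int}).

Lemma chromatic_clique_sum A A1 A2 S p p1 p2 pS :
  A1 :|: A2 = A -> A1 :&: A2 = S -> clique e S ->
  (forall u v, u \in A1 :\: S -> v \in A2 :\: S -> ~~ e u v) ->
  chromatic e A p -> chromatic e A1 p1 -> chromatic e A2 p2 -> chromatic e S pS ->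
  p * pS = p1 * p2.
Proof.
move=> A12 SE cS sep pP p1P p2P pSP; apply: poly_nat_ext => k.
by rewrite !hornerM pP p1P p2P pSP -!natrM (card_col_clique_sum k e_sym A12 SE).
Qed.

Lemma chromatic_cone v B p : v \notin B -> clique e (v |: B) ->
  chromatic e B p -> chromatic e (v |: B) (p * ('X - #|B|%:R%:P)).
Proof.
move=> vB cvB pP k; rewrite hornerM hornerXsubC pP.
rewrite (card_col_extensions e k (subsetUr [set v] B)) natr_sum.
rewrite (eq_bigr (fun=> k.+1%:R - #|B|%:R : int)); first by rewrite sumr_const mulr_natl.
move=> s sB; apply/eqP; rewrite eq_sym subr_eq -natrD.
by rewrite (card_extensions_cone vB cvB).
Qed.

Lemma chromatic_clique S p : clique e S -> chromatic e S p ->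
  p = \prod_(i < #|S|) ('X - i%:R%:P).
Proof.
move=> cS pP; apply: (chromatic_uniq pP); move: cS {p pP}.
move: {-1}#|S| (erefl #|S|) => n; elim: n S => [|n IH] S nS cS.
  move/eqP: nS; rewrite cards_eq0 => /eqP-> k; rewrite big_ord0 hornerC.
  rewrite (card_col_edgeless k _ e_sym e_irr) ?cards0 ?expn0 //.
  by apply/setP => B; rewrite in_cliques inE subset0;
    apply/negbTE/negP => /and3P[/eqP->]; rewrite cards0.
have /card_gt0P[v vS] : (0 < #|S|)%N by rewrite nS.
have cv : #|S :\ v| = n by move: nS; rewrite (cardsD1 v) vS => -[].
rewrite -(setD1K vS) big_ord_recr /= -cv; apply: chromatic_cone.
- by rewrite !inE eqxx.
- by rewrite setD1K.
- by rewrite cv; apply: IH => //; apply: cliqueS cS; apply: subD1set.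
Qed.
End CliqueSumPolynomials.

(** * Connectivity and the multiplicity of the root one *)

Section Separation.
Variables (V : finType).
Implicit Types (e : rel V) (A B C S : {set V}) (a b u v w x y z : V).

Definition component e B a := [set w | connect (within e B) a w].

Lemma component_sub e B a : a \in B -> component e B a \subset B.
Proof.
move=> aB; apply/subsetP => w; rewrite inE => aw; have [<-//|aw'] := eqVneq a w.
by have /andP[] := connect_within_mem aw aw'.
Qed.

Lemma component_step e B a c d : a \in B -> c \in component e B a -> d \in B -> e c d ->
  d \in component e B a.
Proof.
move=> aB cC dB cd; have cB := subsetP (component_sub e aB) _ cC.
move: cC; rewrite !inE => ac; apply: connect_trans ac (connect1 _).
by rewrite /within cB dB.
Qed.

Lemma component_conn e B a b : a \in B -> b \in component e B a ->
  connect (within e (component e B a)) a b.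
Proof.
move=> aB; rewrite inE => /connectP[p pp ->]; apply/connectP; exists p => //.
have sub : {subset a :: p <= component e B a}.
  by move=> w wp; rewrite inE; apply: path_connect pp _ wp.
move: (component e B a) sub => C; elim: p a {aB} pp => [|y p IH] x //= /andP[/and3P[_ _ xy] pp] sub.
rewrite /within sub ?mem_head // sub ?inE ?eqxx ?orbT // xy /=.
by apply: IH => // w wp; apply: sub; rewrite inE wp orbT.
Qed.

(** One side is a component of [A :\: S] together with [S], the other is the
    complement of that component. *)
Lemma not_conn_split e A S : symmetric e -> S \subset A -> ~~ conn e (A :\: S) ->
  exists A1 A2, [/\ A1 :|: A2 = A, A1 :&: A2 = S, A1 :\: S != set0, A2 :\: S != set0
    & forall u v, u \in A1 :\: S -> v \in A2 :\: S -> ~~ e u v].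
Proof.
move=> es /subsetP SA; have [conn|no] :=
  boolP [forall a in A :\: S, A :\: S \subset component e (A :\: S) a].
  case/negP; apply/connP => u v uA vA; have /subsetP/(_ v vA) := forall_inP conn u uA.
  by rewrite inE.
move: no => /forall_inPn[a aB /subsetPn[b bB bC]] _.
pose C := component e (A :\: S) a; have CB : C \subset A :\: S := component_sub e aB.
have CA u : u \in C -> (u \in A) && (u \notin S) by move/(subsetP CB); rewrite inE andbC.
exists (C :|: S), (A :\: C); split.
- apply/setP => u; rewrite !in_setU in_setD; case uC : (u \in C) => /=; first by case/andP: (CA u uC).
  by case uS : (u \in S) => //=; rewrite (SA u uS).
- apply/setP => u; rewrite in_setI in_setU in_setD; case uC : (u \in C) => /=.
    by case/andP: (CA u uC) => _ /negbTE->.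
  by case uS : (u \in S) => //=; rewrite (SA u uS).
- apply/set0Pn; exists a; rewrite in_setD in_setU; have -> : a \in C by rewrite inE connect0.
  by rewrite andbT; case/setDP: aB.
- by apply/set0Pn; exists b; rewrite !in_setD; case/setDP: bB => -> ->; rewrite bC.
move=> u v; rewrite !in_setD in_setU => /andP[uS]; rewrite (negbTE uS) orbF => uC.
case/and3P=> vS vC vA; apply/negP => uv; case/negP: vC.
by apply: (component_step aB uC) uv; rewrite in_setD vS.
Qed.

Definition conn2 e A := conn e A && [forall v in A, conn e (A :\ v)].

Variable e : rel V.
Hypotheses (e_sym : symmetric e) (e_irr : irreflexive e).
Let ne u v : e u v -> u != v := adj_neq e_irr.

Lemma conn_con A x y : x \in A -> y \in A -> e x y -> conn e A -> conn (con e x y) (A :\ y).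
Proof.
move=> xA yA xy /connP cA; pose h u := if u == y then x else u.
have hA u : u \in A -> h u \in A :\ y.
  by move=> uA; rewrite /h; case: (eqVneq u y) => [_|uy]; rewrite in_setD1 ?(ne xy) ?uy.
have step u v : connect (within e A) u v -> connect (within (con e x y) (A :\ y)) (h u) (h v).
  move/connectP=> [p]; elim: p u => [|w p IH] u /=; first by move=> _ ->.
  case/andP=> /and3P[uA wA uw] pp vp; apply: connect_trans (IH w pp vp).
  have [->|huw] := eqVneq (h u) (h w); first exact: connect0.
  apply: connect1; rewrite /within !hA //= /con huw /=; move: huw; rewrite /h.
  case: (eqVneq u y) uw => [->|uy]; case: (eqVneq w y) => [->|wy] uw //; rewrite ?eqxx ?uw ?orbT //.
apply/connP => u v /setD1P[uy uA] /setD1P[vy vA].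
by have := step _ _ (cA _ _ uA vA); rewrite /h (negbTE uy) (negbTE vy).
Qed.

Lemma del_within A x y : x \notin A \/ y \notin A -> {in A &, del e x y =2 e}.
Proof.
move=> xy u v uA vA; rewrite del_E; case: (e u v) => //=; apply/negP.
case: xy => /negP xy; case/orP => /andP[/eqP E1 /eqP E2]; subst; exact: xy.
Qed.

Lemma withinS_del A B x y u v : (x \notin A) || (y \notin A) -> A \subset B ->
  connect (within e A) u v -> connect (within (del e x y) B) u v.
Proof.
move=> /orP xyA AB; apply: withinS => // a b aA bA ab.
by rewrite (del_within xyA).
Qed.

Lemma conn2_del A x y : (2 < #|A|)%N -> x \in A -> y \in A -> e x y -> conn2 e A ->
  conn (del e x y) A.
Proof.
move=> A3 xA yA xy /andP[_ /forall_inP c2].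
have cs := connect_within_sym A (del_sym e_sym x y).
have nxy := ne xy.
have to_x w : w \in A -> w != y -> connect (within (del e x y) A) w x.
  move=> wA wy; apply: (@withinS_del (A :\ y)); rewrite ?subD1set ?in_setD1 ?eqxx ?orbT //.
  by have /connP := c2 y yA; apply; rewrite in_setD1 ?wy ?nxy.
have y_x : connect (within (del e x y) A) y x.
  have /card_gt0P[z] : (0 < #|A :\ x :\ y|)%N.
    by move: A3; rewrite (cardsD1 x) xA (cardsD1 y (A :\ x)) in_setD1 eq_sym nxy yA.
  rewrite !in_setD1 => /and3P[zy zx zA]; apply: connect_trans (to_x z zA zy).
  apply: (@withinS_del (A :\ x)); rewrite ?subD1set ?in_setD1 ?eqxx //.
  by have /connP := c2 x xA; apply; rewrite in_setD1 ?zx // eq_sym nxy.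
have all_x w : w \in A -> connect (within (del e x y) A) w x.
  by move=> wA; have [->//|wy] := eqVneq w y; apply: to_x.
by apply/connP => u v uA vA; apply: connect_trans (all_x u uA) _; rewrite cs all_x.
Qed.

(** If the contraction is not 2-connected, a cut vertex of it must be the merged
    vertex, so {x, y} separates [A]. Each component of the rest is adjacent to
    both x and y and thus contains a detour for the edge xy. A vertex z is in at
    most one component, so after deletion of xy and z the other one still joins
    x and y. *)
Lemma conn2_del_or_con A x y : (2 < #|A|)%N -> x \in A -> y \in A -> e x y -> conn2 e A ->
  conn2 (del e x y) A || conn2 (con e x y) (A :\ y).
Proof.
move=> A3 xA yA xy c2; have nxy := ne xy.
have cd := conn2_del A3 xA yA xy c2; case/andP: c2 => cA /forall_inP c2.
have cc := conn_con xA yA xy cA; rewrite /conn2 cd cc /=.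
have [//|/forall_inPn[v /setD1P[vy vA] nv]] :=
  boolP [forall v in A :\ y, conn (con e x y) (A :\ y :\ v)].
  by rewrite orbT.
rewrite orbF; have vx : v = x.
  apply/eqP/negPn/negP => vx; case/negP: nv.
  have -> : A :\ y :\ v = A :\ v :\ y by rewrite !setDDl setUC.
  by apply: conn_con => //; rewrite ?in_setD1 ?xA ?yA ?andbT 1?eq_sym // c2.
subst v; have {}nv : ~~ conn e (A :\ y :\ x).
  apply: contra nv => H; rewrite (eq_conn (e' := e)) // => u v.
  rewrite !in_setD1 => /and3P[ux uy _] /and3P[v_x v_y _].
  rewrite /con (negbTE ux) (negbTE v_x) /= orbF; apply: andb_idl; exact: ne.
apply/forall_inP => z zA.
have [zx|zx] := eqVneq z x.
  by rewrite (eq_conn (e' := e)) ?c2 //; apply: del_within; left; rewrite zx in_setD1 eqxx.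
have [zy|zy] := eqVneq z y.
  by rewrite (eq_conn (e' := e)) ?c2 //; apply: del_within; right; rewrite zy in_setD1 eqxx.
pose B := A :\ y :\ x; pose D := within (del e x y) (A :\ z).
suff xyD : connect D x y.
  have Ds := connect_within_sym (A :\ z) (del_sym e_sym x y).
  have /connP cz := c2 z zA; apply/connP => u w uA wA.
  apply: connect_sub (cz u w uA wA) => a b /and3P[aA bA ab].
  case dab : (del e x y a b); first by apply: connect1; rewrite /within aA bA.
  move: dab; rewrite del_E ab => /negbFE/orP[]/andP[/eqP-> /eqP->] //.
  by rewrite -/D Ds.
have comp_xy a : a \in B -> z \notin component e B a -> connect D x y.
  move=> aB zC; set C := component e B a in zC.
  have CB : C \subset B := component_sub e aB.
  have CA : C \subset A :\ z.
    apply/subsetP => w wC; rewrite in_setD1; have := subsetP CB _ wC.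
    rewrite !in_setD1 => /and3P[_ _ ->]; rewrite andbT.
    by apply: contraNneq zC => <-.
  have aC : a \in C by rewrite inE connect0.
  have exit t t' : [set t; t'] = [set x; y] -> t != t' -> exists2 c, c \in C & e c t.
    move=> E tt'.
    have BE : B = A :\ t :\ t'.
      by rewrite /B !setDDl [X in _ :\: X]setUC -E.
    have tA : t \in A by have : t \in [set x; y]; [rewrite -E !inE eqxx | case/set2P=> ->].
    have t'A : t' \in A by have : t' \in [set x; y]; [rewrite -E !inE eqxx orbT | case/set2P=> ->].
    have /connP cA' := c2 t' t'A.
    have aA' : a \in A :\ t'.
      by move: aB; rewrite BE !in_setD1 => /and3P[-> _ ->].
    have tA' : t \in A :\ t' by rewrite in_setD1 tt'.
    have tC : t \notin C.
      by apply/negP => /(subsetP CB); rewrite BE !in_setD1 eqxx andbF.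
    have [c [d [cC dC _ dA ecd]]] := connect_exit (cA' a t aA' tA') aC tC.
    exists c => //; suff <- : d = t by [].
    apply/eqP/negPn/negP => dt; case/negP: dC.
    apply: component_step aB cC _ ecd; rewrite BE.
    by move: dA; rewrite !in_setD1 dt => /andP[-> ->].
  have [c cC cx] := exit x y erefl nxy.
  have [c' c'C c'y] : exists2 c, c \in C & e c y by apply: (exit y x); rewrite 1?setUC // eq_sym.
  have inD w : w \in C -> connect D a w.
    move=> wC; apply: (@withinS_del C) => //.
      by apply/orP; left; apply/negP => /(subsetP CB); rewrite !in_setD1 eqxx.
    exact: component_conn.
  have Ds := connect_within_sym (A :\ z) (del_sym e_sym x y).
  have nC w : w \in C -> (w != x) && (w != y) && (w \in A :\ z).
    by move=> wC; rewrite (subsetP CA _ wC);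
      move: (subsetP CB _ wC); rewrite !in_setD1 => /and3P[-> -> _].
  apply: connect_trans (_ : connect D x a) _.
    rewrite -/D Ds; apply: connect_trans (inD c cC) (connect1 _).
    have /andP[/andP[c_x c_y] cA'] := nC c cC.
    by rewrite /D /within cA' in_setD1 eq_sym zx xA /= del_E cx (negbTE c_x) (negbTE c_y).
  apply: connect_trans (inD c' c'C) (connect1 _).
  have /andP[/andP[c_x c_y] cA'] := nC c' c'C.
  by rewrite /D /within cA' in_setD1 eq_sym zy yA /= del_E c'y (negbTE c_x) (negbTE c_y).
have [//|nD] := boolP (connect D x y).
case/negP: nv; apply/connP => a b aB bB.
have zin w : w \in B -> connect (within e B) w z.
  move=> wB; apply/negPn/negP => wz; case/negP: nD; apply: (comp_xy w wB).
  by rewrite inE.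
apply: connect_trans (zin a aB) _.
by rewrite (connect_within_sym _ e_sym) zin.
Qed.
End Separation.

Section ChromaticInvariant.
Variable V : finType.
Implicit Types (e : rel V) (A : {set V}) (p : {poly int}).

(** The number (-1)^n P'(1) is Crapo's beta invariant. It is additive under
    deletion and contraction, and it vanishes if there is a cut vertex, as then
    P has the two factors P(A1) and P(A2) with root 1. One of deletion and
    contraction keeps the graph 2-connected, whence positivity. *)
Lemma chromatic_beta e A p : symmetric e -> irreflexive e -> chromatic e A p ->
  (1 < #|A|)%N -> conn e A ->
  0 <= (-1) ^+ #|A| * p^`().[1] /\ (conn2 e A -> 0 < (-1) ^+ #|A| * p^`().[1]).
Proof.
have [m] := ubnP #|cliques e 2 A|; elim: m e A p => // m IH e A p.
rewrite ltnS => mE es ei pP A2 cA.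
have [x [y [xA yA xy]]] : exists x y, [/\ x \in A, y \in A & e x y].
  have /card_gt1P[u [v [uA vA uv]]] := A2.
  have := connP _ _ cA u v uA vA => /connectP[[|w q] /=]; first by move=> _ vu; rewrite vu eqxx in uv.
  by case/andP=> /and3P[_ wA uw] _ _; exists u, w.
have nxy : x != y by apply: contraTneq xy => ->; rewrite ei.
have [A3|A3] := ltnP 2 #|A|; last first.
  have AE : [set x; y] = A.
    by apply/eqP; rewrite eqEcard subUset !sub1set xA yA cards2 nxy.
  have kA : clique e A.
    have : [set x; y] \in cliques e 2 A by rewrite edge_cliques // xA yA.
    by rewrite in_cliques AE => /and3P[].
  have cardA : #|A| = 2%N by rewrite -AE cards2 nxy.
  rewrite (chromatic_clique es ei kA pP) cardA big_ord_recr big_ord1 /= subr0.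
  rewrite derivM !derivXsubC derivX !hornerE.
  by [].
have [c2|nc2] := boolP (conn2 e A); last first.
  (* At a cut vertex both sides contain an edge, so P has a double root at 1. *)
  suff -> : p^`().[1] = 0 by rewrite mulr0.
  move: nc2; rewrite /conn2 cA /= => /forall_inPn[v vA nv].
  have vA' : [set v] \subset A by rewrite sub1set.
  have [A1 [A2' [AE SE /set0Pn[a aA1] /set0Pn[b bA2] sep]]] := not_conn_split es vA' nv.
  have [p1 [p1P _ _]] := chromatic_exists A1 es ei.
  have [p2 [p2P _ _]] := chromatic_exists A2' es ei.
  have [pS [pSP _ _]] := chromatic_exists [set v] es ei.
  have := chromatic_clique_sum es AE SE (clique1 e v) sep pP p1P p2P pSP.
  rewrite (chromatic_clique es ei (clique1 e v) pSP) cards1 big_ord1 subr0 => PE.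
  have edge B B' a' b' : B :|: B' = A -> B :&: B' = [set v] -> a' \in B :\ v -> b' \in B' :\ v ->
      (forall u w, u \in B :\ v -> w \in B' :\ v -> ~~ e u w) ->
      exists c d, [/\ c \in B, d \in B & e c d].
    move=> BA BB aB bB s.
    have bB' : b' \notin B :\ v.
      apply/negP => /setD1P[bv bB1]; have : b' \in B :&: B' by rewrite inE bB1; case/setD1P: bB.
      by rewrite BB inE (negbTE bv).
    have aA : a' \in A by rewrite -BA inE; case/setD1P: aB => _ ->.
    have bA : b' \in A by rewrite -BA inE; case/setD1P: bB => _ ->; rewrite orbT.
    have [c [d [cC dC _ dA cd]]] := connect_exit (connP _ _ cA _ _ aA bA) aB bB'.
    exists c, d; split=> //; first by case/setD1P: cC.
    apply/negPn/negP => dB; have dB' : d \in B' :\ v.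
      rewrite in_setD1; move: dA; rewrite -BA inE (negbTE dB) /= => ->; rewrite andbT.
      apply: contraNneq dB => ->; have : v \in B :&: B' by rewrite BB inE.
      by rewrite inE => /andP[].
    by have := s c d cC dB'; rewrite cd.
  have [c1 [d1 [c1A d1A e1]]] := edge _ _ a b AE SE aA1 bA2 sep.
  have [|||c2' [d2 [c2A d2A e2]]] := edge A2' A1 b a _ _ bA2 aA1.
  - by rewrite setUC.
  - by rewrite setIC.
  - by move=> u w uA wA; rewrite es sep.
  have r1 := rootP (chromatic_root1 p1P c1A d1A e1).
  have r2 := rootP (chromatic_root1 p2P c2A d2A e2).
  have r := rootP (chromatic_root1 pP xA yA xy).
  have := congr1 (fun q => q^`().[1]) PE.
  by rewrite !derivM derivX !hornerE r r1 r2 !hornerE.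
have [pd [pdP _ _]] := chromatic_exists A (del_sym es x y) (del_irr ei x y).
have [pc [pcP _ _]] := chromatic_exists (A :\ y) (con_sym es x y) (con_irr e x y).
have pE := chromatic_uniq pP (chromatic_del_con es ei xA yA xy pdP pcP).
have cAy : #|A| = #|A :\ y|.+1 by rewrite (cardsD1 y A) yA.
have m1 := card_edges_del es ei xA yA xy.
have m2 := card_edges_con es ei xA yA xy.
have [||d0 d1] := IH _ A pd _ (del_sym es x y) (del_irr ei x y) pdP A2; first by lia.
  exact: conn2_del.
have [|||c0 c1] := IH _ (A :\ y) pc _ (con_sym es x y) (con_irr e x y) pcP; first by lia.
- by lia.
- by apply: conn_con.
have bE : (-1) ^+ #|A| * p^`().[1] = (-1) ^+ #|A| * pd^`().[1] + (-1) ^+ #|A :\ y| * pc^`().[1].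
  by rewrite pE derivB hornerD hornerN cAy exprS; ring.
suff pos : 0 < (-1) ^+ #|A| * p^`().[1] by split=> //; apply: ltW.
rewrite bE; have /orP[/d1|/c1] := conn2_del_or_con es ei A3 xA yA xy c2; lia.
Qed.
End ChromaticInvariant.

(** * Inequalities from real roots *)

Section Roots.
Variable C : numClosedFieldType.

Lemma coef_pred_prod_XsubC (s : seq C) n : size s = n.+1 ->
  (\prod_(z <- s) ('X - z%:P))`_n = - \sum_(z <- s) z.
Proof. by move=> sn; rewrite -[n]/(n.+1.-1) -sn coefPn_prod_XsubC // sn. Qed.

Lemma coef_pred2_prod_XsubC (s : seq C) n : size s = n.+2 ->
  (\prod_(z <- s) ('X - z%:P))`_n *+ 2 = (\sum_(z <- s) z) ^+ 2 - \sum_(z <- s) z ^+ 2.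
Proof.
elim: s n => // a s IH n [sn]; rewrite !big_cons mulrBl coefB coefXM coefCM.
rewrite (coef_pred_prod_XsubC sn) mulrN opprK mulrnDl.
case: n sn => [|n] sn /=; last by rewrite (IH n sn); ring.
case: s sn {IH} => [|b [|]] //= _; rewrite !big_seq1; ring.
Qed.

Lemma bin2_double m : ('C(m, 2) * 2 + m = m * m)%N.
Proof. by elim: m => // m; rewrite binS bin1; lia. Qed.

(** Newton's identities for the first two power sums. *)
Lemma root_power_sums (s : seq C) n m t (P : {poly C}) :
  P = \prod_(z <- s) ('X - z%:P) -> size s = n.+2 ->
  P`_n.+1 = - m%:R -> P`_n = 'C(m, 2)%:R - t%:R ->
  \sum_(z <- s) z = m%:R /\ \sum_(z <- s) z ^+ 2 = (m + 2 * t)%:R.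
Proof.
move=> -> sn; rewrite (coef_pred_prod_XsubC sn) => /oppr_inj s1 c2.
have := coef_pred2_prod_XsubC sn; rewrite c2 s1 => h; split=> //.
have -> : \sum_(z <- s) z ^+ 2 = m%:R ^+ 2 - ('C(m, 2)%:R - t%:R) *+ 2 by rewrite h; ring.
have B : 'C(m, 2)%:R *+ 2 + m%:R = m%:R * m%:R :> C.
  by rewrite -natrM -(bin2_double m) natrD natrM mulr_natr.
rewrite expr2 -B natrD natrM; move: ('C(m, 2)%:R : C) (m%:R : C) (t%:R : C) => x y z; ring.
Qed.

Lemma real_sqr_sum_ge0 (s : seq C) (c : C) : c \is Num.real ->
  {in s, forall z, z \is Num.real} -> 0 <= \sum_(z <- s) (z - c) ^+ 2.
Proof.
move=> cr sr; rewrite big_seq; apply: sumr_ge0 => z zs.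
by apply: real_exprn_even_ge0 => //; apply: rpredB => //; apply: sr.
Qed.

(** The inequality between arithmetic and geometric means. *)
Lemma prod_sqr_ge1 (s : seq C) (c : C) : c \is Num.real -> (0 < size s)%N ->
  {in s, forall z, z \is Num.real} -> 1 <= \prod_(z <- s) (z - c) ^+ 2 ->
  (size s)%:R <= \sum_(z <- s) (z - c) ^+ 2.
Proof.
move=> cr s0 sr; rewrite !(big_tnth _ _ s).
pose F (i : 'I_(size s)) := (tnth (in_tuple s) i - c) ^+ 2.
have F0 i : i \in 'I_(size s) -> 0 <= F i.
  move=> _; apply: real_exprn_even_ge0 => //; apply: rpredB => //; apply: sr.
  exact: mem_tnth.
have [] := leif_AGM F0; rewrite card_ord => /(le_trans _) h _ /h.
have S0 : 0 <= \sum_(i in 'I_(size s)) F i by apply: sumr_ge0 => i; apply: F0.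
rewrite expr_ge1 ?divr_ge0 ?ler0n //.
by rewrite ler_pdivlMr ?ltr0n // mul1r.
Qed.
End Roots.

Section RealRootInequalities.
Variables (C : numClosedFieldType) (V : finType) (e : rel V) (A : {set V}) (p : {poly int}).
Hypotheses (e_sym : symmetric e) (e_irr : irreflexive e) (pP : chromatic e A p).
Hypotheses (A3 : (2 < #|A|)%N) (A_conn2 : conn2 e A).
Hypothesis p_real : forall z : C, root (map_poly intr p) z -> z \is Num.real.

(** The three inequalities come from the sums of (z - c)^2 over the roots z
    other than 0 and 1, for c = 1, 2 and 3. *)
Lemma real_root_inequalities :
  [/\ (#|cliques e 2 A| <= 2 * #|cliques e 3 A| + 1)%N,
      (3 * #|cliques e 2 A| + 5 <= 2 * #|cliques e 3 A| + 4 * #|A|)%N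
    & (5 * #|cliques e 2 A| + 13 <= 2 * #|cliques e 3 A| + 9 * #|A|)%N].
Proof.
have [pm ps] := chromatic_monic e_sym e_irr pP.
have [_ _ c1 c2] := chromatic_coefs e_sym e_irr pP.
have /set0Pn[v vA] : A != set0 by rewrite -card_gt0; lia.
have r0 : root p 0 by apply: (chromatic_root0 e_sym e_irr pP); apply/set0Pn; exists v.
case/andP: (A_conn2) => cA _.
have [_ /(_ A_conn2) beta] := chromatic_beta e_sym e_irr pP (ltnW A3) cA.
have r1 : root p 1.
  have /card_gt1P[x [y [xA yA xy]]] : (1 < #|A|)%N by lia.
  have := connP _ _ cA x y xA yA => /connectP[[|w q] /=]; first by move=> _ E; rewrite E eqxx in xy.
  by case/andP=> /and3P[_ wA xw] _ _; apply: chromatic_root1 pP xA wA xw.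
have [q0 q0E] := factor_theorem _ _ r0; rewrite polyC0 subr0 in q0E.
have /factor_theorem[q qE] : root q0 1.
  by have := rootP r1; rewrite q0E !hornerE => q01; apply/rootP.
have q1 : p^`().[1] = q.[1].
  by rewrite q0E qE !derivM derivX derivXsubC !hornerE.
have q1n0 : q.[1] != 0 by apply: contraTneq beta => q10; rewrite q1 q10 mulr0 ltxx.
have qm : q \is monic.
  by move: pm; rewrite q0E qE -mulrA monicMr // monicMl ?monicXsubC // monicX.
have sq : (size q).+2 = #|A|.+1.
  rewrite -ps q0E qE -mulrA mulrC size_monicM ?monic_neq0 //; last first.
    by rewrite monicMl ?monicXsubC // monicX.
  by rewrite size_monicM ?monicX ?monicXsubC ?monic_neq0 ?monicX // size_XsubC size_polyX /=.
pose Q : {poly C} := map_poly intr q.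
have Qm : Q \is monic by apply: monic_map.
have [s QE] := closed_field_poly_normal Q; rewrite (monicP Qm) scale1r in QE.
have ss : size s = (#|A| - 2)%N.
  have : size Q = size q by rewrite size_map_inj_poly //; apply: intr_inj.
  by rewrite QE size_prod_XsubC; lia.
have PE : map_poly intr p = \prod_(z <- 0 :: 1 :: s) ('X - z%:P) :> {poly C}.
  rewrite q0E qE !rmorphM /= -/Q QE map_polyX rmorphB /= map_polyX map_polyC /= !big_cons subr0.
  by rewrite rmorph1; ring.
have s_real : {in s, forall z, z \is Num.real}.
  by move=> z zs; apply: p_real; rewrite PE root_prod_XsubC !inE zs !orbT.
have [n An] : exists n, #|A| = n.+2 by exists (#|A| - 2)%N; lia.
have [|||sum1 sum2] := root_power_sums PE (n := n) (m := #|cliques e 2 A|) (t := #|cliques e 3 A|).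
- by rewrite /= ss An; lia.
- by rewrite coef_map /= (c1 _ An) rmorphN /= rmorph_nat.
- by rewrite coef_map /= (c2 _ An) rmorphB /= !rmorph_nat.
rewrite !big_cons add0r expr0n add0r expr1n in sum1 sum2.
set m := #|cliques e 2 A| in sum1 sum2 *; set t := #|cliques e 3 A| in sum2 *.
have sumc (c : int) : \sum_(z <- s) (z - c%:~R) ^+ 2 =
    (m%:Z + 2 * t%:Z - 1 - 2 * c * (m%:Z - 1) + c ^+ 2 * n%:Z)%:~R.
  have -> : \sum_(z <- s) (z - c%:~R) ^+ 2 =
     \sum_(z <- s) z ^+ 2 - 2 * c%:~R * \sum_(z <- s) z + c%:~R ^+ 2 * n%:R.
    have -> : n = size s by lia.
    elim: (s) => [|a r IH]; first by rewrite !big_nil /=; ring.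
    by rewrite !big_cons IH /= -[(size r).+1]addn1 natrD; ring.
  have -> : \sum_(z <- s) z = m%:R - 1 by rewrite -sum1; ring.
  have -> : \sum_(z <- s) z ^+ 2 = (m + 2 * t)%:R - 1 by rewrite -sum2; ring.
  rewrite natrD natrM !(rmorphD, rmorphB, rmorphM, rmorphXn) /= -!pmulrn; ring.
have real_int (c : int) : (c%:~R : C) \is Num.real by apply: realz.
have ge0 (c : int) := real_sqr_sum_ge0 (real_int c) s_real.
have := ge0 2; have := ge0 3; rewrite !sumc !ler0z => h3 h2.
have : (size s)%:R <= \sum_(z <- s) (z - 1%:~R) ^+ 2.
  apply: prod_sqr_ge1 => //; first by rewrite ss subn_gt0.
  have -> : \prod_(z <- s) (z - 1%:~R) ^+ 2 = (q.[1] ^+ 2)%:~R.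
    have -> : (q.[1] ^+ 2)%:~R = Q.[1] ^+ 2 :> C.
      by rewrite rmorphXn /= /Q -[1 in RHS](rmorph1 (intr : int -> C)) horner_map.
    rewrite QE horner_prod -prodrXl; apply: eq_bigr => z _.
    by rewrite hornerXsubC; ring.
  rewrite ler1z; move: q1n0; move: (q.[1]) => x; lia.
rewrite sumc pmulrn ler_int ss An => h1; move: h1 h2 h3.
have -> : 3 ^+ 2 = 9 :> int by [].
have -> : 2 ^+ 2 = 4 :> int by [].
by rewrite expr1n; clear; move: m t => m t h1 h2 h3; split; lia.
Qed.
End RealRootInequalities.

(** * Chordal graphs *)

Local Close Scope ring_scope.
Section InducedPaths.
Variables (V : finType) (r : rel V).
Implicit Types (x y z : V) (s p : seq V).

(** An induced path, as a recursive condition on its list of vertices. *)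
Fixpoint induced s := if s is x :: s' then
  (if s' is y :: q then [&& r x y, x \notin s' & all (fun z => ~~ r x z) q] else true)
  && induced s' else true.

Lemma induced_cat s1 s2 : induced (s1 ++ s2) -> induced s2.
Proof. by elim: s1 => // x s1 IH /= /andP[_]. Qed.

Lemma last_occurrence (a : pred V) s : has a s ->
  exists s1 z s2, [/\ s = s1 ++ z :: s2, a z & ~~ has a s2].
Proof.
elim: s => // x s IH /=; have [hs|hs] := boolP (has a s).
  by have [s1 [z [s2 [-> az ns]]]] := IH hs; exists (x :: s1), z, s2.
by rewrite orbF => ax; exists [::], x, s.
Qed.

(** Prepending x to an induced path q: if x is already on q, or else at the
    last neighbour of x on q, cut off what comes before. *)
Lemma induced_path x p : path r x p ->
  exists q, [/\ induced (x :: q), last x q = last x p & {subset q <= p}].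
Proof.
elim: p x => [|w p IH] x /=; first by exists [::].
case/andP=> xw /IH[q [iq lq sq]].
have sub z : z \in w :: q -> z \in w :: p.
  by rewrite !inE => /orP[->//|/sq ->]; rewrite orbT.
have [xq|xq] := boolP (x \in w :: q).
  have [s1 [s2 E]] : exists s1 s2, w :: q = s1 ++ x :: s2.
    by case/splitPr: xq => s1 s2; exists s1, s2.
  have ixs : induced (s1 ++ x :: s2) by rewrite -E.
  exists s2; split; first exact: induced_cat ixs.
    by have := congr1 (last w) E; rewrite last_cat /= -lq => ->.
  by move=> z zs; apply: sub; rewrite E mem_cat inE zs !orbT.
have [|s1 [z [s2 [E xz ns]]]] := @last_occurrence (r x) (w :: q); first by rewrite /= xw.
exists (z :: s2); split.
- have izs : induced (s1 ++ z :: s2) by rewrite -E.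
  change (induced (x :: z :: s2)) with
    ([&& r x z, x \notin z :: s2 & all (fun z => ~~ r x z) s2] && induced (z :: s2)).
  have {}ns : all (fun z => ~~ r x z) s2 by move: ns; rewrite -all_predC.
  rewrite (induced_cat izs) xz ns !andbT.
  by apply: contra xq; rewrite E mem_cat => ->; rewrite orbT.
- by have := congr1 (last w) E; rewrite last_cat /= lq => ->.
- by move=> y ys; apply: sub; rewrite E mem_cat ys orbT.
Qed.

Lemma induced_uniq s : induced s -> uniq s.
Proof. by elim: s => // x [|y q] IH //= /andP[/and3P[_ -> _] /IH]. Qed.

Lemma induced_nth x0 s i j : induced s -> i < j -> j < size s ->
  r (nth x0 s i) (nth x0 s j) = (j == i.+1).
Proof.
elim: s i j => // x s IH [|i] [|j] //=; case: s IH => [|y q] IH; rewrite ?ltn0 //.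
  case/andP=> /and3P[xy _ /allP nq] _ _; case: j => [|j] //=; rewrite !ltnS => jq.
  by apply/negbTE/nq/mem_nth.
by case/andP=> _ iq; rewrite !ltnS => ij js; rewrite (IH i j) // eqSS.
Qed.
End InducedPaths.

Lemma cyclic_far p q n : 0 < p -> p.+1 < q -> q <= n ->
  ((q == p.+1 %[mod n.+1]) || (p == q.+1 %[mod n.+1])) = false.
Proof.
move=> p0 pq qn; rewrite (modn_small (m := q)) ?(modn_small (m := p)) ?(modn_small (m := p.+1)); try lia.
have [->|qn'] := eqVneq q n; first by rewrite modnn; lia.
rewrite modn_small; lia.
Qed.

Lemma cyclic_succ i j n : i < j -> j < n ->
  ((j == i.+1 %% n) || (i == j.+1 %% n)) = (j == i.+1) || ((i == 0) && (j.+1 == n)).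
Proof.
move=> ij jn; rewrite (modn_small (m := i.+1)); last by lia.
have [<-|jn'] := eqVneq j.+1 n; first by rewrite modnn andbT.
by rewrite modn_small; lia.
Qed.

(** A vertex adjacent exactly to the two ends of an induced path closes it to an
    induced cycle. *)
Lemma induced_path_hole (V : finType) (e : rel V) (a : V) (q : seq V) :
  symmetric e -> irreflexive e -> 1 < size q -> uniq (a :: q) ->
  (forall i j, i < j -> j < size q -> e (nth a q i) (nth a q j) = (j == i.+1)) ->
  (forall i, i < size q -> e a (nth a q i) = (i == 0) || (i.+1 == size q)) ->
  injective (fun i : 'I_(size q).+1 => nth a (a :: q) i) /\
  forall i j : 'I_(size q).+1,
    e (nth a (a :: q) i) (nth a (a :: q) j) = (j == ordS i) || (i == ordS j).
Proof.
move=> es ei q1 uq eq ea; split.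
  by move=> i j /eqP; rewrite nth_uniq // => /eqP/val_inj.
have key (i j : 'I_(size q).+1) : i < j ->
    e (nth a (a :: q) i) (nth a (a :: q) j) = (j == ordS i) || (i == ordS j).
  move=> ij; rewrite -!val_eqE [val (ordS i)]/= [val (ordS j)]/=.
  rewrite (cyclic_succ ij (ltn_ord j)).
  case: i j ij => [[|i] iq] [[|j] jq] //= ij; first by rewrite ea // !eqSS.
  by rewrite eq // orbF eqSS.
move=> i j; case: (ltngtP i j) => [|ji|/val_inj->]; first exact: key.
  by rewrite es key // orbC.
rewrite ei orbb; apply/esym/negbTE; rewrite -val_eqE /=.
have [jn|jn] := eqVneq j.+1 (size q).+1.
  by rewrite jn modnn; case: jn => ->; rewrite -lt0n ltnW.
by rewrite modn_small; [rewrite neq_ltn ltnSn|rewrite ltn_neqAle jn /=; apply: ltn_ord].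
Qed.

Section Chordal.
Variable V : finType.
Implicit Types (e : rel V) (A B S : {set V}) (u v x y : V).

Definition hole e n (c : 'I_n -> V) : Prop := injective c /\
  forall i j, e (c i) (c j) = (j == ordS i) || (i == ordS j).

Definition chordal_in e A : Prop := forall n (c : 'I_n -> V),
  3 < n -> (forall i, c i \in A) -> ~ hole e c.

Lemma chordal_inS e A B : A \subset B -> chordal_in e B -> chordal_in e A.
Proof. by move=> /subsetP AB cB n c n3 cA; apply: cB => // i; apply: AB. Qed.

Lemma hole_card n (c : 'I_n -> V) e A : hole e c -> (forall i, c i \in A) -> n <= #|A|.
Proof.
move=> [ci _] cA; rewrite -[n]card_ord -(card_imset _ ci).
by apply/subset_leq_card/subsetP => _ /imsetP[i _ ->].
Qed.

Lemma chordal_clique e A : clique e A -> chordal_in e A.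
Proof.
move=> /cliqueP kA [//|n] c n3 cA [ci ca].
have n2 : 2 < n.+1 by apply: ltnW.
pose i2 := Ordinal n2.
have := ca ord0 i2; rewrite kA //; last by rewrite (inj_eq ci).
rewrite -!val_eqE /= !modn_small //; last by case: n n3 {ci ca cA c i2 n2} => [|[]].
Qed.

Section Glue.
Variables (e : rel V) (A A1 A2 S : {set V}).
Hypotheses (e_sym : symmetric e) (A12 : A1 :|: A2 = A) (SE : A1 :&: A2 = S).
Hypothesis kS : clique e S.
Hypothesis separated : forall u v, u \in A1 :\: S -> v \in A2 :\: S -> ~~ e u v.

Let crossing (d : nat -> V) k a : (forall i, d i \in A) -> (forall i, e (d i) (d i.+1)) ->
  (d a \in A1 :\: S /\ d (a + k) \in A2 :\: S) \/ (d a \in A2 :\: S /\ d (a + k) \in A1 :\: S) ->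
  exists2 p, a < p < a + k & d p \in S.
Proof.
move=> dA de; elim: k a => [|k IH] a.
  rewrite addn0 => -[] [] /setDP[a1 aS] /setDP[a2 _];
  by move: aS; rewrite -SE inE a1 a2.
move=> H; have [pS|pS] := boolP (d a.+1 \in S).
  case: k H {IH} => [|k] H; last by exists a.+1 => //; lia.
  by rewrite addn1 in H; case: H => -[_ /setDP[_]]; rewrite pS.
have [|p pk pS'] := IH a.+1; last by exists p => //; lia.
rewrite addSnnS; have := dA a.+1; rewrite -A12 inE.
have ea := de a; case: H => -[h1 h2] h; [left|right]; split=> //; rewrite in_setD pS /=.
  case/orP: h => // h; have := separated h1 (v := d a.+1); rewrite in_setD pS h => /(_ isT).
  by rewrite ea.
case/orP: h => // h; have := @separated (d a.+1) _ _ h1; rewrite in_setD pS h => /(_ isT).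
by rewrite e_sym ea.
Qed.

(** Walk around an induced cycle from a vertex that is only in A1 to one only in
    A2 and back. Both ways lead through S, in two adjacent vertices; but they are
    not consecutive on the cycle. *)
Lemma chordal_glue : chordal_in e A1 -> chordal_in e A2 -> chordal_in e A.
Proof.
move=> c1 c2 [//|n] c n3 cA H; have [ci ca] := H.
have [all1|/forallPn[j j1]] := boolP [forall i, c i \in A1].
  by apply: c1 n3 _ H => i; apply: (forallP all1).
have [all2|/forallPn[i i2]] := boolP [forall i, c i \in A2].
  by apply: c2 n3 _ H => i'; apply: (forallP all2).
have iA : c i \in A1 :\: S.
  have := cA i; rewrite -A12 -SE !inE (negbTE i2) orbF => ->; by rewrite andbF.
have jA : c j \in A2 :\: S.
  by have := cA j; rewrite -A12 -SE !inE (negbTE j1) /= => ->.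
(* The cycle, unrolled and started at i. *)
pose d k := c (Ordinal (ltn_pmod (i + k) (ltn0Sn n))).
have dA k : d k \in A by apply: cA.
have d_inj a b : a <= n -> b <= n -> d a = d b -> a = b.
  move=> an bn /ci/(congr1 val) /= /eqP; rewrite eqn_modDl !modn_small ?ltnS //.
  by move/eqP.
have d_adj a b : e (d a) (d b) = (b == a.+1 %[mod n.+1]) || (a == b.+1 %[mod n.+1]).
  rewrite ca -!val_eqE /= -!(addn1 (_ %% _)) !modnDml !addn1 -!addnS !eqn_modDl.
  by [].
have de k : e (d k) (d k.+1) by rewrite d_adj eqxx.
have d0 : d 0 \in A1 :\: S.
  rewrite /d (_ : Ordinal _ = i) //; apply: val_inj; by rewrite /= addn0 modn_small.
have dn : d n.+1 = d 0 by congr c; apply: val_inj; rewrite /= addn0 modnDr.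
pose m := (j + (n.+1 - i)) %% n.+1.
have mn : m < n.+1 by apply: ltn_pmod.
have dm : d m \in A2 :\: S.
  rewrite /d (_ : Ordinal _ = j) //; apply: val_inj.
  by rewrite /= /m modnDmr addnCA subnKC ?modnDr ?modn_small // ltnW.
have [|p pm pS] := @crossing d m 0 dA de; first by left.
have [|q qm qS] := @crossing d (n.+1 - m) m dA de.
  by right; rewrite subnKC ?dn // ltnW.
case/andP: pm => p0 pm; rewrite add0n in pm.
case/andP: qm => mq; rewrite subnKC; last exact: ltnW.
rewrite ltnS => qn; have pq : p.+1 < q by apply: leq_ltn_trans mq.
have dpq : d p != d q.
  apply/eqP => /d_inj E; have := ltn_trans (ltnSn p) pq.
  by rewrite E ?ltnn // ltnW // (leq_trans _ qn) // ltnW.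
by have := cliqueP _ _ kS _ _ pS qS dpq; rewrite d_adj cyclic_far.
Qed.
End Glue.

Section Dirac.
Variables (e : rel V) (A : {set V}).
Hypotheses (e_sym : symmetric e) (e_irr : irreflexive e) (A_chordal : chordal_in e A).

(** Let a and b be nonadjacent, C the component of b among the vertices not
    adjacent to a, and S the set of neighbours of a with a neighbour in C, which
    separates a from b. If u and v in S were not adjacent, an induced path from u
    to v through C would be closed to a hole by a. *)
Lemma chordal_clique_separator : ~~ clique e A ->
  exists S, [/\ S \subset A, clique e S & ~~ conn e (A :\: S)].
Proof.
move=> /forall_inPn[a aA /forall_inPn[b bA]]; rewrite negb_imply => /andP[ab nab].
pose N := nbr e A a; pose B := A :\: (a |: N).
have bB : b \in B by rewrite !inE negb_or eq_sym ab bA (negbTE nab).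
pose C := component e B b; have /subsetP CB : C \subset B := component_sub e bB.
have bC : b \in C by rewrite inE connect0.
have CA c : c \in C -> [/\ c \in A, c != a & ~~ e a c].
  move/CB; rewrite /B in_setD in_setU1 in_nbr negb_or => /andP[/andP[ca]].
  by rewrite negb_and => /orP[/negP h /h//|h cA].
pose S := [set u in N | [exists c in C, e u c]].
have SN u : u \in S -> [/\ u \in A, e a u & exists2 c, c \in C & e u c].
  by rewrite inE in_nbr => /andP[/andP[uA au] /exists_inP].
exists S; split.
- by apply/subsetP => u /SN[].
- apply/cliqueP => u v uS vS uv; apply/negPn/negP => nuv.
  have [uA au [c cC uc]] := SN u uS; have [vA av [c' c'C vc']] := SN v vS.
  pose D := u |: (v |: C).
  have CD : C \subset D by apply/subsetP => x xC; rewrite !in_setU1 xC !orbT.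
  have uD : u \in D by rewrite !in_setU1 eqxx.
  have vD : v \in D by rewrite !in_setU1 eqxx orbT.
  have comp x : x \in C -> connect (within e D) b x.
    by move=> xC; apply: (withinS CD _ (component_conn bB xC)).
  have : connect (within e D) u v.
    have cD := subsetP CD _ cC; have c'D := subsetP CD _ c'C.
    apply: connect_trans (connect1 (_ : within e D u c)) _; first by rewrite /within uD cD.
    apply: (@connect_trans _ _ b); first by rewrite (connect_within_sym _ e_sym) comp.
    apply: connect_trans (comp _ c'C) (connect1 _).
    by rewrite /within c'D vD e_sym.
  case/connectP=> p0 pp0 vE.
  have [p [ip lp sp]] := induced_path pp0; rewrite -vE in lp.
  have pD : {subset u :: p <= D}.
    by move=> x; rewrite inE => /orP[/eqP->//|/sp/(path_within_sub pp0)].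
  have au_p x : x \in u :: p -> e a x = (x == u) || (x == v).
    move=> /pD; rewrite !in_setU1 => /or3P[/eqP->|/eqP->|/CA[_ _ /negbTE eax]].
    - by rewrite au eqxx.
    - by rewrite av eqxx orbT.
    - rewrite eax; apply/esym/negbTE; apply/norP.
      by split; apply: contraFneq eax => ->.
  have ap : a \notin u :: p.
    apply/negP => /[dup] /au_p; rewrite e_irr => /esym/negbT/norP[nau nav] /pD.
    by rewrite !in_setU1 (negbTE nau) (negbTE nav) => /CA[]; rewrite eqxx.
  have up := induced_uniq ip.
  have iw : forall i j, i < j -> j < size (u :: p) ->
       e (nth a (u :: p) i) (nth a (u :: p) j) = (j == i.+1).
    move=> i j ij js; rewrite -(induced_nth a ip ij js) /within.
    by rewrite !pD ?mem_nth //; apply: ltn_trans js.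
  case: p ip lp sp pD au_p ap up iw => [|w p]; first by move=> _ /= E; rewrite E eqxx in uv.
  move=> _ lp _ pD au_p ap up iw.
  have q2 : 2 < size [:: u, w & p].
    case: p lp iw {pD au_p ap up} => [|//] /= wv /(_ 0 1 isT isT) /=.
    by rewrite wv (negbTE nuv).
  have ea i : i < size [:: u, w & p] ->
      e a (nth a [:: u, w & p] i) = (i == 0) || (i.+1 == size [:: u, w & p]).
    move=> iq; rewrite au_p ?mem_nth //; congr (_ || _).
      by rewrite -[X in _ == X]/(nth a [:: u, w & p] 0) nth_uniq.
    have -> : v = nth a [:: u, w & p] (size p).+1.
      by rewrite -lp -[(size p).+1]/((size [:: u, w & p]).-1) nth_last.
    by rewrite nth_uniq // -eqSS.
  move: [:: u, w & p] pD au_p ap up iw q2 ea => q pD _ ap up iw q2 ea.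
  have H := induced_path_hole e_sym e_irr (ltnW q2) _ iw ea.
  apply: (A_chordal (c := fun i : 'I_(size q).+1 => nth a (a :: q) i)) => //.
    move=> [[|i] /= iq] //.
    have /pD : nth a q i \in q by apply: mem_nth.
    by rewrite !in_setU1 => /or3P[/eqP->|/eqP->|/CA[]].
  by apply: H; rewrite /= ap.
apply/connP => cn.
have aS : a \notin S by apply/negP => /SN[_]; rewrite e_irr.
have bS : b \notin S by apply/negP => /SN[_ ab' _]; rewrite ab' in nab.
have aC : a \notin C by apply/negP => /CA[_]; rewrite eqxx.
have := cn b a; rewrite !in_setD aS bS aA bA => /(_ isT isT) /connect_exit /(_ bC aC).
case=> c [d [cC dC _ /setDP[dA dS] cd]].
have [cA ca nac] := CA c cC.
have da : d != a by apply: contraNneq nac => <-; rewrite e_sym.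
have [adj|nadj] := boolP (e a d).
  by case/negP: dS; rewrite inE in_nbr dA adj; apply/exists_inP; exists c; rewrite // e_sym.
case/negP: dC; apply: component_step bB cC _ cd.
by rewrite in_setD in_setU1 in_nbr negb_or da (negbTE nadj) andbF dA.
Qed.
End Dirac.
End Chordal.
Local Open Scope ring_scope.

(** * Planar graphs with real chromatic roots *)

Section Main.
Variables (C : numClosedFieldType) (V : finType) (e lt : rel V) (n : V -> V -> V -> bool).
Hypotheses (e_sym : symmetric e) (e_irr : irreflexive e).
Hypothesis e_planar : crossing_parity e lt n.
Implicit Types (A B S : {set V}) (p q : {poly int}).

Local Notation mapC p := (map_poly (intr : int -> C) p).

Lemma split_proper A A1 A2 S :
  A1 :|: A2 = A -> A1 :&: A2 = S -> A1 :\: S != set0 -> A2 :\: S != set0 ->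
  [/\ A1 \subset A, A2 \subset A, (#|A1| < #|A|)%N & (#|A2| < #|A|)%N].
Proof.
move=> <- <- /set0Pn[x /setDP[x1 x12]] /set0Pn[y /setDP[y2 y12]].
have x2 : x \notin A2 by apply: contra x12 => x2; rewrite inE x1.
have y1 : y \notin A1 by apply: contra y12 => y1; rewrite inE y1.
rewrite subsetUl subsetUr; split=> //; apply: proper_card; apply/properP; split;
  rewrite ?subsetUl ?subsetUr //.
- by exists y => //; rewrite inE y2 orbT.
- by exists x => //; rewrite inE x1.
Qed.

(** These are the roots of the falling factorial. *)
Lemma chromatic_clique_root S p (z : C) : clique e S -> chromatic e S p ->
  root (mapC p) z -> exists2 i, (i < #|S|)%N & z = i%:R.
Proof.
move=> kS pP; rewrite (chromatic_clique e_sym e_irr kS pP) rmorph_prod /=.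
rewrite /root horner_prod => /prodf_eq0[i _].
rewrite rmorphB /= map_polyX map_polyC /= hornerXsubC subr_eq0 => /eqP->.
by exists i => //; rewrite rmorph_nat.
Qed.

(** In a clique with five vertices an edge lies in three triangles. *)
Lemma planar_clique_card A : clique e A -> (#|A| <= 4)%N.
Proof.
move=> kA; rewrite leqNgt; apply/negP => A5.
have atomA : atom e A.
  apply/atomP => S SA _; apply/connP => u v uS vS.
  have [->|uv] := eqVneq u v; first exact: connect0.
  apply: connect1; rewrite /within uS vS (cliqueP _ _ kA) //.
    by case/setDP: uS. by case/setDP: vS.
have /card_gt1P[u [v [uA vA uv]]] : (1 < #|A|)%N by lia.
have := atom_edge_le2 e_sym e_irr e_planar atomA uA vA (cliqueP _ _ kA _ _ uA vA uv).
rewrite (_ : [set x in A | _] = A :\ u :\ v).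
  by move: A5; rewrite (cardsD1 u) uA (cardsD1 v (A :\ u)) !inE eq_sym uv vA; lia.
apply/setP => x; rewrite in_set !in_setD1; have [xA|xA] := boolP (x \in A); rewrite ?andbF //= andbT.
rewrite andbC; congr andb; [have yA := vA|have yA := uA].
  by apply/idP/idP => [|xv]; [apply: contraTneq => ->; rewrite e_irr|
    apply: (cliqueP _ _ kA); rewrite // eq_sym].
by apply/idP/idP => [|xv]; [apply: contraTneq => ->; rewrite e_irr|
    apply: (cliqueP _ _ kA); rewrite // eq_sym].
Qed.

Lemma atom_conn2 A : atom e A -> conn2 e A.
Proof.
move=> /atomP atomA; apply/andP; split.
  by have := atomA set0; rewrite setD0; apply; rewrite ?sub0set ?clique0.
by apply/forall_inP => v vA; apply: atomA; rewrite ?sub1set ?clique1.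
Qed.

(** The inequalities of [atom_euler] and [real_root_inequalities] leave
    m = 2n - 3, t = n - 2, and n = 4, m = 6. *)
Lemma atom_real_roots_clique A p : atom e A -> chromatic e A p -> (3 < #|A|)%N ->
  (forall z : C, root (mapC p) z -> z \is Num.real) -> clique e A.
Proof.
move=> atomA pP A4 p_real.
have [i1 i2 i3] := real_root_inequalities e_sym e_irr pP (ltnW A4) (atom_conn2 atomA) p_real.
have mA := card_edges_le e A.
apply: clique_card_edges.
have [[h1 h2]|[_ h]] := atom_euler e_sym e_irr e_planar atomA; last first.
  by case: (atom_not_disc e_sym e_irr e_planar atomA A4); lia.
have A4' : #|A| = 4%N by lia.
have c42 : 'C(4, 2) = 6%N by [].
by move: mA; rewrite A4' c42; lia.
Qed.

Lemma real_roots_chordal A p : chromatic e A p ->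
  (forall z : C, root (mapC p) z -> z \is Num.real) -> chordal_in e A.
Proof.
have [k] := ubnP #|A|; elim: k A p => // k IH A p; rewrite ltnS => Ak pP p_real.
have [A3|A4] := leqP #|A| 3.
  move=> m c m3 cA H; have := hole_card H cA; by rewrite leqNgt (leq_ltn_trans A3 m3).
have [atomA|] := boolP (atom e A).
  by apply: chordal_clique; apply: atom_real_roots_clique p_real.
move=> /forallPn[S]; rewrite negb_imply -andbA => /and3P[SA kS nc].
have [A1 [A2 [A12 SE n1 n2 sep]]] := not_conn_split e_sym SA nc.
have [_ _ lt1 lt2] := split_proper A12 SE n1 n2.
have [p1 [p1P _ _]] := chromatic_exists A1 e_sym e_irr.
have [p2 [p2P _ _]] := chromatic_exists A2 e_sym e_irr.
have [pS [pSP _ _]] := chromatic_exists S e_sym e_irr.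
have PE := chromatic_clique_sum e_sym A12 SE kS sep pP p1P p2P pSP.
have real12 z : root (mapC (p1 * p2)) z -> z \is Num.real.
  rewrite -PE rmorphM /= rootM => /orP[/p_real//|].
  by move/(chromatic_clique_root kS pSP) => [i _ ->]; apply: realn.
apply: (chordal_glue e_sym A12 SE kS sep).
  apply: (IH A1 p1) => //; first by apply: leq_trans lt1 Ak.
  by move=> z z1; apply: real12; rewrite rmorphM /= rootM z1.
apply: (IH A2 p2) => //; first by apply: leq_trans lt2 Ak.
by move=> z z2; apply: real12; rewrite rmorphM /= rootM z2 orbT.
Qed.

Lemma chordal_planar_roots A p (z : C) : chordal_in e A -> chromatic e A p ->
  root (mapC p) z -> exists2 i, (i < 4)%N & z = i%:R.
Proof.
have [k] := ubnP #|A|; elim: k A p => // k IH A p; rewrite ltnS => Ak cA pP pz.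
have [kA|nkA] := boolP (clique e A).
  have [i iA ->] := chromatic_clique_root kA pP pz.
  by exists i => //; apply: leq_trans iA (planar_clique_card kA).
have [S [SA kS nc]] := chordal_clique_separator e_sym e_irr cA nkA.
have [A1 [A2 [A12 SE n1 n2 sep]]] := not_conn_split e_sym SA nc.
have [s1 s2 lt1 lt2] := split_proper A12 SE n1 n2.
have [p1 [p1P _ _]] := chromatic_exists A1 e_sym e_irr.
have [p2 [p2P _ _]] := chromatic_exists A2 e_sym e_irr.
have [pS [pSP _ _]] := chromatic_exists S e_sym e_irr.
have PE := chromatic_clique_sum e_sym A12 SE kS sep pP p1P p2P pSP.
have : root (mapC (p1 * p2)) z by rewrite -PE rmorphM /= rootM pz.
rewrite rmorphM /= rootM => /orP[z1|z2].
- by apply: IH p1P z1; [apply: leq_trans lt1 Ak|apply: chordal_inS cA].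
- by apply: IH p2P z2; [apply: leq_trans lt2 Ak|apply: chordal_inS cA].
Qed.
End Main.

From mathcomp Require Import all_classical all_reals topology normedtype.
From mathcomp Require Import sequences interval_inference complex.
Import numFieldNormedType.Exports.

(** * Crossing parities of plane drawings *)

Section Crossings.
Variable R : realType.
Implicit Types (v w : R * R) (p q : nat -> R * R).

(** The lexicographically negative vectors. The tie on the vertical axis is
    broken by the second coordinate so that exactly one of v and - v is in this
    half plane. *)
Definition lefthalf v := (v.1 < 0) || ((v.1 == 0) && (v.2 < 0)).

(** For a short step from v to w far from the origin, this tells whether it
    crosses the downward ray from the origin. *)
Definition ray_cross v w : bool := (lefthalf v != lefthalf w) && (v.2 < 0).

Lemma lefthalfN v : v != 0 -> lefthalf (- v) = ~~ lefthalf v.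
Proof.
case: v => x y nz; rewrite /lefthalf /= oppr_lt0 oppr_eq0 oppr_lt0.
case: (ltrgtP x 0) => //= x0; case: (ltrgtP y 0) => //= y0.
by move: nz; rewrite x0 y0 eqxx.
Qed.

(** A short step far from the origin that crosses the vertical axis does so far
    above or far below the origin. *)
Lemma lefthalf_near d v w : `|v - w| < d -> lefthalf v != lefthalf w ->
  d <= `|v| -> `|v| = `|v.2|.
Proof.
case: v w => [x y] [x' y']; rewrite !prod_normE /= /lefthalf /=.
rewrite gt_max => /andP[dx _] h; rewrite le_max => fx.
have xx : x <= 0 /\ 0 <= x' \/ 0 <= x /\ x' <= 0.
  by move: h; case: (ltrgtP x 0) => ?; case: (ltrgtP x' 0) => ? //= _; lra.
have : `|x| <= `|x - x'|.
  by case: xx => -[x0 x0']; [rewrite !ler0_norm|rewrite !ger0_norm]; lra.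
move=> xd; apply/max_idPr; apply/(le_trans xd)/ltW/(lt_le_trans dx).
by case/orP: fx => // fx; lra.
Qed.

Lemma second_near d v w : `|v - w| < d -> d <= `|v.2| ->
  (v.2 < 0) = (w.2 < 0) /\ `|v.2| - d <= `|w.2|.
Proof.
case: v w => [x y] [x' y']; rewrite !prod_normE /= gt_max => /andP[_ dy] h.
have h' := lerB_dist y y'; split; last by lra.
move: dy; rewrite ltr_norml => /andP[dy1 dy2].
case: (lerP 0 y) h => y0.
  by rewrite ger0_norm // => h; apply/esym/negbTE; lra.
by rewrite ltr0_norm // => h; apply/esym; lra.
Qed.

Lemma ray_crossC d v w : `|v - w| < d -> d <= `|v| ->
  ray_cross v w = ray_cross w v.
Proof.
move=> vw dv; rewrite /ray_cross eq_sym; case: (boolP (_ == _)) => //= h.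
rewrite eq_sym in h.
have [] // := second_near vw; by rewrite -(lefthalf_near vw).
Qed.

(** A step and its opposite together cross the whole vertical axis. *)
Lemma ray_crossN v w : v != 0 -> w != 0 ->
  (lefthalf v != lefthalf w -> v.2 != 0) ->
  ray_cross (- v) (- w) = ray_cross v w (+) (lefthalf v (+) lefthalf w).
Proof.
move=> v0 w0 h; rewrite /ray_cross !lefthalfN // oppr_lt0.
move: h; case: (ltrgtP v.2 0) => h; case: (lefthalf v); case: (lefthalf w) => //=;
  by move=> /(_ isT).
Qed.

(** If any side of the square crosses the vertical axis, the second coordinates
    of all four corners have the same sign, and a closed walk crosses the axis an
    even number of times. *)
Lemma ray_cross_square d v1 v2 v3 v4 :
  `|v1 - v2| < d -> `|v2 - v3| < d -> `|v3 - v4| < d -> `|v4 - v1| < d ->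
  4 * d <= `|v1| -> 4 * d <= `|v2| -> 4 * d <= `|v3| -> 4 * d <= `|v4| ->
  ray_cross v1 v2 + ray_cross v2 v3 + ray_cross v3 v4 + ray_cross v4 v1 = 0.
Proof.
have same u1 u2 u3 u4 : `|u1 - u2| < d -> `|u2 - u3| < d -> `|u3 - u4| < d ->
    4 * d <= `|u1| -> lefthalf u1 != lefthalf u2 ->
    [/\ (u2.2 < 0) = (u1.2 < 0), (u3.2 < 0) = (u1.2 < 0) &
        (u4.2 < 0) = (u1.2 < 0)].
  move=> d1 d2 d3 f1 l12.
  have d0 := le_lt_trans (normr_ge0 _) d1.
  have e1 : `|u1| = `|u1.2| by apply: lefthalf_near d1 l12 _; lra.
  have [|s12 f2] := second_near d1; first by lra.
  have [|s23 f3] := second_near d2; first by lra.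
  have [|s34 f4] := second_near d3; first by lra.
  by rewrite -s34 -s23 -s12.
move=> d1 d2 d3 d4 f1 f2 f3 f4; rewrite /ray_cross.
have := same _ _ _ _ d1 d2 d3 f1; have := same _ _ _ _ d2 d3 d4 f2.
have := same _ _ _ _ d3 d4 d1 f3; have := same _ _ _ _ d4 d1 d2 f4.
case: (lefthalf v1); case: (lefthalf v2); case: (lefthalf v3);
  case: (lefthalf v4) => //= a4 a3 a2 a1;
  try (by case: a1 => // e1 e2 e3; rewrite ?e1 ?e2 ?e3; case: (v1.2 < 0));
  try (by case: a2 => // e1 e2 e3; rewrite ?e1 ?e2 ?e3; case: (v2.2 < 0));
  by case: a3 => // e1 e2 e3; rewrite ?e1 ?e2 ?e3; case: (v3.2 < 0).
Qed.

(** Every inner side of the grid belongs to two squares. *)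
Lemma grid_boundary (h w : nat -> nat -> bool) N M :
  (forall i j, (i < N)%N -> (j < M)%N ->
     h i j + w i.+1 j + h i j.+1 + w i j = 0) ->
  \sum_(i < N) h i 0%N + \sum_(i < N) h i M =
  \sum_(j < M) w 0%N j + \sum_(j < M) w N j.
Proof.
have b2 (a : bool) : a + a = 0 by case: a.
have row i : (forall j, (j < M)%N -> h i j + w i.+1 j + h i j.+1 + w i j = 0) ->
    h i 0%N + h i M = \sum_(j < M) w i j + \sum_(j < M) w i.+1 j.
  elim: M => [|m IH] H; first by rewrite !big_ord0 !b2.
  rewrite !big_ord_recr /= addrACA -IH => [|j jm]; last exact/H/leqW.
  have := H m (ltnSn m); case: (h i m); case: (h i m.+1); case: (h i 0%N);
  by case: (w i m); case: (w i.+1 m).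
elim: N => [|n IH] H; first by rewrite !big_ord0 !b2.
rewrite !big_ord_recr /= addrACA IH => [|i j ii jj]; last by apply/H/jj/leqW.
rewrite row => [|j jm]; last exact: H.
by rewrite addrA -(addrA (\sum_(j < M) w 0%N j)) b2 addr0.
Qed.

Definition path_cross p N c : bool :=
  \sum_(i < N) ray_cross (p i - c) (p i.+1 - c).

(** The vectors [p i - q j] form a grid with small squares far from the origin,
    and the parities add up to 0 on its boundary by [grid_boundary]. Two sides of
    the boundary are the path p seen from the ends of q. The other two are the
    path q seen from the ends of p, up to sign; by [ray_crossN] the sign is
    accounted for by the positions of the ends. *)
Lemma path_cross_exchange d p q N M : 0 < d ->
  (forall i, (i < N)%N -> `|p i - p i.+1| < d) ->
  (forall j, (j < M)%N -> `|q j - q j.+1| < d) ->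
  (forall i j, (i <= N)%N -> (j <= M)%N -> 4 * d <= `|p i - q j|) ->
  path_cross p N (q 0%N) + path_cross p N (q M) +
  path_cross q M (p 0%N) + path_cross q M (p N) =
  lefthalf (q 0%N - p 0%N) + lefthalf (q M - p 0%N) +
  lefthalf (q 0%N - p N) + lefthalf (q M - p N).
Proof.
move=> d0 dp dq dpq.
pose h i j : bool := ray_cross (p i - q j) (p i.+1 - q j).
pose w i j : bool := ray_cross (p i - q j) (p i - q j.+1).
have dp' i j : (i < N)%N -> `|(p i - q j) - (p i.+1 - q j)| < d.
  by move=> iN; rewrite opprB addrA subrK; apply: dp.
have dq' i j : (j < M)%N -> `|(p i - q j) - (p i - q j.+1)| < d.
  by move=> jM; rewrite opprB addrC addrA subrK distrC; apply: dq.
have f1 i j : (i <= N)%N -> (j <= M)%N -> d <= `|p i - q j|.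
  by move=> iN jM; apply: le_trans (dpq _ _ iN jM); lra.
have square i j : (i < N)%N -> (j < M)%N ->
    h i j + w i.+1 j + h i j.+1 + w i j = 0.
  move=> iN jM.
  have e1 := ray_crossC (dp' _ j.+1 iN) (f1 _ _ (ltnW iN) jM).
  have e2 := ray_crossC (dq' i _ jM) (f1 _ _ (ltnW iN) (ltnW jM)).
  rewrite /h /w e1 e2; apply: (@ray_cross_square d).
  - exact: dp'.
  - exact: dq'.
  - by rewrite distrC; apply: dp'.
  - by rewrite distrC; apply: dq'.
  1-4: by apply: dpq => //; apply: ltnW.
have := grid_boundary square; rewrite -/(path_cross p N (q 0%N)).
rewrite -/(path_cross p N (q M)) -addrA => ->.
have side i : (i <= N)%N ->
    \sum_(j < M) w i j + path_cross q M (p i) =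
    lefthalf (q 0%N - p i) + lefthalf (q M - p i).
  move=> iN.
  have Q j : (j < M)%N -> w i j + ray_cross (q j - p i) (q j.+1 - p i) =
       lefthalf (q j - p i) + lefthalf (q j.+1 - p i).
    move=> jM; rewrite /w -(opprB (q j)) -(opprB (q j.+1)).
    have nz k : (k <= M)%N -> q k - p i != 0.
      by move=> kM; rewrite -normr_gt0 distrC; apply: lt_le_trans d0 (f1 _ _ _ _).
    rewrite ray_crossN ?(nz _ jM) ?(nz _ (ltnW jM)) //.
    - by case: ray_cross; case: lefthalf; case: lefthalf.
    - move=> H; have dqq : `|(q j - p i) - (q j.+1 - p i)| < d.
        by rewrite opprB addrA subrK; apply: dq.
      have fq : d <= `|q j - p i| by rewrite distrC f1 // ltnW.
      have e := lefthalf_near dqq H fq.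
      by rewrite -normr_gt0 -e; apply: lt_le_trans d0 fq.
  rewrite /path_cross -big_split /=.
  rewrite (eq_bigr (fun j : 'I_M => lefthalf (q j - p i) + lefthalf (q j.+1 - p i))).
    2: by move=> j _; apply: Q.
  elim: (M) => [|m IH]; first by rewrite big_ord0; case: lefthalf.
  rewrite big_ord_recr /= IH; case: (lefthalf _); case: (lefthalf _); case: (lefthalf _) => //.
rewrite addrACA !side //.
by rewrite !addrA.
Qed.
End Crossings.
Local Open Scope classical_set_scope.
Section Analysis.
Variable R : realType.
Implicit Types (f g : R -> R * R).

(** Uniform continuity on a compact interval, with the modulus in the form needed
    for equal subdivisions. *)
Lemma path_unif_continuous f (d : R) : 0 < d ->
  {within `[0, 1], continuous f} ->
  \forall N \near \oo, forall x y : R, x \in `[0, 1]%R -> y \in `[0, 1]%R ->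
     `|x - y| <= N.+1%:R^-1 -> `|f x - f y| < d.
Proof.
move=> d0 /subspace_continuousP cf.
have /compact_near_coveringP K := @segment_compact R 0 1.
pose P N x := x \in `[0, 1]%R -> forall y, y \in `[0, 1]%R ->
  `|x - y| <= N.+1%:R^-1 -> `|f x - f y| < d.
have H : \forall N \near \oo, `[0, 1 : R] `<=` P N.
  apply: K => x x01.
  have d2 : 0 < d / 2 by lra.
  have := cf x x01; move/cvgrPdist_lt/(_ _ d2).
  rewrite near_withinE => /nbhs_ballP [r /= r0 Hr].
  have r2 : 0 < r / 2 by lra.
  exists (ball x (r / 2), [set N | N.+1%:R^-1 < r / 2]).
    by split => /=; [exact: nbhsx_ballx | exact: near_infty_natSinv_lt (PosNum r2)].
  move=> [x' N] /= [bx' N2] x'01 y y01 xy.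
  have h1 : `|f x - f x'| < d / 2.
    apply: (Hr x') => //.
    by apply: le_ball bx'; lra.
  have h2 : `|f x - f y| < d / 2.
    apply: (Hr y) => //; rewrite /ball /=.
    move: bx'; rewrite /ball /= => bx'.
    apply: le_lt_trans (ler_distD x' x y) _; rewrite [r]splitr.
    by apply: ltrD => //; apply: le_lt_trans xy N2.
  by have := ler_distD (f x) (f x') (f y); rewrite (distrC (f x') (f x)); lra.
by apply: filterS H => N H x y x01; apply: H.
Qed.

Lemma disjoint_paths_distance f g :
  {within `[0, 1], continuous f} -> {within `[0, 1], continuous g} ->
  (forall s t : R, s \in `[0, 1]%R -> t \in `[0, 1]%R -> f s <> g t) ->
  \forall d \near 0^'+, forall s t : R, s \in `[0, 1]%R -> t \in `[0, 1]%R ->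
    d <= `|f s - g t|.
Proof.
move=> /subspace_continuousP cf /subspace_continuousP cg fg.
have c01 := @segment_compact R 0 1.
have /compact_near_coveringP K := compact_setX c01 c01.
pose P (d : R) (st : R * R) := (`[0, 1] `*` `[0, 1]) st ->
  d <= `|f st.1 - g st.2|.
have H : \forall d \near 0^'+, `[0, 1 : R] `*` `[0, 1 : R] `<=` P d.
  apply: K => -[s t] /= [s01 t01].
  have r0 : 0 < `|f s - g t| / 3.
    by rewrite divr_gt0 // normr_gt0 subr_eq0; apply/eqP/fg.
  have := cf s s01; move/cvgrPdist_lt/(_ _ r0); rewrite near_withinE => Hs.
  have := cg t t01; move/cvgrPdist_lt/(_ _ r0); rewrite near_withinE => Ht.
  pose Us := [set s' : R | `[0, 1] s' -> `|f s - f s'| < `|f s - g t| / 3].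
  pose Ut := [set t' : R | `[0, 1] t' -> `|g t - g t'| < `|f s - g t| / 3].
  exists (Us `*` Ut, [set d | d < `|f s - g t| / 3]).
    split => /=; first by exists (Us, Ut).
    exact: nbhs_right_lt.
  move=> [[s' t'] d] /= [[us ut] dr] [s'01 t'01].
  have {us}us := us s'01; have {ut}ut := ut t'01.
  have := ler_distD (f s') (f s) (g t); have := ler_distD (g t') (f s') (g t).
  by rewrite (distrC (g t') (g t)); lra.
by apply: filterS H => d H s t s01 t01; apply: (H (s, t)).
Qed.
End Analysis.

(** All arcs are subdivided equally, so finely that the pieces are much shorter
    than the distance between any two disjoint arcs. *)
Lemma planar_crossing_parity (R : realType) (G : mgraph) : planar R G ->
  exists lt n, @crossing_parity (vertex G) (@adj G) lt n.
Proof.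
case=> pt [arc [pt_inj arc_c arc_ends arc_v arc_e]].
have in0 : (0 : R) \in `[0, 1]%R by rewrite in_itv /= lexx ler01.
have in1 : (1 : R) \in `[0, 1]%R by rewrite in_itv /= lexx ler01.
have arc01 e t : t \in `[0, 1]%R -> (exists2 v, v \in ends e & arc e t = pt v)
    \/ 0 < t < 1.
  rewrite in_itv /= !le_eqVlt => /andP[/orP[/eqP <-|t0] /orP[t1|t1]].
  - by move: t1; rewrite eq_sym oner_eq0.
  - left; have : [set arc e 0; arc e 1] (arc e 0) by left.
    by rewrite arc_ends => -[v ve <-]; exists v.
  - left; move/eqP: t1 => ->; have : [set arc e 0; arc e 1] (arc e 1) by right.
    by rewrite arc_ends => -[v ve <-]; exists v.
  - by right; rewrite t0.
pose dj (e e' : edge G) := [forall v in ends e, v \notin ends e'].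
have arc_disj e e' : (dj e e') ->
    forall s t : R, s \in `[0, 1]%R -> t \in `[0, 1]%R -> arc e s <> arc e' t.
  move=> /forall_inP dis s t.
  have dis' v : v \in ends e -> v \in ends e' -> False by move/dis/negP.
  move=> /(arc01 e)[[v ve ->]|s01] /(arc01 e')[[v' ve' ->]|t01].
  - by move/pt_inj => vv; apply: (dis' v) => //; rewrite vv.
  - by move/esym/arc_v; apply.
  - by move/arc_v; apply.
  - move=> /arc_e[] // ee _; have /card_gt0P[v ve] : (0 < #|ends e|)%N.
      by case/andP: (endsP e).
    by apply: (dis' v) => //; rewrite -ee.
have [d d0 Hd] : exists2 d : R, 0 < d & forall e e', (dj e e') ->
    forall s t : R, s \in `[0, 1]%R -> t \in `[0, 1]%R -> 4 * d <= `|arc e s - arc e' t|.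
  have H : \forall d \near (0 : R)^'+, forall ee : edge G * edge G,
      (dj ee.1 ee.2) ->
    forall s t : R, s \in `[0, 1]%R -> t \in `[0, 1]%R -> d <= `|arc ee.1 s - arc ee.2 t|.
    apply: filter_forall => -[e e'] /=.
    have [dis|] := boolP (dj e e'); last first.
      by move=> _; apply: filterE => d.
    by apply: filterS (disjoint_paths_distance (arc_c e) (arc_c e') (arc_disj _ _ dis)) => d H _.
  have [d [d0 /= dH]] := filter_ex (filterI (nbhs_right_gt (0 : R)) H).
  exists (d / 4); first by lra.
  by move=> e e' dis s t s01 t01; have := dH (e, e') dis s t s01 t01 => /=; lra.
have [N HN] : exists N : nat, forall e x y, x \in `[0, 1]%R -> y \in `[0, 1]%R ->
     `|x - y| <= N.+1%:R^-1 -> `|arc e x - arc e y| < d.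
  have H : \forall N \near \oo, forall e x y, x \in `[0, 1]%R -> y \in `[0, 1]%R ->
     `|x - y| <= N.+1%:R^-1 -> `|arc e x - arc e y| < d.
    by apply: filter_forall => e; apply: path_unif_continuous.
  exact: filter_ex H.
pose p e i := arc e (i%:R / N.+1%:R).
have p0 e : p e 0%N = arc e 0 by rewrite /p mul0r.
have pN e : p e N.+1 = arc e 1 by rewrite /p divff ?pnatr_eq0.
have i01 i : (i <= N.+1)%N -> i%:R / N.+1%:R \in `[0 : R, 1]%R.
  move=> iN; rewrite in_itv /= divr_ge0 ?ler0n //=.
  by rewrite ler_pdivrMr ?ltr0n // mul1r ler_nat.
have dp e i : (i < N.+1)%N -> `|p e i - p e i.+1| < d.
  move=> iN; apply: HN; rewrite ?i01 // 1?ltnW //.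
  rewrite -mulrBl -opprB -natrB // subSnn mulN1r normrN ger0_norm //.
have dpq e e' i j : (dj e e') -> (i <= N.+1)%N -> (j <= N.+1)%N ->
   4 * d <= `|p e i - p e' j|.
  by move=> dis iN jN; apply: Hd => //; apply: i01.
pose cr e c := path_cross (p e) N.+1 (pt c).
(* Parallel edges are represented by one of them; its arc may run either way. *)
exists (fun u v => lefthalf (pt u - pt v)).
exists (fun c a b => if [pick e | ends e == [set a; b]%SET] is Some e then cr e c else false).
have two e a b : ends e = [set a; b]%SET ->
    (arc e 0 = pt a /\ arc e 1 = pt b) \/ (arc e 0 = pt b /\ arc e 1 = pt a).
  move=> eab; have E := arc_ends e; rewrite eab in E.
  have A0 : (pt @` [set v | v \in [set a; b]%SET]) (arc e 0) by rewrite -E; left.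
  have A1 : (pt @` [set v | v \in [set a; b]%SET]) (arc e 1) by rewrite -E; right.
  have Aa : [set arc e 0; arc e 1] (pt a) by rewrite E; exists a => //; rewrite /= !inE eqxx.
  have Ab : [set arc e 0; arc e 1] (pt b) by rewrite E; exists b => //; rewrite /= !inE eqxx orbT.
  case: A0 => v /=; rewrite !inE => /orP[]/eqP -> e0; case: A1 => v' /=;
    rewrite !inE => /orP[]/eqP -> e1; [left|by left|by right|left]; split=> //.
  - by case: Ab => ->; rewrite -?e0 -?e1.
  - by case: Aa => ->; rewrite -?e0 -?e1.
split.
- move=> u v uv; rewrite -opprB lefthalfN // subr_eq0.
  by apply: contra uv => /eqP/pt_inj ->.
- by move=> c a b; rewrite finset.setUC.
move=> a b c d' /existsP[e0 ab] /existsP[e0' cd] ac ad bc bd.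
case: pickP => [e /eqP eab|/(_ e0)]; last by rewrite ab.
case: pickP => [e' /eqP ecd|/(_ e0')]; last by rewrite cd.
have dis : (dj e e').
  apply/forall_inP => v; rewrite eab ecd !inE negb_or.
  by case/orP => /eqP->; apply/andP; split.
have := @path_cross_exchange R d (p e) (p e') N.+1 N.+1 d0 (dp e) (dp e')
   (fun i j => @dpq e e' i j dis).
rewrite !p0 !pN /cr.
have bring (a1 a2 a3 a4 b1 b2 b3 b4 : bool) : a1 + a2 + a3 + a4 = b1 + b2 + b3 + b4 ->
    [/\ a1 (+) a2 (+) a3 (+) a4 = b1 (+) b2 (+) b3 (+) b4,
     a2 (+) a1 (+) a3 (+) a4 = b2 (+) b1 (+) b4 (+) b3,
     a1 (+) a2 (+) a4 (+) a3 = b3 (+) b4 (+) b1 (+) b2 &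
     a2 (+) a1 (+) a4 (+) a3 = b4 (+) b3 (+) b2 (+) b1].
  by case: a1; case: a2; case: a3; case: a4; case: b1; case: b2; case: b3; case: b4.
by case: (two e a b eab) => -[-> ->]; case: (two e' c d' ecd) => -[-> ->] /bring[].
Qed.
Local Close Scope classical_set_scope.

(** * The equivalence for planar multigraphs *)

Lemma adj_sym (G : mgraph) : symmetric (@adj G).
Proof. by move=> u v; apply: eq_existsb => e; rewrite finset.setUC. Qed.

Lemma adj_irr (G : mgraph) : loopless G -> irreflexive (@adj G).
Proof.
move=> ll u; apply/negbTE/negP => /existsP[e /eqP E].
by have := ll e; rewrite E finset.setUid cards1.
Qed.

Lemma chromatic_adj (G : mgraph) :
  chromatic (@adj G) [set: vertex G]%SET (chromatic_poly G).
Proof.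
move=> k; rewrite (chromatic_polyP G) //; congr (_%:R).
apply: eq_card => f; rewrite finset.in_set; apply/forallP/colP => [H|[_ H] u].
  split=> [u|u v _ _ uv]; first by rewrite finset.in_setT.
  by have /forallP/(_ v)/implyP := H u; apply.
by apply/forallP => v; apply/implyP; apply: H; rewrite finset.in_setT.
Qed.

Lemma chordal_simplification_in (G : mgraph) : loopless G ->
  chordal (simplification G) <-> chordal_in (@adj G) [set: vertex G]%SET.
Proof.
move=> ll; split=> [[_ ch] n c n3 _ [ci ca]|ch].
  by apply: (ch n c n3); split=> // i j; rewrite adj_simplification.
split; first exact: simplification_simple.
move=> n c n3 [ci ca]; apply: (ch n c n3) => [i|]; first by rewrite finset.in_setT.
by split=> // i j; rewrite -ca adj_simplification.
Qed.

Theorem corollary7 (R : realType) (G : mgraph)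
    (G_loopless : loopless G) (G_planar : planar R G) :
  [/\ only_real_chromatic_roots R G <-> only_integral_chromatic_roots R G,
      only_integral_chromatic_roots R G <-> chordal (simplification G)
    & only_real_chromatic_roots R G ->
        forall z : R[i], chromatic_root G z -> z \in [:: 0; 1; 2; 3]].
Proof.
have [lt [n pl]] := planar_crossing_parity G_planar.
have es := @adj_sym G; have ei := adj_irr G_loopless.
have P := chromatic_adj G.
have small : chordal (simplification G) -> forall z : R[i], chromatic_root G z ->
    exists2 i : nat, (i < 4)%N & z = i%:R.
  move=> /(chordal_simplification_in G_loopless) ch z.
  exact: (chordal_planar_roots es ei pl ch P).
have real_chordal : only_real_chromatic_roots R G -> chordal (simplification G).
  move=> real; apply/(chordal_simplification_in G_loopless).
  exact: (real_roots_chordal es ei pl P real).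
have int_real : only_integral_chromatic_roots R G -> only_real_chromatic_roots R G.
  by move=> int z /int[m ->]; apply: realz.
have chordal_int : chordal (simplification G) -> only_integral_chromatic_roots R G.
  by move=> ch z /(small ch)[i _ ->]; exists i.
split.
- by split=> [/real_chordal/chordal_int|/int_real].
- by split=> [/int_real/real_chordal|/chordal_int].
move=> /real_chordal ch z /(small ch)[[|[|[|[|//]]]] _ ->];
  by rewrite !inE eqxx ?orbT.
Qed.
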